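(* Let $\nu>0$, $a>0$ and $b\in[0,a)$. Then (i) $\displaystyle\lim_{t\to\infty} t^{\nu}\,P^{(\nu)}_a(\infty>\tau_b>t)=\frac{1}{2^{\nu}\Gamma(\nu+1)}\,b^{2\nu}\Big\{1-\Big(\frac{b}{a}\Big)^{2\nu}\Big\}$; (ii) $\displaystyle\lim_{t\to\infty} t^{\nu}\,P^{(-\nu)}_a(\tau_b>t)=\frac{1}{2^{\nu}\Gamma(\nu+1)}\,a^{2\nu}\Big\{1-\Big(\frac{b}{a}\Big)^{2\nu}\Big\}$.
   Context: For $\mu\in\mathbb{R}$ and $x>0$, $P^{(\mu)}_x$ denotes the law on $\Omega=C([0,\infty);\mathbb{R})$ of the Bessel process with index $\mu$ (dimension $2(\mu+1)$) started at $x$; $R$ is the coordinate process on $\Omega$. For $b\ge 0$, $\tau_b=\inf\{t\ge0: R_t=b\}$ (with $\inf\emptyset=\infty$). $\Gamma$ is the gamma function. *)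

(* Defs.v *)
From Stdlib Require List.
From HB Require Import structures.
From mathcomp Require Import all_boot all_order all_algebra.
From mathcomp Require Import all_classical all_reals all_analysis.
Set Implicit Arguments. Unset Strict Implicit. Unset Printing Implicit Defensive.
Import Order.TTheory GRing.Theory Num.Theory.
Import numFieldNormedType.Exports.
Local Open Scope classical_set_scope.
Local Open Scope ring_scope.

Section Defs.
Variable R : realType.

(* Gamma function, Euler integral (used only at arguments > 0). *)
Definition Gamma (s : R) : R :=
  Rintegral lebesgue_measure `]0, +oo[%classic (fun x => x `^ (s - 1) * expR (- x)).

Definition besselI (mu z : R) : R :=
  limn (series (fun k : nat =>
    (z / 2) `^ (2 * k%:R + mu) / (k`!%:R * Gamma (k%:R + mu + 1)))).

(* Transition density (w.r.t. Lebesgue measure dy on (0,oo)) of the Bessel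
   process of index mu killed at its first hitting time of 0:
   q_t(x,y) = (y/t) (y/x)^mu exp(-(x^2+y^2)/(2t)) I_{|mu|}(xy/t). *)
Definition bessel_q (mu t x y : R) : R :=
  (y / t) * (y / x) `^ mu * expR (- (x ^+ 2 + y ^+ 2) / (2 * t))
  * besselI `|mu| (x * y / t).

(* Path space Omega = C([0,oo); R): a path is represented by a function
   R -> R continuous on [0,oo) and constant (= w 0) on (-oo,0). *)
Definition cpath_prop (w : R -> R) : Prop :=
  {within `[0, +oo[%classic, continuous w} /\ (forall t, t < 0 -> w t = w 0).

Record cpath := CPath { path_of :> R -> R; path_ofP : cpath_prop path_of }.

Lemma cpath_prop0 : cpath_prop (fun _ => 0).
Proof. split; last by []. by move=> x; apply: cvg_cst. Qed.

HB.instance Definition _ := gen_eqMixin cpath.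
HB.instance Definition _ := gen_choiceMixin cpath.
HB.instance Definition _ := isPointed.Build cpath (CPath cpath_prop0).

Definition coord_sets : set (set cpath) :=
  [set A | exists (t : R) (B : set R), measurable B /\
           A = (fun w : cpath => w t) @^-1` B].

Definition Omega := g_sigma_algebraType coord_sets.

Definition hit (b : R) (w : Omega) : \bar R :=
  ereal_inf [set s%:E | s in [set s : R | 0 <= s /\ path_of w s = b]].

Fixpoint fdd (mu x s : R) (l : seq (R * set R)) : \bar R :=
  match l with
  | [::] => 1%E
  | (t, A) :: l' =>
      (\int[lebesgue_measure]_(y in A) ((bessel_q mu (t - s) x y)%:E * fdd mu y t l'))%E
  end.

Definition last_time (l : seq (R * set R)) : R := last 0 (map fst l).

(* P is the law P^(mu)_x of the Bessel process of index mu started at x,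
   as seen up to its first hitting time of 0 (which is all that matters
   for hitting times of levels b in [0, x)). *)
Definition bessel_law (mu x : R) (P : probability Omega R) : Prop :=
  P [set w : Omega | path_of w 0 = x] = 1%E /\
  forall l : seq (R * set R),
    sorted (fun p q => p.1 < q.1) l ->
    (forall p, List.In p l -> 0 < p.1 /\ measurable p.2 /\ p.2 `<=` `]0, +oo[%classic) ->
    P [set w : Omega | ((last_time l)%:E < hit 0 w)%E /\
                       forall p, List.In p l -> p.2 (path_of w p.1)]
    = fdd mu x 0 l.

End Defs.

(* Main.v *)
(* For the process of index [- nu] the hitting time of 0 has an explicit density,
   whose tail [survival] behaves like [x ^ (2 nu) t ^ (- nu) / (2 ^ nu Gamma (nu + 1))].
   A path alive at time [t] has either stayed above [b], or has passed below [b]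
   and survived from there; by continuity it does so from a point close to [b],
   which contributes the tail of a process started at [b].  Hence [P (tau_b > t)]
   is asymptotically the difference of the two tails.
   This first-passage decomposition is made rigorous on the dyadic grids
   [t / 2 ^ n], where the event of staying above [b] is an iterated integral
   [kiter] of the transition kernel.  The process of index [nu] is the h-transform
   of the former by [x ^ (2 nu)]; the same decomposition applied to that harmonic
   function gives
   [P^(nu) (tau_b > t) = 1 - (b / a) ^ (2 nu) * P^(-nu) (tau_b <= t)]. *)
Require Import Defs.
From HB Require Import structures.
From mathcomp Require Import all_boot all_order all_algebra.
From mathcomp Require Import all_classical all_reals all_analysis.
From mathcomp Require Import measurable_realfun ring lra.
Import Order.TTheory GRing.Theory Num.Theory.
Import numFieldNormedType.Exports.
Local Open Scope classical_set_scope.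
Local Open Scope ring_scope.

(** * First-passage inequalities for iterates of a sub-Markov kernel *)

Section sub_markov_kernel.
Context (R : realType).
Local Open Scope ereal_scope.
Notation lm := (@lebesgue_measure R).
Notation pos := (`]0%R, +oo[%classic : set R).

(** A [bessel_law] gives finite-dimensional distributions only, so no strong Markov property at
    [tau_b] is at hand: all estimates are made for the sampled chain, at fixed [t], and the grid is
    refined before [t] grows. Two obstacles shape them. The chain jumps across the level instead of
    touching it. For an upper bound on what follows the passage this is harmless, since a start in
    (0, b] has a tail bounded through [b]. For a lower bound the landing point must lie in (b', b]
    for some b' < b; jumps that miss this window cost O(dl^2) each, and b' tends to [b] once the
    grid has been refined. The tail estimate also degrades when the passage is late and little time
    is left. A late passage however requires survival over a fixed fraction of [t], so its
    contribution is a product of two tails, of order t^(-2 nu). For the upper bound on P (tau_b > t)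
    the fraction is one half; for the lower bound it is 2^-r, and [r] tends to infinity after
    [t]. *)

Definition kint (q : R -> R -> R) (A : set R) (f : R -> \bar R) (x : R) : \bar R :=
  \int[lm]_(y in A) ((q x y)%:E * f y).

Fixpoint kiter (q : R -> R -> R) (A : set R) (f : R -> \bar R) (n : nat) : R -> \bar R :=
  if n is m.+1 then kint q A (kiter q A f m) else f.

Variable q : R -> R -> R.
Hypothesis mq : measurable_fun setT (fun z : R * R => q z.1 z.2).
Hypothesis q0 : forall x y, (0 < y)%R -> (0 <= q x y)%R.

Lemma measurable_kernel_mul (A : set R) (f : R -> \bar R) (x : R) :
  measurable A -> A `<=` pos -> measurable_fun pos f ->
  measurable_fun A (fun y => (q x y)%:E * f y).
Proof.
move=> mA Ap mf; apply: emeasurable_funM.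
  apply/measurable_EFinP; apply: (@measurable_funS _ _ _ _ setT) => //.
  exact: (measurableT_comp mq (pair1_measurable x)).
by apply: measurable_funS mf.
Qed.

Lemma posP (y : R) : pos y = (0 < y)%R.
Proof. by rewrite /= in_itv /= andbT. Qed.

Lemma kernel_mul_ge0 (A : set R) (f : R -> \bar R) (x : R) :
  A `<=` pos -> (forall y, (0 < y)%R -> 0 <= f y) ->
  forall y, A y -> 0 <= (q x y)%:E * f y.
Proof.
by move=> Ap f0 y /Ap; rewrite posP => y0; rewrite mule_ge0 ?lee_fin ?q0 ?f0.
Qed.

Lemma kint_ge0 A f x : A `<=` pos -> (forall y, (0 < y)%R -> 0 <= f y) ->
  0 <= kint q A f x.
Proof. by move=> Ap f0; apply: integral_ge0; exact: kernel_mul_ge0. Qed.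

Lemma measurable_kint A f : measurable A -> A `<=` pos ->
  measurable_fun pos f -> (forall y, (0 < y)%R -> 0 <= f y) ->
  measurable_fun setT (kint q A f).
Proof.
move=> mA Ap mf f0; rewrite /kint.
pose F (z : R * R) : \bar R := (q z.1 z.2 * \1_A z.2)%:E * (f \_ A) z.2.
have -> : (fun x => \int[lm]_(y in A) ((q x y)%:E * f y)) =
    (fun x => \int[lm]_y F (x, y)).
  apply/funext => x; rewrite integral_mkcond; apply: eq_integral => y _.
  rewrite /F /= !patchE indicE; case: ifPn => yA; last by rewrite mule0.
  by rewrite mulr1.
apply: (@measurable_fun_fubini_tonelli_F _ _ _ _ _ lm F).
- apply: emeasurable_funM.
    apply/measurable_EFinP; apply: measurable_funM => //.
    by apply: measurableT_comp => //; exact: measurable_indic.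
  apply: measurableT_comp => //.
  by apply/(measurable_restrictT _ mA); apply: measurable_funS mf.
- move=> [x y]; rewrite /F /= indicE patchE; case: ifPn => yA; last by rewrite mule0.
  have /Ap := set_mem yA; rewrite posP => y0.
  by rewrite mulr1 mule_ge0 ?lee_fin ?q0 ?f0.
Qed.

Lemma le_kint A f g x : measurable A -> A `<=` pos ->
  measurable_fun pos f -> measurable_fun pos g ->
  (forall y, (0 < y)%R -> 0 <= f y) -> (forall y, A y -> f y <= g y) ->
  kint q A f x <= kint q A g x.
Proof.
move=> mA Ap mf mg f0 fg; apply: ge0_le_integral => //.
- exact: kernel_mul_ge0.
- exact: measurable_kernel_mul.
- exact: measurable_kernel_mul.
- move=> y Ay; rewrite lee_wpmul2l ?fg// lee_fin q0//.
  by move: (Ap _ Ay); rewrite posP.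
Qed.

Lemma kintD A f g x : measurable A -> A `<=` pos ->
  measurable_fun pos f -> measurable_fun pos g ->
  (forall y, (0 < y)%R -> 0 <= f y) -> (forall y, (0 < y)%R -> 0 <= g y) ->
  kint q A (fun y => f y + g y) x = kint q A f x + kint q A g x.
Proof.
move=> mA Ap mf mg f0 g0; rewrite /kint -ge0_integralD//.
- apply: eq_integral => y /[!inE] /Ap; rewrite posP => y0.
  by rewrite ge0_muleDr ?f0 ?g0.
- exact: kernel_mul_ge0.
- exact: measurable_kernel_mul.
- exact: kernel_mul_ge0.
- exact: measurable_kernel_mul.
Qed.

Lemma kintZ A (c : R) f x : measurable A -> A `<=` pos -> (0 <= c)%R ->
  measurable_fun pos f -> (forall y, (0 < y)%R -> 0 <= f y) ->
  kint q A (fun y => c%:E * f y) x = c%:E * kint q A f x.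
Proof.
move=> mA Ap c0 mf f0; rewrite /kint -ge0_integralZl//.
- by apply: eq_integral => y _; rewrite muleCA.
- exact: measurable_kernel_mul.
- exact: kernel_mul_ge0.
Qed.

Lemma kint_cst A (c : R) x : measurable A -> A `<=` pos -> (0 <= c)%R ->
  kint q A (cst c%:E) x = c%:E * kint q A (cst 1) x.
Proof.
move=> mA Ap c0; rewrite -kintZ//.
by rewrite /kint; apply: eq_integral => y _; rewrite /cst mule1.
Qed.

Lemma kintU A B f x : measurable A -> measurable B -> A `<=` pos -> B `<=` pos ->
  [disjoint A & B] -> measurable_fun pos f -> (forall y, (0 < y)%R -> 0 <= f y) ->
  kint q (A `|` B) f x = kint q A f x + kint q B f x.
Proof.
move=> mA mB Ap Bp AB mf f0; rewrite /kint ge0_integral_setU//.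
- apply: measurable_kernel_mul => //; first exact: measurableU.
  by rewrite subUset.
- by apply: kernel_mul_ge0 => //; rewrite subUset.
Qed.

Lemma kiter_ge0 A f n : A `<=` pos -> (forall y, (0 < y)%R -> 0 <= f y) ->
  forall x, (0 < x)%R -> 0 <= kiter q A f n x.
Proof. by move=> Ap f0; elim: n => //= n IH x x0; exact: kint_ge0. Qed.

Lemma measurable_kiter A f n : measurable A -> A `<=` pos ->
  measurable_fun pos f -> (forall y, (0 < y)%R -> 0 <= f y) ->
  measurable_fun pos (kiter q A f n).
Proof.
move=> mA Ap mf f0; elim: n => //= n IH.
apply: (@measurable_funS _ _ _ _ setT) => //.
by apply: measurable_kint => //; exact: kiter_ge0.
Qed.

Variable b : R.
Hypothesis b0 : (0 <= b)%R.
Notation above := (`]b, +oo[%classic : set R).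
Notation below := (`]0%R, b]%classic : set R).

Lemma above_pos : above `<=` pos.
Proof. by move=> y; rewrite /= !in_itv/= !andbT; exact: le_lt_trans. Qed.

Lemma below_pos : below `<=` pos.
Proof. by move=> y; rewrite /= !in_itv/= !andbT => /andP[]. Qed.

Lemma kint_split f x : measurable_fun pos f -> (forall y, (0 < y)%R -> 0 <= f y) ->
  kint q pos f x = kint q below f x + kint q above f x.
Proof.
move=> mf f0; rewrite -kintU//.
- congr kint; apply/seteqP; split=> y; rewrite /= !in_itv/= !andbT.
    by move=> y0; have [yb|yb] := leP y b; [left|right]; rewrite ?y0.
  by move=> [/andP[]//|]; exact: le_lt_trans.
- exact: below_pos.
- exact: above_pos.
- rewrite disj_set2E; apply/eqP/seteqP; split=> y //=.
  by rewrite !in_itv/= => -[/andP[_ yb]]; rewrite andbT ltNge yb.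
Qed.

Lemma kiter_one_le1 n x : (forall x, (0 < x)%R -> kint q pos (cst 1) x <= 1) ->
  (0 < x)%R -> kiter q above (cst 1) n x <= 1.
Proof.
move=> q1; elim: n x => [//|n IH] x x0 /=.
apply: le_trans (q1 x x0); rewrite (kint_split (cst 1))//.
apply: (@le_trans _ _ (kint q above (cst 1) x)); last first.
  by rewrite leeDr//; apply: kint_ge0 => //; exact: below_pos.
have ab := above_pos.
apply: le_kint => //; first exact: measurable_kiter.
  exact: kiter_ge0.
by move=> y /ab; rewrite posP; exact: IH.
Qed.

Let D := kiter q above (cst 1).

(** Read as F_k <= A_k + L (1 - D_k): a path either stays above [b], which [A] accounts for, or
    falls and then contributes at most [L]. Mass lost by the kernel only helps, so total mass at
    most 1 suffices. The sums are arranged to avoid subtraction in the extended reals. *)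
Lemma first_passage_lower (F A : nat -> R -> \bar R) (L : R) :
  (forall x, (0 < x)%R -> kint q pos (cst 1) x <= 1) ->
  (0 <= L)%R ->
  (forall k, measurable_fun pos (F k)) ->
  (forall k x, (0 < x)%R -> 0 <= F k x) ->
  measurable_fun pos (A 0%N) -> (forall x, (0 < x)%R -> 0 <= A 0%N x) ->
  (forall k x, A k.+1 x = kint q above (A k) x) ->
  (forall k x, (0 < x)%R -> F k.+1 x <= kint q pos (F k) x) ->
  (forall k x, (0 < x <= b)%R -> F k x <= L%:E) ->
  (forall x, (0 < x)%R -> F 0%N x <= A 0%N x) ->
  forall k x, (0 < x)%R -> F k x + L%:E * D k x <= A k x + L%:E.
Proof.
move=> q1 L0 mF F0 mA0 A0 Arec Frec FL FA.
have Aiter k : A k = kiter q above (A 0%N) k.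
  by elim: k => // k IH; apply/funext => x; rewrite Arec /= IH.
have mA k : measurable_fun pos (A k).
  by rewrite Aiter; apply: measurable_kiter => //; exact: above_pos.
have Age0 k x : (0 < x)%R -> 0 <= A k x.
  by rewrite Aiter; apply: kiter_ge0 => //; exact: above_pos.
have mD k : measurable_fun pos (D k).
  by apply: measurable_kiter => //; exact: above_pos.
have D0 k x : (0 < x)%R -> 0 <= D k x.
  by apply: kiter_ge0 => //; exact: above_pos.
have ab := above_pos; have be := below_pos.
elim=> [|k IH] x x0.
  by rewrite mule1 leeD2r// FA.
have F0k := F0 k; have A0k := Age0 k; have D0k := D0 k.
have mFk := mF k; have mAk := mA k; have mDk := mD k.
have LD y : (0 < y)%R -> 0 <= L%:E * D k y.
  by move=> y0; rewrite mule_ge0 ?D0.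
have mLD : measurable_fun pos (fun y => L%:E * D k y) by exact: measurable_funeM.
apply: (@le_trans _ _ (kint q pos (F k) x + L%:E * D k.+1 x)).
  by rewrite leeD2r// Frec.
have -> : D k.+1 x = kint q above (D k) x by [].
rewrite kint_split// -kintZ// -addeA -kintD//.
apply: (@le_trans _ _ (kint q below (cst L%:E) x + kint q above (fun y => A k y + L%:E) x)).
  apply: leeD; apply: le_kint => //.
  - by move=> y; rewrite /= in_itv/= => /andP[y0 yb]; apply: FL; rewrite y0.
  - exact: emeasurable_funD.
  - exact: emeasurable_funD.
  - by move=> y y0; rewrite adde_ge0 ?F0 ?LD.
  - by move=> y /ab; rewrite posP; exact: IH.
rewrite kintD// [_ + kint _ _ (fun=> _) _]addeC addeA [kint _ _ _ _ + _]addeC.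
rewrite [X in X + _ <= _]addeC -(kint_split (cst L%:E))// addeC -Arec leeD2l//.
by rewrite kint_cst// -[leRHS]mule1 lee_wpmul2l// q1.
Qed.

(** Read as F_k >= A_k + L (1 - D_k) - L k eta. A fall contributes at least [L] only if it lands in
    (b', b]; [eta] bounds the mass that one step from above [b] kills or sends below b', and it is
    paid at each of the [k] steps. *)
Lemma first_passage_upper (F A : nat -> R -> \bar R) (L b' eta : R) :
  (0 < b' < b)%R -> (0 <= eta)%R ->
  (forall x, (0 < x)%R -> kint q pos (cst 1) x <= 1) ->
  (forall x, (b < x)%R -> 1 <= kint q `]b', +oo[ (cst 1) x + eta%:E) ->
  (0 <= L)%R ->
  (forall k, measurable_fun pos (F k)) ->
  (forall k x, (0 < x)%R -> 0 <= F k x) ->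
  measurable_fun pos (A 0%N) -> (forall x, (0 < x)%R -> 0 <= A 0%N x) ->
  (forall k x, A k.+1 x = kint q above (A k) x) ->
  (forall k x, (0 < x)%R -> kint q pos (F k) x <= F k.+1 x) ->
  (forall x, (0 < x)%R -> A 0%N x <= F 0%N x) ->
  forall k, (forall i x, (i < k)%N -> (b' < x <= b)%R -> L%:E <= F i x) ->
  forall x, (b < x)%R ->
    A k x + L%:E <= F k x + L%:E * D k x + (L * k%:R * eta)%:E.
Proof.
move=> /andP[b'0 b'b] eta0 q1 qeta L0 mF F0 mA0 A0 Arec Frec FA.
have Aiter k : A k = kiter q above (A 0%N) k.
  by elim: k => // k IH; apply/funext => x; rewrite Arec /= IH.
have mA k : measurable_fun pos (A k).
  by rewrite Aiter; apply: measurable_kiter => //; exact: above_pos.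
have Age0 k x : (0 < x)%R -> 0 <= A k x.
  by rewrite Aiter; apply: kiter_ge0 => //; exact: above_pos.
have mD k : measurable_fun pos (D k).
  by apply: measurable_kiter => //; exact: above_pos.
have D0 k x : (0 < x)%R -> 0 <= D k x.
  by apply: kiter_ge0 => //; exact: above_pos.
have ab := above_pos; have be := below_pos.
pose mid := `]b', b]%classic : set R.
have mmid : measurable mid by exact: measurable_itv.
have mpos : mid `<=` pos.
  by move=> y; rewrite /mid /= !in_itv/= andbT => /andP[/(lt_trans b'0)].
elim=> [|k IH] FL x bx; have x0 := le_lt_trans b0 bx.
  by rewrite mulr0 mul0r adde0 mule1 leeD2r// FA.
have F0k := F0 k; have A0k := Age0 k; have D0k := D0 k.
have mFk := mF k; have mAk := mA k; have mDk := mD k.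
have LD y : (0 < y)%R -> 0 <= L%:E * D k y.
  by move=> y0; rewrite mule_ge0 ?D0.
have mLD : measurable_fun pos (fun y => L%:E * D k y) by exact: measurable_funeM.
have Lk0 : (0 <= L * k%:R * eta)%R by rewrite !mulr_ge0.
apply: (@le_trans _ _ (kint q pos (F k) x + L%:E * D k.+1 x + (L * k.+1%:R * eta)%:E)); last first.
  by rewrite leeD2r// leeD2r// Frec.
have -> : D k.+1 x = kint q above (D k) x by [].
rewrite kint_split// -kintZ//.
have Ldec : (L * k.+1%:R * eta)%:E = (L * k%:R * eta)%:E + (L * eta)%:E.
  by rewrite -EFinD -natr1; congr EFin; ring.
rewrite Ldec.
have ab1 : kint q above (cst 1) x <= 1.
  apply: le_trans (q1 _ x0); rewrite (kint_split (cst 1))// leeDr//.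
  exact: kint_ge0.
(* The constant [L] is spread over the mass on (b', oo), at the price [L * eta]: the share on [mid]
   pays for the falls at this step, the share on [above] feeds the induction hypothesis. *)
apply: (@le_trans _ _ (kint q mid (cst L%:E) x + kint q above (fun y => A k y + L%:E) x + (L * eta)%:E)).
  rewrite (kintD above (A k) (cst L%:E))//.
  rewrite Arec [X in _ <= X + _]addeCA.
  rewrite -[X in _ <= X]addeA.
  apply: leeD2l.
  have k1 : forall y : R, (0 < y)%R -> 0 <= cst L%:E y by [].
  rewrite -(kintU mid above (cst L%:E))//; last first.
    rewrite disj_set2E; apply/eqP/seteqP; split=> y //=.
    by rewrite /mid /= !in_itv/= => -[/andP[_ yb]]; rewrite andbT ltNge yb.
  have -> : mid `|` above = `]b', +oo[%classic.
    apply/seteqP; split=> y; rewrite /mid /= !in_itv/= !andbT.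
      by move=> [/andP[]//|]; exact: lt_trans.
    by move=> b'y; have [yb|yb] := leP y b; [left|right]; rewrite ?b'y.
  have b'pos : `]b', +oo[%classic `<=` pos.
    by move=> y; rewrite /= !in_itv/= !andbT; exact: lt_trans.
  rewrite (kint_cst `]b', +oo[%classic)//.
  have M0 : 0 <= kint q `]b', +oo[ (cst 1) x by apply: kint_ge0.
  rewrite EFinM -(@muleDr _ L%:E (kint q `]b', +oo[ (cst 1) x) eta%:E)//; last first.
    exact: ge0_adde_def.
  by rewrite -[leLHS]mule1; apply: lee_wpmul2l => //; exact: qeta.
rewrite (addeA _ (L * k%:R * eta)%:E) leeD2r//.
have hmid : kint q mid (cst L%:E) x <= kint q below (F k) x.
  apply: (@le_trans _ _ (kint q mid (F k) x)).
    by apply: le_kint => // y; rewrite /mid /= in_itv/=; exact: FL.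
  apply: ge0_subset_integral => //.
  - exact: measurable_kernel_mul.
  - exact: kernel_mul_ge0.
  - by move=> y; rewrite /mid /= !in_itv/= => /andP[b'y ->]; rewrite (lt_trans b'0).
rewrite [leRHS](_ : _ = kint q below (F k) x + (kint q above (F k) x +
    (kint q above (fun y => L%:E * D k y) x + (L * k%:R * eta)%:E))); last first.
  by rewrite !addeA.
apply: (leeD hmid).
rewrite addeA -kintD//.
apply: (@le_trans _ _ (kint q above (fun y => F k y + L%:E * D k y + (L * k%:R * eta)%:E) x)).
  apply: le_kint => //.
  - exact: emeasurable_funD.
  - by apply: emeasurable_funD => //; exact: emeasurable_funD.
  - by move=> y y0; rewrite adde_ge0 ?Age0 ?lee_fin.
  - by move=> y; rewrite /= in_itv/= andbT; apply: IH => i z ik; apply: FL; exact: ltnW.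
have mFL : measurable_fun pos (fun y => F k y + L%:E * D k y).
  exact: emeasurable_funD.
have FL0 : forall y : R, (0 < y)%R -> 0 <= F k y + L%:E * D k y.
  by move=> y y0; rewrite adde_ge0 ?F0k ?LD.
rewrite (kintD _ (fun y => F k y + L%:E * D k y) (cst (L * k%:R * eta)%:E))//.
rewrite leeD2l// kint_cst// -[leRHS]mule1 lee_wpmul2l//.
Qed.

End sub_markov_kernel.

Arguments kint {R}.
Arguments kiter {R}.

Set Implicit Arguments.
Unset Strict Implicit.

(** * Integration and changes of variables on the positive half-line *)

Section half_line_calculus.
Context (R : realType).
Local Open Scope ereal_scope.
Notation lm := (@lebesgue_measure R).
Notation pos := (`]0%R, +oo[%classic : set R).
Implicit Types (h k F G f g : R -> R) (x y : R).

Definition seg (n : nat) : set R := `[n.+1%:R^-1%R, n.+1%:R%R]%classic.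

Lemma seg_mono (m n : nat) : (m <= n)%N -> seg m `<=` seg n.
Proof.
move=> mn x; rewrite /seg /= !in_itv/= => /andP[mx xm]; apply/andP; split.
  by apply: le_trans mx; rewrite lef_pV2 ?posrE// ler_nat.
by apply: le_trans xm _; rewrite ler_nat.
Qed.

Lemma nat_above x : exists n : nat, (x <= n.+1%:R)%R.
Proof.
exists (Num.truncn `|x|); apply: le_trans (ler_norm _) _.
exact/ltW/truncnS_gt.
Qed.

Lemma bigcup_seg : \bigcup_n seg n = pos.
Proof.
apply/seteqP; split => x /=.
  move=> [n _]; rewrite /seg /= !in_itv/= andbT => /andP[+ _].
  by apply: lt_le_trans; rewrite invr_gt0.
rewrite in_itv/= andbT => x0.
have [m xm] := nat_above x; have [n xn] := nat_above x^-1.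
exists (maxn m n) => //; rewrite /seg /= in_itv/=; apply/andP; split.
  rewrite -[leRHS]invrK lef_pV2 ?posrE ?invr_gt0//.
  by apply: (le_trans xn); rewrite ler_nat ltnS leq_maxr.
by apply: (le_trans xm); rewrite ler_nat ltnS leq_maxl.
Qed.

Lemma cvg_integral_exhaust (T : nat -> set R) (h : R -> R) :
  (forall n, measurable (T n)) -> (forall m n, (m <= n)%N -> T m `<=` T n) ->
  \bigcup_n T n = pos ->
  measurable_fun pos h -> (forall x, (0 < x)%R -> (0 <= h x)%R) ->
  \int[lm]_(x in T n) (h x)%:E @[n --> \oo] --> \int[lm]_(x in pos) (h x)%:E.
Proof.
move=> mT Tmono Tpos mh h0; rewrite -Tpos.
have Tp n : T n `<=` pos by rewrite -Tpos; exact: bigcup_sup.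
apply: ge0_nondecreasing_set_cvg_integral => //.
- by move=> m n mn; rewrite subsetEset; exact: Tmono.
- move=> n; apply/measurable_EFinP; exact: measurable_funS mh.
- by move=> n x /Tp; rewrite /= in_itv/= andbT lee_fin; exact: h0.
Qed.

Lemma cvg_integral_seg (h : R -> R) :
  measurable_fun pos h -> (forall x, (0 < x)%R -> (0 <= h x)%R) ->
  \int[lm]_(x in seg n) (h x)%:E @[n --> \oo] --> \int[lm]_(x in pos) (h x)%:E.
Proof.
move=> mh h0; apply: cvg_integral_exhaust => //.
- by move=> n; exact: measurable_itv.
- exact: seg_mono.
- exact: bigcup_seg.
Qed.

Lemma continuous_pos_measurable h :
  (forall x, (0 < x)%R -> {for x, continuous h}) -> measurable_fun pos h.
Proof.
move=> ch; apply: open_continuous_measurable_fun; first exact: interval_open.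
by move=> x; rewrite inE/= in_itv/= andbT; exact: ch.
Qed.

(** Changes of variables are made on compact segments. Here [T n] is the image of [seg n]; both
    families exhaust the half-line, and monotone convergence carries the equality over for
    nonnegative integrands. *)
Lemma integral_exhaust_eq (T : nat -> set R) (h k : R -> R) :
  (forall n, measurable (T n)) -> (forall m n, (m <= n)%N -> T m `<=` T n) ->
  \bigcup_n T n = pos ->
  (forall x, (0 < x)%R -> {for x, continuous h}) ->
  (forall x, (0 < x)%R -> {for x, continuous k}) ->
  (forall x, (0 < x)%R -> (0 <= h x)%R) -> (forall x, (0 < x)%R -> (0 <= k x)%R) ->
  (forall n, \int[lm]_(x in T n) (h x)%:E = \int[lm]_(x in seg n) (k x)%:E) ->
  \int[lm]_(x in pos) (h x)%:E = \int[lm]_(x in pos) (k x)%:E.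
Proof.
move=> mT Tm Tp ch ck h0 k0 hk.
have c1 := cvg_integral_exhaust mT Tm Tp (continuous_pos_measurable ch) h0.
have c2 := cvg_integral_seg (continuous_pos_measurable ck) k0.
rewrite (eq_cvg _ _ hk) in c1.
by rewrite -(cvg_lim _ c1)// -(cvg_lim _ c2).
Qed.

Lemma within_pos_continuous h (a b : R) : (0 < a)%R ->
  (forall x, (0 < x)%R -> {for x, continuous h}) ->
  {within `[a, b], continuous h}.
Proof.
move=> a0 ch; apply: continuous_in_subspaceT => x.
by rewrite inE/= in_itv/= => /andP[ax _]; apply: ch; exact: lt_le_trans ax.
Qed.

Lemma integral_square_subst (p : R) h : (0 < p)%R ->
  (forall x, (0 < x)%R -> {for x, continuous h}) ->
  (forall x, (0 < x)%R -> (0 <= h x)%R) ->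
  \int[lm]_(u in pos) (h u)%:E =
  \int[lm]_(y in pos) (h (p * y ^+ 2) * (2 * p * y))%:E.
Proof.
move=> p0 ch h0.
pose F y := (p * y ^+ 2)%R.
have dF : forall x, is_derive x 1%R F (2 * p * x)%R.
  move=> x; rewrite /F; apply: is_derive_eq; rewrite /GRing.scale/=; ring.
have F'E : F^`()%classic = (fun x => 2 * p * x)%R.
  by apply/funext => x; rewrite derive1E; apply: derive_val.
have cF x : {for x, continuous F}.
  by apply: differentiable_continuous; apply/derivable1_diffP; apply: ex_derive.
have F0 x : (0 < x)%R -> (0 < F x)%R by move=> x0; rewrite /F mulr_gt0// exprn_gt0.
have cF' x : {for x, continuous (fun x : R => 2 * p * x)%R}.
  by apply: cvgM; [exact: cvg_cst|exact: cvg_id].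
have n0 n : (0 < (n.+1%:R^-1 : R))%R by rewrite invr_gt0.
have nn n : ((n.+1%:R^-1 : R) <= n.+1%:R)%R.
  by apply: (@le_trans _ _ 1%R); rewrite ?invf_le1 ?ler1n.
apply: (@integral_exhaust_eq (fun n => `[F n.+1%:R^-1%R, F n.+1%:R]%classic) h
  (fun y => h (p * y ^+ 2) * (2 * p * y))%R) => //.
- move=> m n mn x; rewrite /= !in_itv/= => /andP[mx xm]; apply/andP; split.
    apply: le_trans mx; rewrite /F ler_pM2l// ler_sqr ?nnegrE//.
    by rewrite lef_pV2 ?posrE// ler_nat.
  by apply: (le_trans xm); rewrite /F ler_pM2l// ler_sqr ?nnegrE// ler_nat.
- apply/seteqP; split => x /=.
    move=> [n _]; rewrite /= !in_itv/= andbT => /andP[+ _].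
    by apply: lt_le_trans; exact: F0.
  rewrite in_itv/= andbT => x0.
  have [m xm] := nat_above (x / p); have [n xn] := nat_above (p / x).
  exists (maxn m n) => //; rewrite /= in_itv/= /F; apply/andP; split.
    rewrite exprVn ler_pdivrMr ?exprn_gt0// mulrC -ler_pdivrMr//.
    apply: (le_trans xn); apply: (@le_trans _ _ ((maxn m n).+1%:R)).
      by rewrite ler_nat ltnS leq_maxr.
    by rewrite ler_eXnr// ler1n.
  rewrite mulrC -ler_pdivrMr//.
  apply: (le_trans xm); apply: (@le_trans _ _ ((maxn m n).+1%:R)).
    by rewrite ler_nat ltnS leq_maxl.
  by rewrite ler_eXnr// ler1n.
- move=> x x0; apply: cvgM; last exact: cF'.
  by apply: (@continuous_comp _ _ _ F h); [exact: cF|apply: ch; exact: F0].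
- by move=> x x0; rewrite mulr_ge0 ?h0 ?F0// ltW// !mulr_gt0.
- move=> n; rewrite (@integration_by_substitution_increasing _ F h)//.
  + by apply: eq_integral => y _; rewrite F'E.
  + move=> x y; rewrite !in_itv/= => /andP[nx _] /andP[ny _] xy.
    rewrite /F ltr_pM2l// ltr_sqr ?nnegrE//.
      by apply: ltW; exact: lt_le_trans nx.
    by apply: ltW; exact: lt_le_trans ny.
  + by move=> x _; rewrite F'E; exact: cF'.
  + by rewrite F'E; apply/cvg_ex; eexists; apply: cvg_at_right_filter; exact: cF'.
  + by rewrite F'E; apply/cvg_ex; eexists; apply: cvg_at_left_filter; exact: cF'.
  + split.
    * by move=> x _; apply: ex_derive.
    * by apply: cvg_at_right_filter; exact: cF.
    * by apply: cvg_at_left_filter; exact: cF.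
  + by apply: within_pos_continuous => //; exact: F0.
Qed.

Lemma integral_inv_subst (c : R) h : (0 < c)%R ->
  (forall x, (0 < x)%R -> {for x, continuous h}) ->
  (forall x, (0 < x)%R -> (0 <= h x)%R) ->
  \int[lm]_(u in pos) (h u)%:E =
  \int[lm]_(r in pos) (h (c / r) * (c / r ^+ 2))%:E.
Proof.
move=> c0 ch h0.
pose F y := (c / y)%R.
have dF x : (0 < x)%R -> is_derive x 1%R F (- (c / x ^+ 2))%R.
  move=> x0; have x1 : x != 0%R by rewrite gt_eqF.
  have dx : derivable (fun y : R => y^-1)%R x 1%R by apply: derivableV.
  have dxE : is_derive x 1%R (fun y : R => y^-1)%R (- x ^- 2)%R.
    apply: DeriveDef; first exact: dx.
    by rewrite deriveV ?derive_id /GRing.scale/= ?mulr1//; exact: derivable_id.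
  rewrite /F; apply: is_derive_eq; rewrite /GRing.scale/=.
  by rewrite ?mulr0 ?addr0 ?add0r mulrN.
have F'E x : (0 < x)%R -> (F^`()%classic x = - (c / x ^+ 2))%R.
  by move=> x0; rewrite derive1E; have := dF x x0 => ?; apply: derive_val.
have cF x : (0 < x)%R -> {for x, continuous F}.
  move=> x0; apply: differentiable_continuous; apply/derivable1_diffP.
  by have := dF x x0 => ?; apply: ex_derive.
have F0 x : (0 < x)%R -> (0 < F x)%R by move=> x0; rewrite /F divr_gt0.
have cG' x : (0 < x)%R -> {for x, continuous (fun x : R => c / x ^+ 2)%R}.
  move=> x0; apply: cvgM; first exact: cvg_cst.
  apply: cvgV; first by rewrite expf_neq0// gt_eqF.
  by apply: exprn_continuous.
have cF' x : (0 < x)%R -> {for x, continuous (fun x : R => - (c / x ^+ 2))%R}.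
  by move=> x0; apply: cvgN; exact: cG'.
have F'cvg x : (0 < x)%R -> F^`()%classic z @[z --> x] --> (- (c / x ^+ 2))%R.
  move=> x0; apply: (cvg_trans _ (cF' x x0)); apply: near_eq_cvg.
  near=> z; rewrite F'E//; near: z; exact: lt_nbhsr.
have n0 n : (0 < (n.+1%:R^-1 : R))%R by rewrite invr_gt0.
have nn n : ((n.+1%:R^-1 : R) <= n.+1%:R)%R.
  by apply: (@le_trans _ _ 1%R); rewrite ?invf_le1 ?ler1n.
apply: (@integral_exhaust_eq (fun n => `[F n.+1%:R, F n.+1%:R^-1%R]%classic) h
  (fun r => h (c / r) * (c / r ^+ 2))%R) => //.
- move=> m n mn x; rewrite /= !in_itv/= /F !invrK => /andP[mx xm]; apply/andP; split.
    by apply: le_trans mx; rewrite ler_pM2l// lef_pV2 ?posrE// ler_nat.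
  by apply: (le_trans xm); rewrite ler_pM2l// ler_nat.
- apply/seteqP; split => x /=.
    move=> [n _]; rewrite /= !in_itv/= andbT => /andP[+ _].
    by apply: lt_le_trans; exact: F0.
  rewrite in_itv/= andbT => x0.
  have [m xm] := nat_above (x / c); have [n xn] := nat_above (c / x).
  exists (maxn m n) => //; rewrite /= in_itv/= /F invrK; apply/andP; split.
    rewrite ler_pdivrMr// mulrC -ler_pdivrMr//.
    by apply: (le_trans xn); rewrite ler_nat ltnS leq_maxr.
  rewrite mulrC -ler_pdivrMr//.
  by apply: (le_trans xm); rewrite ler_nat ltnS leq_maxl.
- move=> x x0; apply: cvgM; last first.
    exact: cG'.
  by apply: (@continuous_comp _ _ _ F h); [exact: cF|apply: ch; exact: F0].
- by move=> x x0; rewrite mulr_ge0 ?h0 ?F0// ltW// divr_gt0// exprn_gt0.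
- move=> n; rewrite (@integration_by_substitution_decreasing _ F h)//.
  + apply: eq_integral => y; rewrite inE /seg /= in_itv/= => /andP[ny _].
    have y0 : (0 < y)%R by exact: lt_le_trans ny.
    by rewrite (_ : ((h \o F) * - F^`()%classic)%R y = (h (F y) * - F^`()%classic y)%R)// F'E// opprK.
  + move=> x y; rewrite !in_itv/= => /andP[nx _] /andP[ny _] xy.
    rewrite /F ltr_pM2l// ltf_pV2 ?posrE//.
      by exact: lt_le_trans nx.
    by exact: lt_le_trans ny.
  + move=> x; rewrite in_itv/= => /andP[nx _]; have x0 := lt_trans (n0 n) nx.
    by rewrite /continuous_at F'E//; exact: F'cvg.
  + by apply/cvg_ex; eexists; apply: cvg_at_right_filter; exact: F'cvg.
  + by apply/cvg_ex; eexists; apply: cvg_at_left_filter; apply: F'cvg.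
  + split.
    * move=> x; rewrite in_itv/= => /andP[nx _]; have := dF x (lt_trans (n0 n) nx) => ?.
      exact: ex_derive.
    * by apply: cvg_at_right_filter; exact: cF.
    * by apply: cvg_at_left_filter; exact: cF.
  + by apply: within_pos_continuous => //; exact: F0.
Unshelve. all: by end_near. Qed.

Lemma le_integral_EFin (A : set R) f g : measurable A ->
  measurable_fun A f -> measurable_fun A g ->
  (forall x, A x -> (0 <= f x <= g x)%R) ->
  \int[lm]_(x in A) (f x)%:E <= \int[lm]_(x in A) (g x)%:E.
Proof.
move=> mA mf mg fg.
have mf' : measurable_fun A (EFin \o f) by exact/measurable_EFinP.
have mg' : measurable_fun A (EFin \o g) by exact/measurable_EFinP.
apply: (@ge0_le_integral _ _ _ lm A mA (EFin \o f) (EFin \o g) _ mf' mg').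
  by move=> x Ax; have /andP[] := fg x Ax.
by move=> x Ax; have /andP[] := fg x Ax.
Qed.

Lemma subset_integral_EFin (A B : set R) f : measurable A -> measurable B ->
  A `<=` B -> measurable_fun B f -> (forall x, B x -> (0 <= f x)%R) ->
  \int[lm]_(x in A) (f x)%:E <= \int[lm]_(x in B) (f x)%:E.
Proof.
move=> mA mB AB mf f0.
have mf' : measurable_fun B (EFin \o f) by exact/measurable_EFinP.
exact: (@ge0_subset_integral _ _ _ lm A B mA mB (EFin \o f) mf').
Qed.

Lemma integralZl_EFin_ge0 (A : set R) (c : R) f : measurable A ->
  measurable_fun A f -> (forall x, A x -> (0 <= f x)%R) -> (0 <= c)%R ->
  \int[lm]_(x in A) (c * f x)%:E = c%:E * \int[lm]_(x in A) (f x)%:E.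
Proof.
move=> mA mf f0 c0.
have mf' : measurable_fun A (EFin \o f) by exact/measurable_EFinP.
by rewrite -(@ge0_integralZl _ _ _ lm A mA (EFin \o f) mf').
Qed.

End half_line_calculus.

(** * The Gamma function and two integrals that it evaluates *)

Section gamma_function.
Context (R : realType).
Notation lm := (@lebesgue_measure R).
Notation pos := (`]0%R, +oo[%classic : set R).
Implicit Types (s p x y : R).

Lemma continuous_powR_pos p x : 0 < x -> {for x, continuous (fun y : R => y `^ p)}.
Proof.
move=> x0; apply: differentiable_continuous; apply/derivable1_diffP.
by apply: derivable_powR; rewrite in_itv/= andbT.
Qed.

Definition gamma_integrand s x := x `^ (s - 1) * expR (- x).

Lemma continuous_expRN x : {for x, continuous (fun y : R => expR (- y))}.
Proof.
apply: (@continuous_comp _ _ _ -%R expR); first exact: opp_continuous.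
exact: continuous_expR.
Qed.

Lemma continuous_gamma_integrand s x : 0 < x ->
  {for x, continuous (gamma_integrand s)}.
Proof.
move=> x0; apply: cvgM; first exact: continuous_powR_pos.
exact: continuous_expRN.
Qed.

Lemma gamma_integrand_ge0 s x : 0 <= gamma_integrand s x.
Proof. by rewrite mulr_ge0 ?powR_ge0 ?expR_ge0. Qed.

(** This is x / p <= exp (x / p) raised to the power [p]. Every later estimate that trades an
    exponential for a power comes from it, with [p] chosen to obtain the desired power of time. *)
Lemma powR_le_expR p x : 0 < p -> 0 <= x -> x `^ p <= p `^ p * expR x.
Proof.
move=> p0 x0.
have p1 : p != 0 by rewrite gt_eqF.
have -> : x `^ p = p `^ p * (x / p) `^ p.
  by rewrite -powRM ?divr_ge0 ?(ltW p0)// mulrCA divff// mulr1.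
rewrite ler_pM2l ?powR_gt0//.
have -> : expR x = expR (x / p) `^ p by rewrite -expRM mulfVK.
apply: ge0_ler_powR; rewrite ?nnegrE ?divr_ge0 ?expR_ge0 ?(ltW p0)//.
by apply: le_trans (expR_ge1Dx _); rewrite lerDr.
Qed.

Local Open Scope ereal_scope.

Definition egamma s : \bar R := \int[lm]_(x in pos) (gamma_integrand s x)%:E.

Lemma seg_bounds (n : nat) : (0 < n.+1%:R^-1 :> R)%R /\ (n.+2%:R^-1 < n.+2%:R :> R)%R.
Proof.
split; first by rewrite invr_gt0.
by apply: (@lt_trans _ _ 1%R); rewrite ?invf_lt1 ?ltr1n.
Qed.

Lemma cvg_gamma_boundary s : (0 < s)%R ->
  (n.+2%:R^-1 `^ s * expR (- n.+2%:R^-1) - n.+2%:R `^ s * expR (- n.+2%:R))%R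
    @[n --> \oo] --> 0%R.
Proof.
move=> s0; rewrite -(subr0 0%R).
have ch : (n.+2%:R^-1 : R)%R @[n --> \oo] --> 0%R.
  by have := @cvg_harmonic R; rewrite -(cvg_shiftn 1); under eq_fun do rewrite addn1.
apply: cvgB.
- apply: (@squeeze_cvgr _ _ _ _ (fun=> 0%R) (fun n : nat => n.+2%:R^-1 `^ s)%R).
  + near=> n; rewrite mulr_ge0 ?powR_ge0 ?expR_ge0//=.
    have e1 : (expR (- (n.+2%:R^-1 : R)) <= 1)%R by rewrite -expR0 ler_expR oppr_le0 invr_ge0.
    by rewrite -[leRHS]mulr1; apply: ler_wpM2l; rewrite ?powR_ge0.
  + exact: cvg_cst.
  + by apply: (cvg_at_rightP _ _ _).1 (powR_cvg0 s0) _ _; split.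
- have s1 : (0 < s + 1)%R by rewrite ltr_wpDl// ltW.
  apply: (@squeeze_cvgr _ _ _ _ (fun=> 0%R)
    (fun n : nat => (s + 1) `^ (s + 1) * n.+2%:R^-1)%R).
  + near=> n; rewrite mulr_ge0 ?powR_ge0 ?expR_ge0//=.
    have n2 : (0 < n.+2%:R :> R)%R by [].
    rewrite ler_pdivlMr// -mulrA [(expR _ * _)%R]mulrC mulrA.
    rewrite expRN ler_pdivrMr ?expR_gt0//.
    have -> : (n.+2%:R `^ s * n.+2%:R = n.+2%:R `^ (s + 1) :> R)%R.
      by rewrite powRD ?powRr1// [_ == 0%R]gt_eqF ?implybT.
    exact: powR_le_expR.
  + exact: cvg_cst.
  + by rewrite -[X in _ --> X](mulr0 ((s + 1)%R `^ (s + 1)%R)%R); apply: cvgMr.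
Unshelve. all: by end_near. Qed.

(** Integration by parts on each segment, then a limit in the extended reals: the functional
    equation precedes finiteness and serves to prove it. *)
Lemma egammaS s : (0 < s)%R -> egamma (s + 1) = s%:E * egamma s.
Proof.
move=> s0.
pose B n : R := (n.+2%:R^-1 `^ s * expR (- n.+2%:R^-1) - n.+2%:R `^ s * expR (- n.+2%:R))%R.
(* The index is shifted because [seg 0] is the single point 1, whereas integration by parts is
   applied on a segment of positive length. *)
have part (n : nat) : \int[lm]_(x in @seg R n.+1) (gamma_integrand (s + 1) x)%:E =
    (B n)%:E + s%:E * \int[lm]_(x in @seg R n.+1) (gamma_integrand s x)%:E.
  have [n0 nn] := seg_bounds n.
  have n20 : (0 < n.+2%:R^-1 :> R)%R by rewrite invr_gt0.
  have ipos x : x \in `]n.+2%:R^-1%R, n.+2%:R%R[ -> (0 < x)%R.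
    by rewrite in_itv/= => /andP[/(lt_trans n20)].
  have dG x : is_derive x 1%R (fun y => - expR (- y))%R (expR (- x)).
    by apply: is_derive_eq; rewrite /GRing.scale/=; ring.
  have cG x : {for x, continuous (fun y : R => - expR (- y))%R}.
    by apply: cvgN; exact: continuous_expRN.
  transitivity (\int[lm]_(x in @seg R n.+1) (x `^ s * expR (- x))%:E).
    by apply: eq_integral => x _; rewrite /gamma_integrand addrK.
  rewrite /seg (@integration_by_parts R (fun y => y `^ s)%R (fun y => - expR (- y))%R
      (fun y => s * y `^ (s - 1))%R (fun y => expR (- y)))//; last 6 first.
  - apply: within_pos_continuous => // x x0; apply: cvgM; first exact: cvg_cst.
    exact: continuous_powR_pos.
  - split.
    + by move=> x /ipos x0; apply: derivable_powR; rewrite in_itv/= andbT.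
    + by apply: cvg_at_right_filter; exact: continuous_powR_pos.
    + by apply: cvg_at_left_filter; exact: continuous_powR_pos.
  - by move=> x /ipos x0; apply: powR_derive1; rewrite in_itv/= andbT.
  - by apply: within_pos_continuous => // x x0; exact: continuous_expRN.
  - split.
    + by move=> x _; have := dG x => ?; exact: ex_derive.
    + by apply: cvg_at_right_filter; exact: cG.
    + by apply: cvg_at_left_filter; exact: cG.
  - by move=> x _; rewrite derive1E; have := dG x => ?; exact: derive_val.
  congr (_ + _).
    by rewrite /B; congr EFin; rewrite !mulrN opprK addrC.
  have mg : measurable_fun (`[n.+2%:R^-1%R, n.+2%:R%R] : set R) (gamma_integrand s).
    apply: (@measurable_funS _ _ _ _ pos) => //.
      by move=> x; rewrite /= !in_itv/= andbT => /andP[/(lt_le_trans n20)].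
    by apply: continuous_pos_measurable; exact: continuous_gamma_integrand.
  rewrite -ge0_integralZl//; last 3 first.
  - exact/measurable_EFinP.
  - by move=> x _; rewrite lee_fin gamma_integrand_ge0.
  - by rewrite lee_fin ltW.
  have -> : \int[lm]_(x in `[n.+2%:R^-1%R, n.+2%:R%R]) (s * x `^ (s - 1) * - expR (- x))%:E =
      \int[lm]_(x in `[n.+2%:R^-1%R, n.+2%:R%R]) - (s%:E * (gamma_integrand s x)%:E).
    apply: eq_integral => x _; rewrite -EFinM -EFinN /gamma_integrand; congr EFin.
    by rewrite mulrA mulrN.
  rewrite integral_ge0N ?oppeK// => x _.
  by rewrite mule_ge0 ?lee_fin ?gamma_integrand_ge0// ltW.
have lim1 t : \int[lm]_(x in @seg R n.+1) (gamma_integrand t x)%:E @[n --> \oo]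
    --> egamma t.
  have := cvg_integral_seg
    (continuous_pos_measurable (fun x => @continuous_gamma_integrand t x))
    (fun x _ => gamma_integrand_ge0 t x).
  by rewrite -(cvg_shiftn 1); under eq_fun do rewrite addn1.
have c1 := lim1 (s + 1)%R.
rewrite (eq_cvg _ _ part) in c1.
have : (B n)%:E + s%:E * \int[lm]_(x in @seg R n.+1) (gamma_integrand s x)%:E
    @[n --> \oo] --> 0 + s%:E * egamma s.
  apply: cvgeD.
  - by first [exact: fin_num_adde_defr|exact: fin_num_adde_defl].
  - by apply: cvg_EFin; [near=> n|exact: cvg_gamma_boundary].
  - by apply: cvgeZl; [|exact: lim1].
by rewrite add0e => c2; rewrite -(cvg_lim _ c1)// -(cvg_lim _ c2).
Unshelve. all: by end_near. Qed.

Lemma integral_expRN_half :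
  \int[lm]_(x in pos) (expR (- (x / 2)))%:E = 2%:E.
Proof.
have dF (x : R) : is_derive x 1%R (fun y => - (2 * expR (- (y / 2))))%R (expR (- (x / 2))).
  by apply: is_derive_eq; rewrite /GRing.scale/=; field.
have cF (x : R) : {for x, continuous (fun y => - (2 * expR (- (y / 2))))%R}.
  apply: differentiable_continuous; apply/derivable1_diffP.
  by have := dF x => ?; exact: ex_derive.
have cf (x : R) : {for x, continuous (fun y : R => expR (- (y / 2)))%R}.
  apply: (@continuous_comp _ _ _ (fun y : R => y / 2)%R (fun y => expR (- y))%R).
    by apply: cvgM; [exact: cvg_id|exact: cvg_cst].
  exact: continuous_expRN.
rewrite integral_itv_obnd_cbnd; last first.
  apply/measurable_EFinP; apply: continuous_pos_measurable => x _; exact: cf.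
have -> : \int[lm]_(x in `[0%R, +oo[) (expR (- (x / 2)))%:E =
    0%R%:E - (- (2 * expR (- (0 / 2))))%:E.
  apply: (@ge0_continuous_FTC2y R (fun x : R => expR (- (x / 2)))%R
    (fun y : R => - (2 * expR (- (y / 2))))%R 0%R 0%R).
  - by move=> x _; exact: expR_ge0.
  - by apply: continuous_subspaceT => x; exact: cf.
  - rewrite -oppr0 -(mulr0 2%R); apply: cvgN; apply: cvgMr.
    apply: (@cvg_comp _ _ _ (fun x : R => x / 2)%R (fun x => expR (- x))%R _ _ _ _ (@cvgr_expR R)).
    by apply: gt0_cvgMly; [|exact: cvg_id]; rewrite invr_gt0.
  - by move=> x _; have := dF x => ?; exact: ex_derive.
  - by apply: cvg_at_right_filter; exact: cF.
  - by move=> x _; rewrite derive1E; have := dF x => ?; exact: derive_val.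
by rewrite mul0r oppr0 expR0 mulr1 -EFinB sub0r opprK.
Qed.

(** Above 1 the integrand is dominated by a multiple of exp (- x / 2). For smaller [s] the
    singularity at 0 is avoided: by the functional equation an infinite [egamma s] would make
    [egamma (s + 1)] infinite. *)
Lemma egamma_lty s : (0 < s)%R -> egamma s < +oo.
Proof.
move=> s0.
have big p : (0 < p)%R -> egamma (p + 1) < +oo.
  move=> p0; rewrite /egamma.
  have K0 : (0 <= 2 `^ p * p `^ p)%R by rewrite mulr_ge0 ?powR_ge0.
  have mh : measurable_fun pos (fun x : R => expR (- (x / 2))).
    apply: measurableT_comp => //; apply: measurableT_comp => //.
    exact: measurable_funM.
  apply: (@le_lt_trans _ _ (\int[lm]_(x in pos)
      (2 `^ p * p `^ p * expR (- (x / 2)))%:E)).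
    apply: le_integral_EFin => //.
    - by apply: continuous_pos_measurable; exact: continuous_gamma_integrand.
    - exact: measurable_funM.
    - move=> x; rewrite /= in_itv/= andbT => x0; rewrite gamma_integrand_ge0/=.
      rewrite /gamma_integrand addrK.
      have h := powR_le_expR p0 (ltW (divr_gt0 x0 (ltr0n _ 2))).
      have -> : (x `^ p = 2 `^ p * (x / 2) `^ p)%R.
        by rewrite -powRM ?divr_ge0 ?(ltW x0)//; congr powR; field.
      have -> : (- x = - (x / 2) + - (x / 2))%R by field.
      rewrite expRD mulrA ler_pM2r ?expR_gt0// -!mulrA ler_pM2l ?powR_gt0//.
      by rewrite expRN ler_pdivrMr ?expR_gt0.
  by rewrite integralZl_EFin_ge0// ?integral_expRN_half ?ltry// => x _; exact: expR_ge0.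
have := big s s0; rewrite egammaS//.
by rewrite !ltey; apply: contra_neq => ->; exact: gt0_muley.
Qed.

Lemma GammaE s : (0 < s)%R -> (Gamma s)%:E = egamma s.
Proof.
move=> s0; rewrite /Gamma /Rintegral fineK// ge0_fin_numE ?egamma_lty//.
by apply: integral_ge0 => x _; rewrite lee_fin gamma_integrand_ge0.
Qed.

Lemma GammaS s : (0 < s)%R -> Gamma (s + 1) = (s * Gamma s)%R.
Proof.
move=> s0; apply: EFin_inj; rewrite EFinM !GammaE ?egammaS//.
by rewrite addr_gt0.
Qed.

(** On [1, 2] the integrand is at least exp (-2). The bound is crude but uniform in [s], which is
    what the majorant of the Bessel series requires. *)
Lemma Gamma_ge s : (1 <= s)%R -> (expR (- 2) <= Gamma s)%R.
Proof.
move=> s1; have s0 : (0 < s)%R by exact: lt_le_trans s1.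
rewrite -lee_fin GammaE//.
apply: (@le_trans _ _ (\int[lm]_(x in `[1%R, 2%R]) (expR (-2))%:E)).
  rewrite integral_cst//= lebesgue_measure_itv/= lte_fin ltr1n.
  by rewrite -EFinB -EFinM (_ : 2 - 1 = 1)%R ?mulr1//; ring.
apply: (@le_trans _ _ (\int[lm]_(x in `[1%R, 2%R]) (gamma_integrand s x)%:E)).
  apply: le_integral_EFin => //.
  - apply: (@measurable_funS _ _ _ _ pos) => //.
      by move=> x; rewrite /= !in_itv/= andbT => /andP[+ _]; apply: lt_le_trans.
    by apply: continuous_pos_measurable; exact: continuous_gamma_integrand.
  - move=> x; rewrite /= in_itv/= => /andP[x1 x2]; rewrite expR_ge0/= /gamma_integrand.
    rewrite -[leLHS]mul1r ler_pM ?expR_ge0// ?ler_expR ?lerN2//.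
    by rewrite -[leLHS](powRr0 x) ler_powR// subr_ge0.
apply: subset_integral_EFin => //.
- by move=> x; rewrite /= !in_itv/= andbT => /andP[+ _]; apply: lt_le_trans.
- by apply: continuous_pos_measurable; exact: continuous_gamma_integrand.
- by move=> x _; exact: gamma_integrand_ge0.
Qed.

Lemma Gamma_gt0 s : (0 < s)%R -> (0 < Gamma s)%R.
Proof.
move=> s0; have : (0 < Gamma (s + 1))%R.
  by apply: (lt_le_trans (expR_gt0 (-2)%R)); apply: Gamma_ge; rewrite lerDr ltW.
by rewrite GammaS// pmulr_rgt0.
Qed.

Lemma fact_le_Gamma (nu : R) (k : nat) : (0 < nu)%R ->
  (k`!%:R * Gamma (nu + 1) <= Gamma (k%:R + nu + 1))%R.
Proof.
move=> nu0; elim: k => [|k IH]; first by rewrite mul1r add0r.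
have k0 : (0 < k%:R + nu + 1 :> R)%R by rewrite addr_gt0// ltr_wpDl.
have -> : (k.+1%:R + nu + 1 = (k%:R + nu + 1) + 1 :> R)%R by rewrite -natr1; ring.
rewrite (GammaS k0) factS natrM -mulrA; apply: ler_pM => //.
  by apply: mulr_ge0; [exact: ler0n|apply: ltW; apply: Gamma_gt0; exact: addr_gt0].
by rewrite -natr1 addrAC lerDl ltW.
Qed.

Lemma gaussian_moment (m p : R) : (0 < m)%R -> (0 < p)%R ->
  \int[lm]_(y in pos) (y `^ (2 * m - 1) * expR (- (p * y ^+ 2)))%:E =
  (Gamma m / (2 * p `^ m))%:E.
Proof.
move=> m0 p0.
have c0 : (0 < 2 * p `^ m)%R by rewrite mulr_gt0 ?powR_gt0.
have E : (2 * p `^ m)%:E * \int[lm]_(y in pos)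
    (y `^ (2 * m - 1) * expR (- (p * y ^+ 2)))%:E = (Gamma m)%:E.
  rewrite GammaE// /egamma (@integral_square_subst R p (gamma_integrand m))//; last 2 first.
  - by move=> x x0; exact: continuous_gamma_integrand.
  - by move=> x _; exact: gamma_integrand_ge0.
  rewrite -integralZl_EFin_ge0//; last 3 first.
  - apply: measurable_funM.
      by apply: (@measurable_funS _ _ _ _ setT) => //; exact: measurable_powR.
    apply: measurableT_comp => //; apply: measurableT_comp => //.
    by apply: measurable_funM => //; exact: measurable_funX.
  - by move=> x _; rewrite mulr_ge0 ?powR_ge0 ?expR_ge0.
  - exact: ltW.
  apply: eq_integral => y; rewrite inE/= in_itv/= andbT => y0.
  rewrite /gamma_integrand; congr EFin.
  rewrite powRM ?(ltW p0) ?exprn_ge0 ?(ltW y0)//.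
  rewrite -(@mulr_powRB1 R p m) ?(ltW p0)//.
  have -> : (2 * m - 1 = 2 * (m - 1) + 1)%R by ring.
  have y1 : y != 0%R by rewrite gt_eqF.
  rewrite (@powRD _ y) ?y1 ?implybT//.
  rewrite powRr1 ?(ltW y0)// powRrM powR_mulrn ?(ltW y0)//.
  by ring.
rewrite -[LHS]mul1e (_ : 1%E = ((2 * p `^ m)^-1 * (2 * p `^ m))%:E); last first.
  by rewrite mulVf// gt_eqF.
by rewrite EFinM -muleA E -EFinM mulrC.
Qed.

(** The substitution u = x^2 / (2 r) turns this into the Euler integral. It normalises the density
    of the hitting time of 0, whose law is that of x^2 / (2 g) with [g] Gamma distributed. *)
Lemma inverse_gamma_density (nu x : R) : (0 < nu)%R -> (0 < x)%R ->
  \int[lm]_(r in pos) (x `^ (2 * nu) * r `^ (- nu - 1) * expR (- (x ^+ 2 / (2 * r))))%:E =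
  (2 `^ nu * Gamma nu)%:E.
Proof.
move=> nu0 x0; have c0 : (0 < x ^+ 2 / 2)%R by rewrite divr_gt0// exprn_gt0.
rewrite EFinM GammaE// /egamma (@integral_inv_subst R (x ^+ 2 / 2) (gamma_integrand nu))//;
  last 2 first.
- by move=> y y0; exact: continuous_gamma_integrand.
- by move=> y _; exact: gamma_integrand_ge0.
rewrite -integralZl_EFin_ge0//; last 2 first.
- apply: measurable_funM.
    apply: continuous_pos_measurable => r r0.
    apply: (@continuous_comp _ _ _ (fun r : R => x ^+ 2 / 2 / r)%R (gamma_integrand nu)).
      apply: cvgM; first exact: cvg_cst.
      by apply: cvgV; [rewrite gt_eqF|exact: cvg_id].
    by apply: continuous_gamma_integrand; rewrite divr_gt0.
  apply: continuous_pos_measurable => r r0; apply: cvgM; first exact: cvg_cst.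
  apply: cvgV; first by rewrite expf_neq0// gt_eqF.
  by apply: exprn_continuous.
- move=> r; rewrite /= in_itv/= andbT => r0.
  by rewrite mulr_ge0 ?gamma_integrand_ge0// ltW// divr_gt0// exprn_gt0.
apply: eq_integral => r; rewrite inE/= in_itv/= andbT => r0.
rewrite /gamma_integrand; congr EFin.
have -> : (x ^+ 2 / 2 / r = x ^+ 2 / (2 * r))%R by field; rewrite gt_eqF.
set c := (x ^+ 2 / (2 * r))%R.
have cp : (0 < c)%R by rewrite divr_gt0 ?mulr_gt0 ?exprn_gt0.
have -> : (x ^+ 2 / 2 / r ^+ 2 = c * r^-1)%R by rewrite /c; field; rewrite gt_eqF.
have -> : (2 `^ nu * (c `^ (nu - 1) * expR (- c) * (c * r^-1)) =
    2 `^ nu * (c * c `^ (nu - 1)) * r^-1 * expR (- c))%R by ring.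
rewrite mulr_powRB1 ?(ltW cp)// -powRM ?(ltW cp)//; congr (_ * _)%R.
have -> : (2 * c = x ^+ 2 * r^-1)%R by rewrite /c; field; rewrite gt_eqF.
rewrite powRM ?sqr_ge0 ?invr_ge0 ?(ltW r0)// -powR_mulrn ?(ltW x0)// -powRrM.
rewrite -mulrA; congr (_ * _)%R.
have r1 : r != 0%R by rewrite gt_eqF.
rewrite powRB ?r1 ?implybT//.
rewrite powRr1 ?(ltW r0)//; congr (_ / _)%R.
by rewrite -[in RHS](powR_inv1 (ltW r0)) -powRrM mulN1r.
Qed.

End gamma_function.

(** * The Bessel series, the transition kernel and its action on Gaussian functions *)

Section bessel_kernel.
Context (R : realType).
Notation lm := (@lebesgue_measure R).
Notation pos := (`]0%R, +oo[%classic : set R).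
Implicit Types (nu t x y z v : R).

Definition besselI_term nu (k : nat) z :=
  (z / 2) `^ (2 * k%:R + nu) / (k`!%:R * Gamma (k%:R + nu + 1)).

Lemma Gamma_term_gt0 nu (k : nat) : 0 < nu ->
  0 < k`!%:R * Gamma (k%:R + nu + 1).
Proof.
move=> nu0; rewrite mulr_gt0// ?ltr0n ?fact_gt0//.
by apply: Gamma_gt0; rewrite addr_gt0// ltr_wpDl.
Qed.

Lemma besselI_term_ge0 nu (k : nat) z : 0 < nu -> 0 <= besselI_term nu k z.
Proof. by move=> nu0; rewrite divr_ge0 ?powR_ge0// ltW// Gamma_term_gt0. Qed.

Lemma powR_even z (k : nat) : 0 <= z -> z `^ (2 * k%:R) = (z ^+ 2) ^+ k.
Proof. by move=> z0; rewrite powRrM !powR_mulrn ?exprn_ge0// powR_mulrn. Qed.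

(** A summable majorant valid for every real [z], as measurability on the whole line demands. The
    maximum with 1 covers negative [z], where a real power of a negative base is 1 by convention. *)
Lemma besselI_term_le nu (k : nat) z : 0 < nu ->
  besselI_term nu k z <=
  (z / 2) `^ nu * expR 2 * exp_coeff (Num.max 1 ((z / 2) ^+ 2)) k.
Proof.
move=> nu0; rewrite /besselI_term /exp_coeff /=.
set w := Num.max 1 _.
have w1 : 1 <= w by rewrite le_max lexx.
have num : (z / 2) `^ (2 * k%:R + nu) <= (z / 2) `^ nu * w ^+ k.
  have [z0|z0|->] := ltgtP z 0.
  - have z2 : z / 2 < 0 by rewrite pmulr_llt0.
    by rewrite !lt0_powR1// mul1r exprn_ege1.
  - have z2 : 0 < z / 2 by rewrite divr_gt0.
    rewrite powRD; last by rewrite [z / 2 == 0]gt_eqF ?implybT.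
    rewrite mulrC ler_pM2l ?powR_gt0// powR_even ?(ltW z2)//.
    by rewrite lerXn2r ?nnegrE ?exprn_ge0 ?(ltW z2) ?(le_trans ler01 w1)// le_max lexx orbT.
  - by rewrite mul0r !powR0 ?mul0r// gt_eqF// ltr_wpDl// mulr_ge0.
have k0 : 0 < k`!%:R :> R by rewrite ltr0n fact_gt0.
have G0 : expR (-2) <= Gamma (k%:R + nu + 1) :> R.
  by apply: Gamma_ge; rewrite lerDr addr_ge0// ltW.
have Gp : 0 < Gamma (k%:R + nu + 1) :> R by apply: lt_le_trans G0; exact: expR_gt0.
rewrite invfM [leLHS]mulrA [leRHS](_ : _ = (z / 2) `^ nu * w ^+ k * (k`!%:R)^-1 * expR 2); last by ring.
apply: ler_pM.
- by rewrite mulr_ge0 ?powR_ge0 ?invr_ge0 ?ler0n.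
- by rewrite invr_ge0 ltW.
- by rewrite ler_pM2r ?invr_gt0.
- by rewrite -[expR 2]invrK -expRN lef_pV2 ?posrE ?expR_gt0.
Qed.

Lemma is_cvg_besselI nu z : 0 < nu -> cvgn (series (fun k => besselI_term nu k z)).
Proof.
move=> nu0; apply: (@series_le_cvg _ _
  (fun k => (z / 2) `^ nu * expR 2 * exp_coeff (Num.max 1 ((z / 2) ^+ 2)) k)).
- by move=> k; exact: besselI_term_ge0.
- move=> k; apply: mulr_ge0; first by rewrite mulr_ge0 ?powR_ge0 ?expR_ge0.
  by apply: exp_coeff_ge0; rewrite le_max ler01.
- by move=> k; exact: besselI_term_le.
- by apply: is_cvg_seriesZ; exact: is_cvg_series_exp_coeff.
Qed.

Lemma besselIE nu z : besselI nu z = limn (series (fun k => besselI_term nu k z)).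
Proof. by []. Qed.

Lemma besselI_ge0 nu z : 0 < nu -> 0 <= besselI nu z.
Proof.
move=> nu0; apply: limr_ge; first exact: is_cvg_besselI.
by apply: nearW => n; apply: sumr_ge0 => k _; exact: besselI_term_ge0.
Qed.

Lemma EFin_besselI nu z : 0 < nu ->
  (besselI nu z)%:E = (\sum_(k <oo) (besselI_term nu k z)%:E)%E.
Proof.
move=> nu0; rewrite besselIE -EFin_lim; last exact: is_cvg_besselI.
by congr (limn _); apply/funext => n; rewrite /series/= sumEFin.
Qed.

Lemma EFin_expR (w : R) : 0 <= w ->
  (\sum_(k <oo) (w ^+ k / k`!%:R)%:E)%E = (expR w)%:E.
Proof.
move=> w0; rewrite /expR -EFin_lim; last exact: is_cvg_series_exp_coeff.
by congr (limn _); apply/funext => n; rewrite /series/= sumEFin.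
Qed.

Lemma measurable_besselI nu : 0 < nu -> measurable_fun setT (besselI nu).
Proof.
move=> nu0; apply: (@measurable_fun_cvg _ _ _ _ (fun n z => series (fun k => besselI_term nu k z) n)).
- move=> n; rewrite /series/=; apply: measurable_sum => k.
  rewrite /besselI_term; apply: measurable_funM => //.
  apply: (measurableT_comp (measurable_powR _)).
  exact: measurable_funM.
- by move=> z _; exact: is_cvg_besselI.
Qed.

Lemma measurable_invr : measurable_fun setT (fun x : R => x^-1).
Proof.
have -> : (fun x : R => x^-1) = (fun x => if x == 0 then 0 else x^-1).
  by apply/funext => x; case: eqVneq => // ->; rewrite invr0.
apply: measurable_fun_if => //.
- exact: measurable_fun_eqr.
- rewrite setTI; apply: open_continuous_measurable_fun.
    rewrite (_ : _ @^-1` _ = ~` [set 0]).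
      by apply: closed_openC; exact: closed_eq.
    by apply/seteqP; split => x /=; [move/eqP|move=> /eqP/negbTE].
  move=> x; rewrite inE/= => x0; apply: cvgV; last exact: cvg_id.
  by apply/negbT.
Qed.

Lemma measurable_bessel_q mu t : mu != 0 ->
  measurable_fun setT (fun w : R * R => bessel_q mu t w.1 w.2).
Proof.
move=> mu0; rewrite /bessel_q.
have m1 : measurable_fun setT (fun w : R * R => w.1) by exact: measurable_fst.
have m2 : measurable_fun setT (fun w : R * R => w.2) by exact: measurable_snd.
apply: measurable_funM; last first.
  apply: measurableT_comp; first by apply: measurable_besselI; rewrite normr_gt0.
  by apply: measurable_funM => //; exact: measurable_funM.
apply: measurable_funM; last first.
  apply: measurableT_comp => //; apply: measurable_funM => //.
  apply: measurableT_comp => //.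
  by apply: measurable_funD; exact: measurable_funX.
apply: measurable_funM; first exact: measurable_funM.
apply: (measurableT_comp (measurable_powR _)).
apply: measurable_funM => //.
exact: (measurableT_comp measurable_invr).
Qed.

Lemma bessel_q_ge0 mu t x y : mu != 0 -> 0 < t -> 0 < y -> 0 <= bessel_q mu t x y.
Proof.
move=> mu0 t0 y0; rewrite /bessel_q !mulr_ge0 ?powR_ge0 ?expR_ge0 ?(ltW y0)//.
  by rewrite invr_ge0 ltW.
by apply: besselI_ge0; rewrite normr_gt0.
Qed.

Lemma powR_expR x p : 0 < x -> x `^ p = expR (p * ln x).
Proof. by move=> x0; rewrite /powR gt_eqF. Qed.

(** Both indices share the factor I_nu, so the kernels differ only through (y / x)^(2 nu), the ratio
    of the values of the harmonic function. *)
Lemma bessel_q_flip nu t x y : 0 < nu -> 0 < x -> 0 < y ->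
  bessel_q nu t x y = x `^ (- (2 * nu)) * (bessel_q (- nu) t x y * y `^ (2 * nu)).
Proof.
move=> nu0 x0 y0; rewrite /bessel_q normrN.
have -> : (y / x) `^ nu = x `^ (- (2 * nu)) * ((y / x) `^ (- nu) * y `^ (2 * nu)).
  rewrite !powR_expR ?divr_gt0// lnM ?posrE ?invr_gt0// lnV ?posrE//.
  by rewrite -!expRD; congr expR; ring.
ring.
Qed.

Local Open Scope ereal_scope.

(** Expanding I_nu and integrating term by term gives Gaussian moments in which Gamma (k + nu + 1)
    cancels, and what is left is an exponential series. Two cases carry the proof: v = 0 makes x^(2
    nu) harmonic, and v = 1 / (2 r) moves the hitting density of 0 in time. *)
Lemma bessel_q_laplace nu t x v : (0 < nu)%R -> (0 < t)%R -> (0 < x)%R -> (0 <= v)%R ->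
  kint (bessel_q (- nu) t) pos (fun y => (y `^ (2 * nu) * expR (- (v * y ^+ 2)))%:E) x =
  (x `^ (2 * nu) * (1 + 2 * v * t) `^ (- nu - 1) *
   expR (- (v * x ^+ 2 / (1 + 2 * v * t))))%:E.
Proof.
move=> nu0 t0 x0 v0.
have t1 : t != 0%R by rewrite gt_eqF.
have u0 : (0 < 1 + 2 * v * t)%R by rewrite ltr_wpDr// !mulr_ge0// ltW.
have u1 : (1 + 2 * v * t != 0)%R by rewrite gt_eqF.
(* [p] is the total Gaussian rate in [y], namely 1 / (2 t) + v, and [a * y] is half the argument of
   I_nu. *)
pose p := ((1 + 2 * v * t) / (2 * t))%R.
have p0 : (0 < p)%R by rewrite divr_gt0// mulr_gt0.
pose a := (x / (2 * t))%R.
have a0 : (0 < a)%R by rewrite divr_gt0// mulr_gt0.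
pose c k : R := (t^-1 * x `^ nu * expR (- (x ^+ 2 / (2 * t))) * a `^ (2 * k%:R + nu) /
   (k`!%:R * Gamma (k%:R + nu + 1)))%R.
have c0 k : (0 <= c k)%R.
  rewrite /c divr_ge0 ?(ltW (Gamma_term_gt0 _ _))// !mulr_ge0 ?powR_ge0 ?expR_ge0//.
  by rewrite invr_ge0 ltW.
have gm k : (0 < k%:R + nu + 1 :> R)%R by rewrite addr_gt0// ltr_wpDl.
pose f (k : nat) y : R :=
  (c k * (y `^ (2 * (k%:R + nu + 1) - 1) * expR (- (p * y ^+ 2))))%R.
have mf0 (m : R) : measurable_fun pos (fun y : R => y `^ m * expR (- (p * y ^+ 2)))%R.
  apply: (@measurable_funS _ _ _ _ setT) => //.
  apply: measurable_funM; first exact: measurable_powR.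
  apply: measurableT_comp => //; apply: measurableT_comp => //.
  by apply: measurable_funM => //; exact: measurable_funX.
have -> : kint (bessel_q (- nu) t) pos (fun y => (y `^ (2 * nu) * expR (- (v * y ^+ 2)))%:E) x =
    \int[lm]_(y in pos) (\sum_(k <oo) (f k y)%:E).
  rewrite /kint; apply: eq_integral => y; rewrite inE/= in_itv/= andbT => y0.
  rewrite /bessel_q normrN gtr0_norm// EFinM EFin_besselI//.
  set A := (_ * expR _)%R.
  have A0 : (0 <= A)%R by rewrite /A !mulr_ge0 ?powR_ge0 ?expR_ge0 ?invr_ge0 ?(ltW y0) ?(ltW t0).
  rewrite [A%:E * _]muleC -muleA muleC -EFinM -nneseriesZl//; last first.
    by move=> k _; rewrite lee_fin besselI_term_ge0.
  apply: eq_eseriesr => k _; rewrite -EFinM; congr EFin.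
  rewrite /A /f /c /besselI_term.
  have -> : (x * y / t / 2 = a * y)%R by rewrite /a; field.
  have -> : (- (x ^+ 2 + y ^+ 2) / (2 * t) = - (x ^+ 2 / (2 * t)) - y ^+ 2 / (2 * t))%R by field.
  have -> : (- (p * y ^+ 2) = - (y ^+ 2 / (2 * t)) - v * y ^+ 2)%R by rewrite /p; field.
  have -> : ((y / x) `^ (- nu) = x `^ nu * y `^ (- nu))%R.
    rewrite !powR_expR ?divr_gt0// lnM ?posrE ?invr_gt0// lnV ?posrE//.
    by rewrite -!expRD; congr expR; ring.
  have -> : ((a * y) `^ (2 * k%:R + nu) = a `^ (2 * k%:R + nu) * y `^ (2 * k%:R + nu))%R.
    by rewrite powRM ?(ltW a0) ?(ltW y0).
  have -> : (y `^ (2 * (k%:R + nu + 1) - 1) =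
      y * y `^ (- nu) * y `^ (2 * k%:R + nu) * y `^ (2 * nu))%R.
    rewrite -[X in (X * y `^ (- nu))%R](powRr1 (ltW y0)) !powR_expR// -!expRD.
    by congr expR; ring.
  rewrite !expRD.
  have := Gamma_term_gt0 k nu0; set G := (k`!%:R * _)%R => G0.
  by field; rewrite t1 gt_eqF.
rewrite integral_nneseries//; last 2 first.
- by move=> k; apply/measurable_EFinP; apply: measurable_funM; [exact: measurable_cst|exact: mf0].
- move=> k y _; rewrite lee_fin; apply: mulr_ge0; first exact: c0.
  by rewrite mulr_ge0 ?powR_ge0 ?expR_ge0.
under eq_eseriesr => k _.
  rewrite /f integralZl_EFin_ge0//; last by move=> y _; rewrite mulr_ge0 ?powR_ge0 ?expR_ge0.
  rewrite gaussian_moment// -EFinM.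
  over.
pose C : R := ((2 * t)^-1 * x `^ nu * expR (- (x ^+ 2 / (2 * t))) * a `^ nu / p `^ (nu + 1))%R.
have C0 : (0 <= C)%R.
  by rewrite /C !mulr_ge0 ?powR_ge0 ?expR_ge0 ?invr_ge0 ?powR_ge0// mulr_ge0// ltW.
(* After the cancellation of the Gamma factors the sum over [k] is exp (a^2 / p), which combines
   with exp (- x^2 / (2 t)). *)
transitivity (\sum_(k <oo) (C%:E * ((a ^+ 2 / p) ^+ k / k`!%:R)%:E)).
  apply: eq_eseriesr => k _; rewrite -EFinM; congr EFin.
  rewrite /C /c.
  have Gk : Gamma (k%:R + nu + 1) != 0%R :> R by rewrite gt_eqF ?Gamma_gt0.
  have Fk : (k`!%:R != 0 :> R)%R by rewrite pnatr_eq0 -lt0n fact_gt0.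
  have p1 : p != 0%R by rewrite gt_eqF.
  have a1 : a != 0%R by rewrite gt_eqF.
  have -> : (p `^ (k%:R + nu + 1) = p ^+ k * p `^ (nu + 1))%R.
    by rewrite -(addrA k%:R) (@powRD _ p k%:R) ?p1 ?implybT// powR_mulrn// ltW.
  have -> : (a `^ (2 * k%:R + nu) = (a ^+ 2) ^+ k * a `^ nu)%R.
    by rewrite powRD ?a1 ?implybT// powR_even ?(ltW a0).
  clear f C C0; clearbody a p; rewrite expr_div_n.
  have : (p ^+ k != 0)%R by rewrite expf_neq0.
  have : (p `^ (nu + 1) != 0)%R by rewrite gt_eqF ?powR_gt0.
  move: (p ^+ k)%R (p `^ (nu + 1))%R ((a ^+ 2) ^+ k)%R (Gamma _) Gk (k`!%:R)%R Fk.
  move=> P1 P2 A2 G G1 F F1 P20 P10.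
  by field; rewrite G1 F1 P20 P10 t1.
rewrite nneseriesZl; last first.
  by move=> k _; rewrite lee_fin divr_ge0// exprn_ge0// divr_ge0 ?exprn_ge0 ?(ltW a0) ?(ltW p0).
rewrite EFin_expR; last by rewrite divr_ge0 ?exprn_ge0 ?(ltW a0) ?(ltW p0).
rewrite -EFinM; congr EFin; rewrite /C.
have -> : (- (v * x ^+ 2 / (1 + 2 * v * t)) = - (x ^+ 2 / (2 * t)) + a ^+ 2 / p)%R.
  by rewrite /a /p; field; rewrite u1 t1.
have T0 : (0 < 2 * t)%R by rewrite mulr_gt0.
have la : (ln a = ln x - ln (2 * t))%R by rewrite /a lnM ?posrE ?invr_gt0// lnV ?posrE.
have lp : (ln p = ln (1 + 2 * v * t) - ln (2 * t))%R.
  by rewrite /p lnM ?posrE ?invr_gt0// lnV ?posrE.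
rewrite -(powR_inv1 (ltW T0)) -powRN !powR_expR// la lp -!expRD; congr expR.
ring.
Qed.

End bessel_kernel.

(** * The hitting time of 0 for index - nu: semigroup property, tail and short-time estimates *)

Section hitting_zero.
Context (R : realType).
Notation lm := (@lebesgue_measure R).
Notation pos := (`]0%R, +oo[%classic : set R).
Implicit Types (nu t x y r s : R).

Lemma powRN_cvgy nu : 0 < nu -> (r `^ (- nu) : R) @[r --> +oo] --> 0.
Proof.
move=> nu0; apply/cvgr0Pnorm_le => e e0.
have M0 : (0 < e `^ (- nu^-1))%R by rewrite powR_gt0.
near=> r.
have rM : (e `^ (- nu^-1) <= r)%R by near: r; exact: nbhs_pinfty_ge.
have r0 : (0 < r)%R by exact: lt_le_trans rM.
rewrite ger0_norm ?powR_ge0//.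
have -> : e = ((e `^ (- nu^-1)) `^ (- nu))%R.
  by rewrite -powRrM mulrNN mulVf ?powRr1 ?(ltW e0)// gt_eqF.
rewrite !(powRN _ nu) lef_pV2 ?posrE ?powR_gt0//.
by apply: ge0_ler_powR; rewrite ?nnegrE ?(ltW nu0) ?(ltW M0) ?(ltW r0).
Unshelve. all: by end_near. Qed.

Lemma measurable_powR_on (A : set R) (p : R) : measurable A ->
  measurable_fun A (fun r : R => r `^ p).
Proof.
by move=> mA; apply: (@measurable_funS _ _ _ _ setT) => //; exact: measurable_powR.
Qed.

Local Open Scope ereal_scope.

Lemma measurable_integral_param (B : set R) (f : R * R -> R) :
  measurable B -> measurable_fun setT f ->
  (forall x y, B y -> (0 <= f (x, y))%R) ->
  measurable_fun setT (fun x => \int[lm]_(y in B) (f (x, y))%:E).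
Proof.
move=> mB mf f0.
pose F (z : R * R) : \bar R := (f z * \1_B z.2)%:E.
have -> : (fun x => \int[lm]_(y in B) (f (x, y))%:E) = (fun x => \int[lm]_y F (x, y)).
  apply/funext => x; rewrite integral_mkcond; apply: eq_integral => y _.
  by rewrite /F /= patchE indicE; case: ifPn => yB; rewrite ?mulr1 ?mulr0.
apply: (@measurable_fun_fubini_tonelli_F _ _ _ _ _ lm F).
- apply/measurable_EFinP; apply: measurable_funM => //.
  by apply: measurableT_comp => //; exact: measurable_indic.
- move=> [x y]; rewrite /F /= indicE lee_fin.
  by case: (boolP (y \in B)) => [/set_mem yB|_]; rewrite ?mulr1 ?mulr0// f0.
Qed.

Lemma tonelli_on (A B : set R) (f : R * R -> R) :
  measurable A -> measurable B -> measurable_fun setT f ->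
  (forall x y, A x -> B y -> (0 <= f (x, y))%R) ->
  \int[lm]_(x in A) \int[lm]_(y in B) (f (x, y))%:E =
  \int[lm]_(y in B) \int[lm]_(x in A) (f (x, y))%:E.
Proof.
move=> mA mB mf f0.
pose F (z : R * R) : \bar R := (f z * \1_A z.1 * \1_B z.2)%:E.
have -> : \int[lm]_(x in A) \int[lm]_(y in B) (f (x, y))%:E = \int[lm]_x \int[lm]_y F (x, y).
  rewrite integral_mkcond; apply: eq_integral => x _; rewrite patchE; case: ifPn => xA.
    rewrite integral_mkcond; apply: eq_integral => y _.
    by rewrite /F /= patchE !indicE xA mulr1; case: ifPn => yB; rewrite ?mulr1 ?mulr0.
  apply/esym; apply: integral0_eq => y _.
  by rewrite /F /= !indicE (negbTE xA) mulr0 mul0r.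
have -> : \int[lm]_(y in B) \int[lm]_(x in A) (f (x, y))%:E = \int[lm]_y \int[lm]_x F (x, y).
  rewrite integral_mkcond; apply: eq_integral => y _; rewrite patchE; case: ifPn => yB.
    rewrite integral_mkcond; apply: eq_integral => x _.
    by rewrite /F /= patchE !indicE yB mulr1; case: ifPn => xA; rewrite ?mulr1 ?mulr0.
  apply/esym; apply: integral0_eq => x _.
  by rewrite /F /= !indicE (negbTE yB) mulr0.
apply: (@fubini_tonelli _ _ _ _ _ lm lm F).
- apply/measurable_EFinP; apply: measurable_funM; first apply: measurable_funM => //.
    by apply: measurableT_comp => //; exact: measurable_indic.
  by apply: measurableT_comp => //; exact: measurable_indic.
- move=> [x y]; rewrite /F /= !indicE lee_fin.
  case: (boolP (x \in A)) => [/set_mem xA|_]; last by rewrite mulr0 mul0r.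
  by case: (boolP (y \in B)) => [/set_mem yB|_]; rewrite ?mulr1 ?mulr0// f0.
Qed.

(* Density at [r] of the hitting time of 0 for the process of index [- nu]
   started at [x]. *)
Definition zero_density nu r x : R :=
  ((2 `^ nu * Gamma nu)^-1 * (x `^ (2 * nu) * r `^ (- nu - 1) * expR (- (x ^+ 2 / (2 * r)))))%R.

Definition survival nu s x : \bar R :=
  \int[lm]_(r in `]s, +oo[) (zero_density nu r x)%:E.

Lemma zero_density_ge0 nu r x : (0 < nu)%R -> (0 <= zero_density nu r x)%R.
Proof.
move=> nu0; rewrite !mulr_ge0 ?powR_ge0 ?expR_ge0//.
by rewrite invr_ge0 mulr_ge0 ?powR_ge0// ltW// Gamma_gt0.
Qed.

Lemma measurable_zero_density nu :
  measurable_fun setT (fun z : R * R => zero_density nu z.2 z.1).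
Proof.
have m1 : measurable_fun setT (fun w : R * R => w.1) by exact: measurable_fst.
have m2 : measurable_fun setT (fun w : R * R => w.2) by exact: measurable_snd.
apply: measurable_funM => //; apply: measurable_funM; first apply: measurable_funM.
- exact: (measurableT_comp (measurable_powR _) m1).
- exact: (measurableT_comp (measurable_powR _) m2).
- apply: measurableT_comp => //; apply: measurableT_comp => //.
  apply: measurable_funM; first exact: measurable_funX.
  apply: (measurableT_comp (@measurable_invr R)).
  exact: measurable_funM.
Qed.

Lemma measurable_zero_density_r nu x : measurable_fun setT (fun r => zero_density nu r x).
Proof. exact: (measurableT_comp (measurable_zero_density nu) (pair1_measurable x)). Qed.

Lemma survival_ge0 nu s x : (0 < nu)%R -> 0 <= survival nu s x.
Proof.
by move=> nu0; apply: integral_ge0 => r _; rewrite lee_fin zero_density_ge0.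
Qed.

Lemma measurable_survival nu s : (0 < nu)%R -> measurable_fun setT (survival nu s).
Proof.
move=> nu0; apply: (@measurable_integral_param _ (fun z => zero_density nu z.2 z.1)) => //.
  exact: measurable_zero_density.
by move=> x y _; exact: zero_density_ge0.
Qed.

Lemma survival0 nu x : (0 < nu)%R -> (0 < x)%R -> survival nu 0 x = 1.
Proof.
move=> nu0 x0; have c0 : (0 < 2 `^ nu * Gamma nu :> R)%R.
  by rewrite mulr_gt0 ?powR_gt0 ?Gamma_gt0.
rewrite /survival /zero_density integralZl_EFin_ge0//.
- by rewrite inverse_gamma_density// -EFinM mulVf// gt_eqF.
- apply: (@measurable_funS _ _ _ _ setT) => //.
  have := measurable_zero_density_r nu x.
  move=> /(measurable_funM (measurable_cst (2 `^ nu * Gamma nu)%R)).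
  apply: eq_measurable_fun => r _ /=.
  by rewrite /zero_density mulrA divff ?mul1r// gt_eqF.
- by move=> r _; rewrite !mulr_ge0 ?powR_ge0 ?expR_ge0.
- by rewrite invr_ge0 ltW.
Qed.

(** Markov property in density form: being alive at [t] and reaching 0 after a further time [r]. It
    is the Laplace identity at v = 1 / (2 r), where 1 + 2 v t = (r + t) / r. *)
Lemma kint_zero_density nu t r x : (0 < nu)%R -> (0 < t)%R -> (0 < r)%R -> (0 < x)%R ->
  kint (bessel_q (- nu) t) pos (fun y => (zero_density nu r y)%:E) x =
  (zero_density nu (r + t) x)%:E.
Proof.
move=> nu0 t0 r0 x0.
have v0 : (0 <= (2 * r)^-1)%R by rewrite invr_ge0 mulr_ge0// ltW.
have K0 : (0 <= (2 `^ nu * Gamma nu)^-1 * r `^ (- nu - 1) :> R)%R.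
  by rewrite mulr_ge0 ?powR_ge0// invr_ge0 mulr_ge0 ?powR_ge0// ltW// Gamma_gt0.
have nu1 : (- nu != 0)%R by rewrite oppr_eq0 gt_eqF.
have rt : (0 < r + t)%R by rewrite addr_gt0.
transitivity (((2 `^ nu * Gamma nu)^-1 * r `^ (- nu - 1))%:E *
  kint (bessel_q (- nu) t) pos (fun y => (y `^ (2 * nu) * expR (- ((2 * r)^-1 * y ^+ 2)))%:E) x).
  have mf : measurable_fun pos
      (fun y : R => (y `^ (2 * nu) * expR (- ((2 * r)^-1 * y ^+ 2)))%:E).
    apply/measurable_EFinP; apply: measurable_funM; first exact: measurable_powR_on.
    apply: measurableT_comp => //; apply: measurableT_comp => //.
    by apply: measurable_funM => //; exact: measurable_funX.
  have f0 : forall y : R, (0 < y)%R ->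
      0 <= (y `^ (2 * nu) * expR (- ((2 * r)^-1 * y ^+ 2)))%:E.
    by move=> y y0; rewrite lee_fin mulr_ge0 ?powR_ge0 ?expR_ge0.
  have mq := measurable_bessel_q t nu1.
  have q0 : forall z y : R, (0 < y)%R -> (0 <= bessel_q (- nu) t z y)%R.
    by move=> z y; exact: bessel_q_ge0.
  rewrite -(@kintZ R _ mq q0 pos _ _ x (measurable_itv _) (@subset_refl _ _) K0 mf f0).
  rewrite /kint; apply: eq_integral => y _; congr (_ * _); rewrite -EFinM; congr EFin.
  by rewrite /zero_density [(y ^+ 2 / _)%R]mulrC; ring.
rewrite bessel_q_laplace// -EFinM; congr EFin; rewrite /zero_density.
have r1 : r != 0%R by rewrite gt_eqF.
have rt1 : (r + t)%R != 0%R by rewrite gt_eqF.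
have E : (1 + 2 * (2 * r)^-1 * t = (r + t) * r^-1)%R by field.
rewrite E powRM ?invr_ge0 ?(ltW rt) ?(ltW r0)//.
have -> : ((2 * r)^-1 * x ^+ 2 / ((r + t) / r) = x ^+ 2 / (2 * (r + t)))%R.
  by field; rewrite r1 rt1.
have F : (r `^ (- nu - 1) * r^-1 `^ (- nu - 1) = 1)%R.
  by rewrite -powRM ?invr_ge0 ?(ltW r0)// divff// powR1.
transitivity ((r `^ (- nu - 1) * r^-1 `^ (- nu - 1)) * ((2 `^ nu * Gamma nu)^-1 *
  (x `^ (2 * nu) * (r + t) `^ (- nu - 1) * expR (- (x ^+ 2 / (2 * (r + t))))))%R)%R.
  by ring.
by rewrite F mul1r.
Qed.

Lemma continuous_zero_density nu r x : (0 < r)%R ->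
  {for r, continuous (fun u => zero_density nu u x)}.
Proof.
move=> r0; apply: cvgM; first exact: cvg_cst.
apply: cvgM.
  by apply: cvgM; [exact: cvg_cst|exact: continuous_powR_pos].
apply: (@continuous_comp _ _ _ (fun u : R => x ^+ 2 / (2 * u))%R (fun y => expR (- y))%R).
  apply: cvgM; first exact: cvg_cst.
  apply: cvgV; first by rewrite mulf_neq0// gt_eqF.
  by apply: cvgM; [exact: cvg_cst|exact: cvg_id].
exact: continuous_expRN.
Qed.

Lemma survival_shift nu t s x : (0 < nu)%R -> (0 < t)%R -> (0 <= s)%R ->
  \int[lm]_(r in `]s, +oo[) (zero_density nu (r + t) x)%:E = survival nu (s + t) x.
Proof.
move=> nu0 t0 s0; rewrite /survival.
have st0 : (0 < s + t)%R by rewrite ltr_wpDl.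
have mz := measurable_zero_density_r nu x.
have msh : measurable_fun setT (fun r => zero_density nu (r + t) x).
  by apply: (measurableT_comp mz); exact: measurable_funD.
rewrite integral_itv_obnd_cbnd; last first.
  by apply/measurable_EFinP; apply: (@measurable_funS _ _ _ _ setT).
rewrite [RHS]integral_itv_obnd_cbnd; last first.
  by apply/measurable_EFinP; apply: (@measurable_funS _ _ _ _ setT).
pose F r := (r + t)%R.
have dF r : is_derive r 1%R F 1%R.
  by rewrite /F; apply: is_derive_eq; rewrite addr0.
have F'E : F^`()%classic = cst 1%R.
  by apply/funext => r; rewrite derive1E; exact: derive_val.
have cF r : {for r, continuous F}.
  by apply: cvgD; [exact: cvg_id|exact: cvg_cst].
rewrite -[(s + t)%R]/(F s).
rewrite (@increasing_ge0_integration_by_substitutiony R F (fun u => zero_density nu u x) s).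
- by apply: eq_integral => r _; rewrite F'E /= mulr1.
- by move=> u v _ _ uv; rewrite /F ltrD2r.
- by move=> u _; rewrite F'E; exact: cvg_cst.
- by rewrite F'E; exact: is_cvg_cst.
- by rewrite F'E; exact: is_cvg_cst.
- split; last by apply: cvg_at_right_filter; exact: cF.
  by move=> u _; exact: ex_derive.
- apply/cvgryPge => A; near=> r; rewrite /F -lerBlDr; near: r.
  by apply: nbhs_pinfty_ge; exact: num_real.
- apply: continuous_in_subspaceT => u; rewrite inE/= in_itv/= andbT => su.
  by apply: continuous_zero_density; exact: lt_le_trans su.
- by move=> u _; exact: zero_density_ge0.
Unshelve. all: by end_near. Qed.

(** Tonelli brings the kernel under the integral over [r], where it translates the density. The
    exact identity lets tails serve as the function [F] of both first-passage lemmas. *)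
Lemma kint_survival nu t s x : (0 < nu)%R -> (0 < t)%R -> (0 <= s)%R -> (0 < x)%R ->
  kint (bessel_q (- nu) t) pos (survival nu s) x = survival nu (s + t) x.
Proof.
move=> nu0 t0 s0 x0; have nu1 : (- nu != 0)%R by rewrite oppr_eq0 gt_eqF.
have mq := measurable_bessel_q t nu1.
have mq1 := measurableT_comp mq (pair1_measurable x).
have mz1 y : measurable_fun `]s, +oo[ (fun r => zero_density nu r y).
  apply: (@measurable_funS _ _ _ _ setT) => //; exact: measurable_zero_density_r.
transitivity (\int[lm]_(y in pos) \int[lm]_(r in `]s, +oo[)
    (bessel_q (- nu) t x y * zero_density nu r y)%:E).
  rewrite /kint; apply: eq_integral => y; rewrite inE/= in_itv/= andbT => y0.
  rewrite integralZl_EFin_ge0//.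
    by move=> r _; exact: zero_density_ge0.
  exact: bessel_q_ge0.
rewrite (@tonelli_on _ _ (fun z => bessel_q (- nu) t x z.1 * zero_density nu z.2 z.1)%R)//; last 2 first.
- apply: measurable_funM; last exact: measurable_zero_density.
  by apply: (measurableT_comp mq1); exact: measurable_fst.
- move=> y r; rewrite /= !in_itv/= !andbT => y0 _.
  by rewrite mulr_ge0 ?zero_density_ge0 ?bessel_q_ge0.
rewrite -survival_shift//; apply: eq_integral => r.
rewrite inE/= in_itv/= andbT => sr; rewrite -kint_zero_density//; last exact: le_lt_trans sr.
Qed.

Lemma survival_le1 nu s x : (0 < nu)%R -> (0 <= s)%R -> (0 < x)%R -> survival nu s x <= 1.
Proof.
move=> nu0 s0 x0; rewrite -(survival0 nu0 x0); apply: subset_integral_EFin => //.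
- by move=> r; rewrite /= !in_itv/= !andbT; exact: le_lt_trans.
- apply: (@measurable_funS _ _ _ _ setT) => //; exact: measurable_zero_density_r.
- by move=> r _; exact: zero_density_ge0.
Qed.

(** Since [survival nu 0] is 1 on the half-line, the total mass of the kernel is itself a survival
    probability: the only loss is by killing at 0. *)
Lemma kint_one nu t x : (0 < nu)%R -> (0 < t)%R -> (0 < x)%R ->
  kint (bessel_q (- nu) t) pos (cst 1) x = survival nu t x.
Proof.
move=> nu0 t0 x0; rewrite -[t in RHS]add0r -kint_survival//.
rewrite /kint; apply: eq_integral => y; rewrite inE/= in_itv/= andbT => y0.
by rewrite survival0.
Qed.

Lemma integral_powR_tail nu s : (0 < nu)%R -> (0 < s)%R ->
  \int[lm]_(r in `]s, +oo[) (r `^ (- nu - 1))%:E = (s `^ (- nu) / nu)%:E.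
Proof.
move=> nu0 s0; have nu1 : nu != 0%R by rewrite gt_eqF.
have dF r : (0 < r)%R -> is_derive r 1%R (fun u => - nu^-1 * u `^ (- nu))%R (r `^ (- nu - 1))%R.
  move=> r0; have := is_derive1_powR (- nu)%R r0 => ?.
  by apply: is_derive_eq; rewrite /GRing.scale/=; field.
have cF r : (0 < r)%R -> {for r, continuous (fun u => - nu^-1 * u `^ (- nu))%R}.
  move=> r0; apply: differentiable_continuous; apply/derivable1_diffP.
  by have := dF r r0 => ?; exact: ex_derive.
have mp : measurable_fun `]s, +oo[ (fun r : R => r `^ (- nu - 1))%R.
  exact: measurable_powR_on.
rewrite integral_itv_obnd_cbnd; last exact/measurable_EFinP.
have -> : (s `^ (- nu) / nu)%:E = 0%R%:E - (- nu^-1 * s `^ (- nu))%:E.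
  by rewrite -EFinB; congr EFin; rewrite sub0r mulNr opprK mulrC.
apply: (@ge0_continuous_FTC2y R (fun r => r `^ (- nu - 1))%R
  (fun u => - nu^-1 * u `^ (- nu))%R s 0%R).
- by move=> r _; exact: powR_ge0.
- apply: continuous_in_subspaceT => u; rewrite inE/= in_itv/= andbT => su.
  by apply: continuous_powR_pos; exact: lt_le_trans su.
- by rewrite -(mulr0 (- nu^-1)%R); apply: cvgMr; exact: powRN_cvgy.
- move=> r sr; have := dF r (lt_trans s0 sr) => ?; exact: ex_derive.
- by apply: cvg_at_right_filter; exact: cF.
- move=> r; rewrite in_itv/= andbT => sr.
  by rewrite derive1E; have := dF r (lt_trans s0 sr) => ?; exact: derive_val.
Qed.

Definition tail_const nu : R := ((2 `^ nu * Gamma (nu + 1))^-1)%R.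

Lemma tail_constE nu : (0 < nu)%R -> tail_const nu = ((2 `^ nu * Gamma nu)^-1 / nu)%R.
Proof. by move=> nu0; rewrite /tail_const GammaS// mulrCA invfM mulrC. Qed.

Lemma tail_const_gt0 nu : (0 < nu)%R -> (0 < tail_const nu)%R.
Proof. by move=> nu0; rewrite invr_gt0 mulr_gt0 ?powR_gt0// Gamma_gt0// addr_gt0. Qed.

Lemma integral_tail_scaled nu s (c : R) : (0 < nu)%R -> (0 < s)%R -> (0 <= c)%R ->
  \int[lm]_(r in `]s, +oo[) ((2 `^ nu * Gamma nu)^-1 * c * r `^ (- nu - 1))%:E =
  (tail_const nu * c * s `^ (- nu))%:E.
Proof.
move=> nu0 s0 c0.
have K0 : (0 <= (2 `^ nu * Gamma nu)^-1 * c :> R)%R.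
  by rewrite mulr_ge0// invr_ge0 mulr_ge0 ?powR_ge0// ltW// Gamma_gt0.
rewrite integralZl_EFin_ge0//.
- rewrite integral_powR_tail// -EFinM tail_constE//; congr EFin; ring.
- exact: measurable_powR_on.
- by move=> r _; exact: powR_ge0.
Qed.

Lemma survival_upper nu s x : (0 < nu)%R -> (0 < s)%R ->
  survival nu s x <= (tail_const nu * x `^ (2 * nu) * s `^ (- nu))%:E.
Proof.
move=> nu0 s0; rewrite -integral_tail_scaled ?powR_ge0//; apply: le_integral_EFin => //.
- apply: (@measurable_funS _ _ _ _ setT) => //; exact: measurable_zero_density_r.
- by apply: measurable_funM => //; exact: measurable_powR_on.
- move=> r; rewrite /= in_itv/= andbT => sr; rewrite zero_density_ge0//=.
  rewrite /zero_density mulrA mulrA -[leRHS]mulr1 ler_wpM2l//.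
    by rewrite !mulr_ge0 ?powR_ge0// invr_ge0 mulr_ge0 ?powR_ge0// ltW// Gamma_gt0.
  by rewrite -expR0 ler_expR oppr_le0 divr_ge0 ?sqr_ge0// mulr_ge0// ltW// (lt_trans s0).
Qed.

(** For r > s the exponential factor of the density is at least its value at [s], while
    [survival_upper] bounds it by 1. The two bounds agree asymptotically as [s] grows. *)
Lemma survival_lower nu s x : (0 < nu)%R -> (0 < s)%R ->
  (tail_const nu * x `^ (2 * nu) * s `^ (- nu) * expR (- (x ^+ 2 / (2 * s))))%:E <=
  survival nu s x.
Proof.
move=> nu0 s0; rewrite mulrAC -(mulrA (tail_const nu)).
rewrite -integral_tail_scaled ?mulr_ge0 ?powR_ge0 ?expR_ge0//; apply: le_integral_EFin => //.
- by apply: measurable_funM => //; exact: measurable_powR_on.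
- apply: (@measurable_funS _ _ _ _ setT) => //; exact: measurable_zero_density_r.
- move=> r; rewrite /= in_itv/= andbT => sr.
  have K0 : (0 <= (2 `^ nu * Gamma nu)^-1 :> R)%R.
    by rewrite invr_ge0 mulr_ge0 ?powR_ge0// ltW// Gamma_gt0.
  have r0 : (0 < r)%R by exact: lt_trans sr.
  have e : (expR (- (x ^+ 2 / (2 * s))) <= expR (- (x ^+ 2 / (2 * r))))%R.
    rewrite ler_expR lerN2 ler_wpM2l ?sqr_ge0//.
    by rewrite lef_pV2 ?posrE ?mulr_gt0// ler_pM2l// ltW.
  rewrite !mulr_ge0 ?powR_ge0 ?expR_ge0//= /zero_density.
  rewrite [leLHS](_ : _ = (2 `^ nu * Gamma nu)^-1 * (x `^ (2 * nu) * r `^ (- nu - 1) *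
    expR (- (x ^+ 2 / (2 * s)))))%R; last by ring.
  by rewrite ler_wpM2l// ler_wpM2l// mulr_ge0 ?powR_ge0.
Qed.



(** The exponential is traded for its argument to the power - (nu + 2), chosen so that r^(- nu - 1)
    becomes [r]. Integrating over (0, s] then bounds the probability of reaching 0 by time [s] by
    O(s^2). *)
Lemma zero_density_small nu r x : (0 < nu)%R -> (0 < r)%R -> (0 < x)%R ->
  (zero_density nu r x <=
   (2 `^ nu * Gamma nu)^-1 * ((nu + 2) `^ (nu + 2) * 2 `^ (nu + 2)) * r / x ^+ 4)%R.
Proof.
move=> nu0 r0 x0; rewrite /zero_density.
have K0 : (0 <= (2 `^ nu * Gamma nu)^-1 :> R)%R.
  by rewrite invr_ge0 mulr_ge0 ?powR_ge0// ltW// Gamma_gt0.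
have p0 : (0 < nu + 2)%R by rewrite addr_gt0.
set w := (x ^+ 2 / (2 * r))%R.
have w0 : (0 < w)%R by rewrite divr_gt0 ?exprn_gt0// mulr_gt0.
have e : (expR (- w) <= (nu + 2) `^ (nu + 2) * w `^ (- (nu + 2)))%R.
  rewrite expRN powRN ler_pdivlMr ?powR_gt0// mulrC ler_pdivrMr ?expR_gt0//.
  exact: powR_le_expR p0 (ltW w0).
rewrite -!(mulrA ((2 `^ nu * Gamma nu)^-1)%R) ler_wpM2l//.
apply: le_trans (ler_wpM2l _ e) _; first by rewrite mulr_ge0 ?powR_ge0.
have -> : (x `^ (2 * nu) * r `^ (- nu - 1) * ((nu + 2) `^ (nu + 2) * w `^ (- (nu + 2))) =
    (nu + 2) `^ (nu + 2) * (x `^ (2 * nu) * r `^ (- nu - 1) * w `^ (- (nu + 2))))%R by ring.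
rewrite -!(mulrA ((nu + 2) `^ (nu + 2))%R) ler_wpM2l ?powR_ge0//.
have lw : (ln w = 2 * ln x - ln 2 - ln r)%R.
  rewrite /w lnM ?posrE ?exprn_gt0 ?invr_gt0 ?mulr_gt0//.
  rewrite lnV ?posrE ?mulr_gt0// (lnM (x := 2%R)) ?posrE// lnXn//.
  by rewrite -mulr_natl; ring.
have -> : (2 `^ (nu + 2) * r / x ^+ 4 = 2 `^ (nu + 2) * r `^ 1 * x `^ (- 4%:R))%R.
  by rewrite powRr1 ?(ltW r0)// powRN powR_mulrn ?(ltW x0).
rewrite !powR_expR// lw -!expRD ler_expR le_eqVlt; apply/orP; left.
by apply/eqP; ring.
Qed.

Lemma survival_near1 nu s x : (0 < nu)%R -> (0 < s)%R -> (0 < x)%R ->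
  1 <= survival nu s x + ((2 `^ nu * Gamma nu)^-1 *
    ((nu + 2) `^ (nu + 2) * 2 `^ (nu + 2)) * s ^+ 2 / x ^+ 4)%:E.
Proof.
move=> nu0 s0 x0; rewrite -(survival0 nu0 x0) {1}/survival.
have mz A : measurable A -> measurable_fun A (fun r => (zero_density nu r x)%:E).
  move=> mA; apply/measurable_EFinP; apply: (@measurable_funS _ _ _ _ setT) => //.
  exact: measurable_zero_density_r.
have -> : (`]0%R, +oo[ = `]0%R, s] `|` `]s, +oo[ :> set R)%classic.
  apply/seteqP; split => r; rewrite /= !in_itv/= !andbT.
    by move=> r0; have [rs|rs] := leP r s; [left|right]; rewrite ?r0.
  by move=> [/andP[]//|]; exact: lt_trans.
rewrite (@ge0_integral_setU _ _ _ lm `]0%R, s] `]s, +oo[)//; last 3 first.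
- by apply: mz; exact: measurableU.
- by move=> r _; rewrite lee_fin zero_density_ge0.
- rewrite disj_set2E; apply/eqP/seteqP; split=> r //=.
  by rewrite !in_itv/= => -[/andP[_ rs]]; rewrite andbT ltNge rs.
rewrite addeC leeD2l//.
set K := ((2 `^ nu * Gamma nu)^-1 * ((nu + 2) `^ (nu + 2) * 2 `^ (nu + 2)))%R.
have K0 : (0 <= K)%R.
  rewrite /K mulr_ge0// ?mulr_ge0 ?powR_ge0// invr_ge0 mulr_ge0 ?powR_ge0//.
  by rewrite ltW// Gamma_gt0.
apply: (@le_trans _ _ (\int[lm]_(r in `]0%R, s]) (K * s / x ^+ 4)%:E)).
  apply: le_integral_EFin => //.
    by apply: (@measurable_funS _ _ _ _ setT) => //; exact: measurable_zero_density_r.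
  move=> r; rewrite /= in_itv/= => /andP[r0 rs]; rewrite zero_density_ge0//=.
  apply: (le_trans (zero_density_small nu0 r0 x0)); rewrite -/K.
  by rewrite ler_wpM2r ?invr_ge0 ?exprn_ge0 ?(ltW x0)// ler_wpM2l.
rewrite integral_cst//= lebesgue_measure_itv/= lte_fin s0 -EFinB -EFinM lee_fin.
rewrite le_eqVlt; apply/orP; left; apply/eqP; ring.
Qed.

Lemma sumr_sqr_le (n : nat) (u : nat -> R) : (forall k, (0 <= u k)%R) ->
  (\sum_(0 <= k < n) u k ^+ 2 <= (\sum_(0 <= k < n) u k) ^+ 2)%R.
Proof.
move=> u0; elim: n => [|n IH]; first by rewrite !big_geq// expr0n.
rewrite !big_nat_recr//= sqrrD -addrA [leRHS]addrA -[leRHS]addrA lerD//.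
rewrite lerDr mulrn_wge0// mulr_ge0//; exact: sumr_ge0.
Qed.

(** From Gamma (k + nu + 1) >= k! Gamma (nu + 1), the series is dominated by a sum of squares of the
    terms of exp (z / 2), hence by the square of their sum. The rate [z] in the exponent is what
    completes the square (x - y)^2 in the kernel. *)
Lemma besselI_le nu z : (0 < nu)%R -> (0 < z)%R ->
  (besselI nu z <= (z / 2) `^ nu / Gamma (nu + 1) * expR z)%R.
Proof.
move=> nu0 z0; rewrite besselIE; apply: limr_le; first exact: is_cvg_besselI.
apply: nearW => n; rewrite /series/=.
have G0 : (0 < Gamma (nu + 1) :> R)%R by rewrite Gamma_gt0// addr_gt0.
have z2 : (0 < z / 2)%R by rewrite divr_gt0.
apply: (@le_trans _ _ (\sum_(0 <= k < n) ((z / 2) `^ nu / Gamma (nu + 1) *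
    (exp_coeff (z / 2) k) ^+ 2))%R).
  apply: ler_sum => k _; rewrite /besselI_term /exp_coeff/=.
  have k0 : (0 < k`!%:R :> R)%R by rewrite ltr0n fact_gt0.
  have -> : ((z / 2) `^ (2 * k%:R + nu) = (z / 2) `^ nu * ((z / 2) ^+ k) ^+ 2)%R.
    rewrite powRD; last by rewrite [(z / 2)%R == _]gt_eqF ?implybT.
    by rewrite powR_even ?(ltW z2)// mulrC exprAC.
  have -> : ((z / 2) `^ nu / Gamma (nu + 1) * ((z / 2) ^+ k / k`!%:R) ^+ 2 =
     (z / 2) `^ nu * ((z / 2) ^+ k) ^+ 2 / (k`!%:R * (k`!%:R * Gamma (nu + 1))))%R.
    move: k0 G0 ((z / 2) ^+ k)%R ((z / 2) `^ nu)%R => /lt0r_neq0 k0 /lt0r_neq0 G0 A B.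
    by field; rewrite k0 G0.
  apply: ler_wpM2l; first by apply: mulr_ge0; [exact: powR_ge0|exact: sqr_ge0].
  have Gk : (0 < Gamma (k%:R + nu + 1) :> R)%R.
    by apply: Gamma_gt0; rewrite addr_gt0// ltr_wpDl.
  rewrite lef_pV2 ?posrE ?mulr_gt0//.
  by rewrite ler_pM2l//; exact: fact_le_Gamma.
rewrite -mulr_sumr ler_wpM2l ?divr_ge0 ?powR_ge0 ?(ltW G0)//.
apply: le_trans (sumr_sqr_le _ _) _.
  by move=> k; apply: exp_coeff_ge0; exact: ltW.
have -> : (expR z = expR (z / 2) ^+ 2)%R by rewrite expr2 -expRD; congr expR; field.
rewrite lerXn2r ?nnegrE ?expR_ge0//.
  by apply: sumr_ge0 => k _; apply: exp_coeff_ge0; exact: ltW.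
have := @nondecreasing_cvgn_le R (series (exp_coeff (z / 2))) _ _ n; apply.
  apply/nondecreasing_seqP => k; rewrite /series/= big_nat_recr//= lerDl.
  by apply: exp_coeff_ge0; exact: ltW.
exact: is_cvg_series_exp_coeff.
Qed.

Lemma bessel_q_le nu t x y : (0 < nu)%R -> (0 < t)%R -> (0 < x)%R -> (0 < y)%R ->
  (bessel_q (- nu) t x y <= (2 `^ nu * Gamma (nu + 1))^-1 * y * x `^ (2 * nu) *
     t `^ (- nu - 1) * expR (- ((x - y) ^+ 2 / (2 * t))))%R.
Proof.
move=> nu0 t0 x0 y0; rewrite /bessel_q normrN gtr0_norm//.
have z0 : (0 < x * y / t)%R by rewrite divr_gt0// mulr_gt0.
have G0 : (0 < Gamma (nu + 1) :> R)%R by rewrite Gamma_gt0// addr_gt0.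
apply: le_trans (ler_wpM2l _ (besselI_le nu0 z0)) _.
  by rewrite !mulr_ge0 ?powR_ge0 ?expR_ge0 ?invr_ge0 ?(ltW y0) ?(ltW t0).
have -> : (- ((x - y) ^+ 2 / (2 * t)) = - (x ^+ 2 + y ^+ 2) / (2 * t) + x * y / t)%R.
  by field; rewrite gt_eqF.
rewrite expRD.
have E : (y / t * (y / x) `^ (- nu) * (x * y / t / 2) `^ nu =
    (2 `^ nu)^-1 * y * x `^ (2 * nu) * t `^ (- nu - 1))%R.
  have l1 : (ln (x * y / t / 2) = ln x + ln y - ln t - ln 2)%R.
    by rewrite !lnM ?posrE ?mulr_gt0 ?invr_gt0// !lnV ?posrE.
  have l2 : (ln (y / x) = ln y - ln x)%R.
    by rewrite lnM ?posrE ?invr_gt0// lnV ?posrE.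
  have et : (t^-1 = expR (- ln t))%R by rewrite expRN lnK.
  have ey : y = expR (ln y) by rewrite lnK.
  rewrite !powR_expR ?divr_gt0 ?mulr_gt0// l1 l2 et -expRN.
  set ly := ln y in ey *; rewrite ey -!expRD; congr expR; ring.
rewrite le_eqVlt; apply/orP; left; apply/eqP.
transitivity ((y / t * (y / x) `^ (- nu) * (x * y / t / 2) `^ nu) / Gamma (nu + 1) *
  expR (- (x ^+ 2 + y ^+ 2) / (2 * t)) * expR (x * y / t))%R; first by ring.
rewrite E; field; rewrite !gt_eqF ?powR_gt0//.
Qed.

(** The Gaussian factor is traded for a power with exponent nu + 3, which turns t^(- nu - 1) into
    t^2. Uniformity over unbounded [x] uses x - y >= th * x, a gap proportional to [x]: the power of
    [x] left over is -6, bounded by its value at [b]. *)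
Lemma bessel_q_small nu b b' : (0 < nu)%R -> (0 < b' < b)%R ->
  exists2 K : R, (0 <= K)%R & forall t x y, (0 < t)%R -> (b < x)%R -> (0 < y <= b')%R ->
    (bessel_q (- nu) t x y <= K * t ^+ 2)%R.
Proof.
move=> nu0 /andP[b'0 b'b]; have b0 : (0 < b)%R by exact: lt_trans b'b.
pose p := (nu + 3)%R.
have p0 : (0 < p)%R by rewrite addr_gt0.
pose th := ((b - b') / b)%R.
have th0 : (0 < th)%R by rewrite divr_gt0// subr_gt0.
have c0 : (0 <= (2 `^ nu * Gamma (nu + 1))^-1 :> R)%R.
  by rewrite invr_ge0 mulr_ge0 ?powR_ge0// ltW// Gamma_gt0// addr_gt0.
pose K := ((2 `^ nu * Gamma (nu + 1))^-1 * b' * (p `^ p * (2 / th ^+ 2) `^ p) / b ^+ 6)%R.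
exists K.
  by rewrite /K !mulr_ge0 ?powR_ge0 ?(ltW b'0)// invr_ge0 exprn_ge0// ltW.
move=> t x y t0 bx /andP[y0 yb']; have x0 : (0 < x)%R by exact: lt_trans bx.
apply: le_trans (bessel_q_le nu0 t0 x0 y0) _.
set w := ((th * x) ^+ 2 / (2 * t))%R.
have w0 : (0 < w)%R by apply: divr_gt0; [apply: exprn_gt0; exact: mulr_gt0|exact: mulr_gt0].
have thx : (th * x <= x - y)%R.
  rewrite /th mulrAC ler_pdivrMr// mulrBl.
  have : (b' * b <= b' * x)%R by rewrite ler_pM2l// ltW.
  have : (y * b <= b' * b)%R by rewrite ler_pM2r.
  by move=> h1 h2; lra.
have e : (expR (- ((x - y) ^+ 2 / (2 * t))) <= p `^ p * w `^ (- p))%R.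
  apply: (@le_trans _ _ (expR (- w))).
    rewrite ler_expR lerN2 /w ler_wpM2r ?invr_ge0 ?mulr_ge0 ?(ltW t0)//.
    have thx0 : (0 <= th * x)%R by apply: mulr_ge0; exact: ltW.
    by rewrite lerXn2r ?nnegrE// (le_trans thx0 thx).
  rewrite expRN powRN ler_pdivlMr ?powR_gt0// mulrC ler_pdivrMr ?expR_gt0//.
  exact: powR_le_expR p0 (ltW w0).
apply: le_trans (ler_wpM2l _ e) _.
  by rewrite !mulr_ge0 ?powR_ge0// ltW.
have lw : (ln w = 2 * ln x - ln t - ln (2 / th ^+ 2))%R.
  have thx0 : (0 < th * x)%R by exact: mulr_gt0.
  have t20 : (0 < 2 * t)%R by exact: mulr_gt0.
  have lsq (u : R) : (0 < u)%R -> (ln (u ^+ 2) = 2 * ln u)%R.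
    by move=> u0; rewrite lnXn// mulr_natl.
  have -> : (ln w = ln ((th * x) ^+ 2) - ln (2 * t))%R.
    by rewrite /w (@lnM _ ((th * x) ^+ 2)%R (2 * t)^-1%R) ?posrE ?invr_gt0 ?exprn_gt0// lnV ?posrE.
  have -> : (ln (2 / th ^+ 2) = ln 2 - ln (th ^+ 2))%R.
    by rewrite (@lnM _ 2%R (th ^+ 2)^-1%R) ?posrE ?invr_gt0 ?exprn_gt0// lnV ?posrE ?exprn_gt0.
  rewrite (lsq _ thx0) (lsq _ th0) (@lnM _ th x) ?posrE// (@lnM _ 2%R t) ?posrE//.
  ring.
have E : (x `^ (2 * nu) * t `^ (- nu - 1) * w `^ (- p) =
   (2 / th ^+ 2) `^ p * t ^+ 2 / x ^+ 6)%R.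
  rewrite -(powR_mulrn 2 (ltW t0)) -(powR_mulrn 6 (ltW x0)) -powRN.
  have c20 : (0 < 2 / th ^+ 2)%R by rewrite divr_gt0 ?exprn_gt0.
  rewrite !(powR_expR _ x0) !(powR_expR _ t0) (powR_expR _ w0) (powR_expR _ c20) lw.
  by rewrite -!expRD /p; congr expR; ring.
have -> : ((2 `^ nu * Gamma (nu + 1))^-1 * y * x `^ (2 * nu) * t `^ (- nu - 1) *
   (p `^ p * w `^ (- p)) = (2 `^ nu * Gamma (nu + 1))^-1 * p `^ p * y *
   (x `^ (2 * nu) * t `^ (- nu - 1) * w `^ (- p)))%R by ring.
rewrite E.
have -> : (K * t ^+ 2 = (2 `^ nu * Gamma (nu + 1))^-1 * p `^ p * b' *
   ((2 / th ^+ 2) `^ p * t ^+ 2 / b ^+ 6))%R by rewrite /K; ring.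
apply: ler_pM.
- by rewrite !mulr_ge0 ?powR_ge0// ltW.
- by rewrite !mulr_ge0 ?powR_ge0 ?exprn_ge0 ?invr_ge0 ?exprn_ge0 ?(ltW t0) ?(ltW x0).
- by rewrite ler_wpM2l// mulr_ge0 ?powR_ge0.
- rewrite ler_wpM2l ?mulr_ge0 ?powR_ge0 ?exprn_ge0 ?(ltW t0)//.
  rewrite lef_pV2 ?posrE ?exprn_gt0//.
  by rewrite lerXn2r ?nnegrE ?(ltW b0) ?(ltW x0)// ltW.
Qed.

(* Exponent 2 matters: [2 ^ n] steps of length [t / 2 ^ n] accumulate an error
   [O (2 ^- n)], so the overshoot of the sampled process is negligible. *)
Lemma overshoot_bound nu b b' : (0 < nu)%R -> (0 < b' < b)%R ->
  exists2 K : R, (0 <= K)%R & forall t x, (0 < t)%R -> (b < x)%R ->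
    1 <= kint (bessel_q (- nu) t) `]b', +oo[ (cst 1) x + (K * t ^+ 2)%:E.
Proof.
move=> nu0 bb'; have [K K0 HK] := bessel_q_small nu0 bb'.
move: bb' => /andP[b'0 b'b]; have b0 : (0 < b)%R by exact: lt_trans b'b.
pose K1 : R := ((2 `^ nu * Gamma nu)^-1 * ((nu + 2) `^ (nu + 2) * 2 `^ (nu + 2)))%R.
have K10 : (0 <= K1)%R.
  rewrite /K1 mulr_ge0// ?mulr_ge0 ?powR_ge0// invr_ge0 mulr_ge0 ?powR_ge0//.
  by rewrite ltW// Gamma_gt0.
exists (K1 / b ^+ 4 + K * b')%R.
  apply: addr_ge0; apply: mulr_ge0 => //; last exact: ltW.
  by rewrite invr_ge0 exprn_ge0// ltW.
move=> t x t0 bx; have x0 : (0 < x)%R by exact: lt_trans bx.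
have nu1 : (- nu != 0)%R by rewrite oppr_eq0 gt_eqF.
have mq := measurable_bessel_q t nu1.
have q0 : forall z y : R, (0 < y)%R -> (0 <= bessel_q (- nu) t z y)%R.
  by move=> z y; exact: bessel_q_ge0.
(* Mass missing from (b', oo) was killed at 0 before [t] or landed in (0, b']; each part is
   O(t^2). *)
apply: le_trans (survival_near1 nu0 t0 x0) _.
rewrite -kint_one// (@kint_split R _ mq q0 b' (ltW b'0))//.
rewrite -/K1 mulrDl EFinD [X in X + _]addeC -addeA leeD2l// addeC.
apply: leeD.
  rewrite lee_fin mulrAC ler_wpM2r ?sqr_ge0// ler_wpM2l//.
  by rewrite lef_pV2 ?posrE ?exprn_gt0// lerXn2r ?nnegrE ?(ltW b0) ?(ltW x0)// ltW.
apply: (@le_trans _ _ (\int[lm]_(y in `]0%R, b']) (K * t ^+ 2)%:E)).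
  rewrite /kint; under eq_integral => y _ do rewrite mule1.
  apply: le_integral_EFin => //.
    apply: (@measurable_funS _ _ _ _ setT) => //.
    exact: (measurableT_comp mq (pair1_measurable x)).
  move=> y; rewrite /= in_itv/= => /andP[y0 yb]; rewrite q0//=.
  by apply: HK => //; rewrite y0.
rewrite integral_cst//= lebesgue_measure_itv/= lte_fin b'0 -EFinB -EFinM lee_fin.
by rewrite subr0 mulrAC.
Qed.

End hitting_zero.

(** * Hitting events of continuous paths and their dyadic approximation *)

Section path_events.
Context (R : realType).
Notation pos := (`]0%R, +oo[%classic : set R).
Implicit Types (w : Omega R) (a b c s t d e : R).

Lemma path_continuous_at w s e : 0 <= s -> 0 < e ->
  exists2 d, 0 < d & forall u : R, 0 <= u -> `|u - s| < d -> `|path_of w u - path_of w s| < e.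
Proof.
move=> s0 e0; have [cw _] := path_ofP w.
have /subspace_continuousP/(_ s) := cw.
rewrite /= in_itv/= andbT => /(_ s0) /cvgrPdist_lt /(_ e e0).
rewrite near_withinE => /nbhs_ballP[d /= d0 H].
exists d => // u u0 us; rewrite distrC; apply: H; last by rewrite /= in_itv/= andbT.
by rewrite /ball/= distrC.
Qed.

Lemma path_within w s t : 0 <= s -> {within `[s, t], continuous (path_of w)}.
Proof.
move=> s0; have [cw _] := path_ofP w; apply: continuous_subspaceW cw.
by move=> u; rewrite /= !in_itv/= andbT => /andP[su _]; exact: le_trans su.
Qed.

Lemma path_stays_above w b s : 0 <= s -> b < path_of w 0 ->
  (forall u : R, 0 <= u <= s -> path_of w u != b) -> b < path_of w s.
Proof.
move=> s0 b0 nb; rewrite ltNge; apply/negP => ws.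
have [//|c] := @IVT R (path_of w) 0 s b s0 (@path_within w 0 s (lexx 0)).
  by rewrite ge_min ws orbT/= le_max (ltW b0).
by rewrite in_itv/= => cs cb; move: (nb c cs); rewrite cb eqxx.
Qed.

Lemma hit_gt_avoid b w t s : (t%:E < hit b w)%E -> 0 <= s <= t -> path_of w s != b.
Proof.
move=> tb /andP[s0 st]; apply/negP => /eqP ws.
have : (hit b w <= s%:E)%E by apply: ereal_inf_lbound; exists s.
by move=> /(lt_le_trans tb); rewrite lte_fin ltNge st.
Qed.

(** The slack [e] gives a strict inequality although [hit] is an infimum. It is supplied by
    continuity of the path at [t]. *)
Lemma avoid_hit_gt b w t e : 0 < e ->
  (forall s, 0 <= s <= t + e -> path_of w s != b) -> (t%:E < hit b w)%E.
Proof.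
move=> e0 nb; apply: (@lt_le_trans _ _ (t + e)%:E); first by rewrite lte_fin ltrDl.
apply: le_ereal_inf_tmp => _ [s [s0 ws] <-]; rewrite lee_fin leNgt; apply/negP => st.
by have := nb s; rewrite s0 ws eqxx (ltW st) => /(_ isT).
Qed.

Lemma hit_gt_above b w t : 0 <= t -> b < path_of w 0 ->
  (t%:E < hit b w)%E -> forall s, 0 <= s <= t -> b < path_of w s.
Proof.
move=> t0 b0 tb s /andP[s0 st]; apply: path_stays_above => // u /andP[u0 us].
by apply: hit_gt_avoid tb _; rewrite u0 (le_trans us st).
Qed.

Lemma hit_antitone b c w : b <= c -> c <= path_of w 0 -> (hit c w <= hit b w)%E.
Proof.
move=> bc cw; apply: le_ereal_inf_tmp => _ [s [s0 ws] <-].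
have [//|u] := @IVT R (path_of w) 0 s c s0 (@path_within w 0 s (lexx 0)).
  by rewrite ge_min ws bc orbT/= le_max cw.
rewrite in_itv/= => /andP[u0 us] wu.
by apply: (@le_trans _ _ u%:E); [apply: ereal_inf_lbound; exists u|rewrite lee_fin].
Qed.

Lemma dyadic_close t s d : 0 < t -> 0 <= s <= t -> 0 < d ->
  exists n k : nat, (k <= 2 ^ n)%N /\ `|t / 2 ^+ n * k%:R - s| < d.
Proof.
move=> t0 /andP[s0 st] d0.
have [n tn] := nat_above (t / d).
have p0 : 0 < (2 : R) ^+ n.+1 by rewrite exprn_gt0.
have pn : t / d < 2 ^+ n.+1.
  by apply: (le_lt_trans tn); rewrite -natrX ltr_nat ltn_expl.
have x0 : 0 <= s / (t / 2 ^+ n.+1) by rewrite divr_ge0// divr_ge0// ltW.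
have q0 : 0 < t / 2 ^+ n.+1 by rewrite divr_gt0.
exists n.+1, (Num.truncn (s / (t / 2 ^+ n.+1))).
have /andP[k1 k2] := truncn_itv x0.
split.
  rewrite -(ler_nat R); apply: (le_trans k1).
  by rewrite ler_pdivrMr// natrX mulrCA divff ?mulr1// gt_eqF.
move: k1 k2; rewrite ler_pdivlMr// ltr_pdivrMr// => k1 k2.
rewrite ler0_norm; last by rewrite subr_le0 mulrC.
have q1 : t / 2 ^+ n.+1 < d by rewrite ltr_pdivrMr// mulrC -ltr_pdivrMr.
rewrite opprB; apply: le_lt_trans q1.
rewrite -natr1 mulrDl mul1r in k2.
by rewrite [_ / _ * _%:R]mulrC; lra.
Qed.

(** A weak inequality passes from a dense set of times to all times. It is used with the distance to
    [b], for measurability, and with the identity, for levels. *)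
Lemma dyadic_lower_bound w t c (g : R -> R) : 0 < t -> continuous g ->
  (forall n k : nat, (k <= 2 ^ n)%N -> c <= g (path_of w (t / 2 ^+ n * k%:R))) ->
  forall s, 0 <= s <= t -> c <= g (path_of w s).
Proof.
move=> t0 cg H s /andP[s0 st]; rewrite leNgt; apply/negP => gc.
have e0 : 0 < c - g (path_of w s) by rewrite subr_gt0.
have /cvgrPdist_lt/(_ _ e0) /nbhs_ballP[d1 /= d10 Hd1] := cg (path_of w s).
have [d d0 Hd] := path_continuous_at w s0 d10.
have sst : 0 <= s <= t by rewrite s0.
have [n [k [kn dk]]] := dyadic_close t0 sst d0.
have k0 : 0 <= t / 2 ^+ n * k%:R by rewrite mulr_ge0// divr_ge0 ?exprn_ge0// ltW.
have := Hd _ k0 dk; rewrite distrC => /Hd1 /=; rewrite distrC.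
have := H n k kn; set v := g (path_of w (_ * _)) => cv.
by rewrite ger0_norm ?subr_ge0 ?(le_trans (ltW gc))// ltrBlDr subrK ltNge cv.
Qed.

Lemma measurable_coord s (B : set R) : measurable B ->
  measurable [set w : Omega R | B (path_of w s)].
Proof. by move=> mB; apply: sub_sigma_algebra; exists s, B. Qed.

(** By compactness a path avoiding [b] on [0, t] stays at distance at least 1 / (m + 1) from it for
    some [m]. Conversely this distance at time [t] keeps the path off [b] slightly beyond [t], hence
    the strict inequality. Only countably many coordinates remain, which gives measurability. *)
Lemma hit_gtE b t : 0 < t ->
  [set w : Omega R | (t%:E < hit b w)%E] =
  \bigcup_m \bigcap_n \bigcap_(k in [set k | (k <= 2 ^ n)%N])
    [set w : Omega R | m.+1%:R^-1 <= `|path_of w (t / 2 ^+ n * k%:R) - b|].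
Proof.
move=> t0; apply/seteqP; split => w /=.
  move=> tb.
  have cf : {within `[0, t], continuous (fun s => `|path_of w s - b|)}.
    move=> s; apply: (@continuous_comp _ _ _ (path_of w : subspace _ -> R) (fun y : R => `|y - b|)).
      exact: (@path_within w 0 t (lexx 0) s).
    apply: continuous_comp; last exact: norm_continuous.
    by apply: cvgB; [exact: cvg_id|exact: cvg_cst].
  have [c ct cmin] := EVT_min (ltW t0) cf.
  have c0 : 0 < `|path_of w c - b|.
    rewrite normr_gt0 subr_eq0; apply: hit_gt_avoid tb _.
    by move: ct; rewrite in_itv.
  have [m cm] := nat_above `|path_of w c - b|^-1.
  exists m => // n _ k /= kn.
  apply: (@le_trans _ _ `|path_of w c - b|).
    by rewrite -[leRHS]invrK lef_pV2 ?posrE ?invr_gt0.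
  apply: cmin; rewrite in_itv/=; apply/andP; split.
    by rewrite mulr_ge0// divr_ge0 ?exprn_ge0// ltW.
  rewrite mulrAC ler_pdivrMr ?exprn_gt0// ler_pM2l// -natrX ler_nat//.
move=> [m _ Hm].
have cg : continuous (fun y : R => `|y - b|).
  move=> y; apply: (@continuous_comp _ _ _ (fun y : R => y - b) (fun y : R => `|y|)).
    by apply: cvgB; [exact: cvg_id|exact: cvg_cst].
  exact: norm_continuous.
have H := @dyadic_lower_bound w t m.+1%:R^-1 (fun y => `|y - b|) t0 cg
  (fun n k kn => Hm n I k kn).
have m0 : 0 < (m.+1%:R^-1 : R) by rewrite invr_gt0.
have [d d0 Hd] := path_continuous_at w (ltW t0) m0.
have d20 : 0 < d / 2 by rewrite divr_gt0.
apply: (@avoid_hit_gt b w t (d / 2)) => // s /andP[s0 sd].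
have [st|ts] := leP s t.
  apply/negP => /eqP ws; have := H s; rewrite s0 st ws subrr normr0 => /(_ isT).
  by rewrite leNgt m0.
apply/negP => /eqP ws; have := Hd s s0; rewrite ws.
have -> : `|s - t| < d.
  by rewrite ger0_norm ?subr_ge0 ?(ltW ts)//; lra.
move=> /(_ isT); have := H t; rewrite (ltW t0) lexx distrC => /(_ isT).
by rewrite leNgt => /negP.
Qed.

Lemma measurable_hit_gt b t : 0 < t -> measurable [set w : Omega R | (t%:E < hit b w)%E].
Proof.
move=> t0; rewrite hit_gtE//.
apply: bigcupT_measurable => m; apply: bigcapT_measurable => n.
apply: bigcap_measurable; first by exists 0%N => /=.
move=> k _.
apply: (@measurable_coord _ [set y | m.+1%:R^-1 <= `|y - b|]).
rewrite (_ : [set _ | _] = (fun y : R => `|y - b|) @^-1` `[m.+1%:R^-1, +oo[%classic).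
  rewrite -[X in measurable X]setTI.
  have : measurable_fun setT (fun y : R => `|y - b|).
    by apply: measurableT_comp => //; exact: measurable_funB.
  by apply => //; exact: measurable_itv.
by apply/seteqP; split => y /=; rewrite in_itv/= andbT.
Qed.

Definition grid_list dl (A : set R) (i N : nat) : seq (R * set R) :=
  [seq (dl * k%:R, A) | k <- iota i N].

Lemma fdd_grid mu x dl A i N :
  fdd mu x (dl * i%:R) (grid_list dl A i.+1 N) = kiter (bessel_q mu dl) A (cst 1%E) N x.
Proof.
elim: N i x => [//|N IH] i x; rewrite /grid_list/=.
have -> : dl * i.+1%:R - dl * i%:R = dl by rewrite -natr1; ring.
by rewrite /kint; apply: eq_integral => y _; rewrite -(IH i.+1 y).
Qed.

Lemma In_grid_list dl A i N p : List.In p (grid_list dl A i N) <->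
  exists2 k : nat, (i <= k < i + N)%N & p = (dl * k%:R, A).
Proof.
elim: N i => [|N IH] i /=.
  by split => // -[k]; rewrite addn0; case/andP => ik /(leq_ltn_trans ik); rewrite ltnn.
split=> [[<-|/IH[k /andP[ik kN] ->]]|[k /andP[ik kN] pE]].
- by exists i => //; rewrite leqnn -addSnnS leq_addr.
- by exists k => //; rewrite (ltnW ik)/= -addSnnS.
- move: ik; rewrite leq_eqVlt => /predU1P[->|ik]; [by left|right].
  by apply/(IH i.+1); exists k => //; rewrite ik addSnnS.
Qed.

Lemma last_time_grid dl A N : last_time (grid_list dl A 1 N.+1) = dl * N.+1%:R.
Proof.
rewrite /last_time /grid_list -map_comp (eq_map (g := fun k : nat => dl * k%:R))//.
by rewrite -[X in iota 1 X]addn1 iotaD map_cat last_cat /= add1n.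
Qed.

Lemma sorted_grid dl A i N : 0 < dl ->
  sorted (fun p q : R * set R => p.1 < q.1) (grid_list dl A i N).
Proof.
move=> dl0; rewrite /grid_list; case: N => // N /=.
elim: N i => //= N IH i; rewrite IH andbT.
by rewrite ltr_pM2l// ltr_nat.
Qed.

(** The condition on [hit 0] matches the events on which [bessel_law] prescribes probabilities. Time
    0 is left out because those events involve positive times only. *)
Definition grid_event b t (n : nat) : set (Omega R) :=
  [set w : Omega R | (t%:E < hit 0 w)%E /\
     forall k, (0 < k <= 2 ^ n)%N -> b < path_of w (t / 2 ^+ n * k%:R)].

Lemma measurable_grid_event b t n : 0 < t -> measurable (grid_event b t n).
Proof.
move=> t0.
have -> : grid_event b t n = [set w : Omega R | (t%:E < hit 0 w)%E] `&`
    \bigcap_(k in [set k | (0 < k <= 2 ^ n)%N])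
      [set w : Omega R | `]b, +oo[%classic (path_of w (t / 2 ^+ n * k%:R))].
  apply/seteqP; split => w [] /= h1 h2; split => // k /= kn.
    by rewrite in_itv/= andbT; exact: h2.
  by have := h2 k kn; rewrite /= in_itv/= andbT.
apply: measurableI; first exact: measurable_hit_gt.
apply: bigcap_measurable; first by exists 1%N => /=; rewrite expn_gt0.
by move=> k _; exact: measurable_coord.
Qed.

Lemma grid_event_nonincreasing b t : 0 < t ->
  nonincreasing_seq (grid_event b t).
Proof.
move=> t0; apply/nonincreasing_seqP => n; rewrite subsetEset => w [h1 h2]; split => //.
move=> k /andP[k0 kn]; have -> : t / 2 ^+ n * k%:R = t / 2 ^+ n.+1 * (k * 2)%:R.
  by rewrite exprS natrM; field; rewrite expf_neq0.
by apply: h2; rewrite muln_gt0 k0/= expnSr leq_pmul2r.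
Qed.

Section law.
Variables (mu a : R) (P : probability (Omega R) R).
Hypothesis lawP : bessel_law mu a P.

Lemma law_grid_event b t n : 0 < t -> 0 <= b ->
  P (grid_event b t n) =
  kiter (bessel_q mu (t / 2 ^+ n)) `]b, +oo[%classic (cst 1%E) (2 ^ n) a.
Proof.
move=> t0 b0; have dl0 : 0 < t / 2 ^+ n by rewrite divr_gt0// exprn_gt0.
have [_ /(_ (grid_list (t / 2 ^+ n) `]b, +oo[%classic 1 (2 ^ n)))] := lawP.
have -> : fdd mu a 0 (grid_list (t / 2 ^+ n) `]b, +oo[%classic 1 (2 ^ n)) =
    kiter (bessel_q mu (t / 2 ^+ n)) `]b, +oo[%classic (cst 1%E) (2 ^ n) a.
  by rewrite -(fdd_grid mu a _ _ 0 (2 ^ n)) mulr0.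
move=> <-.
- have [N HN] : exists N, (2 ^ n)%N = N.+1.
    by exists (2 ^ n).-1; rewrite prednK// expn_gt0.
  have -> : last_time (grid_list (t / 2 ^+ n) `]b, +oo[%classic 1 (2 ^ n)) = t.
    by rewrite HN last_time_grid -HN natrX divfK// expf_neq0.
  congr (P _); apply/seteqP; split => w [h1 h2]; split => //.
    move=> p /In_grid_list[k /andP[k0 kn] ->] /=; rewrite in_itv/= andbT.
    by apply: h2; rewrite k0.
  move=> k kn; have := h2 (t / 2 ^+ n * k%:R, `]b, +oo[%classic).
  rewrite /= in_itv/= andbT; apply; apply/In_grid_list; exists k => //.
- exact: sorted_grid.
- move=> p /In_grid_list[k /andP[k0 kn] ->] /=; split; first by rewrite mulr_gt0// ltr0n.
  split; first exact: measurable_itv.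
  exact: above_pos.
Qed.

Lemma measurable_start : measurable [set w : Omega R | path_of w 0 = a].
Proof. by apply: (@measurable_coord 0 [set a]); exact: measurable_set1. Qed.

Lemma start_full (A : set (Omega R)) : measurable A ->
  P A = P (A `&` [set w : Omega R | path_of w 0 = a]).
Proof.
move=> mA; have mS := measurable_start.
rewrite -[in LHS](setIT A) -(setUv [set w : Omega R | path_of w 0 = a]) setIUr.
rewrite measureU//; last 3 first.
- exact: measurableI.
- by apply: measurableI => //; exact: measurableC.
- by rewrite setIACA setICr !setI0.
rewrite [X in (_ + X)%E = _](_ : _ = 0%E) ?adde0//; apply/eqP; rewrite -measure_le0.
apply: (@le_trans _ _ (P (~` [set w : Omega R | path_of w 0 = a]))).
  by apply: le_measure; rewrite ?inE//; [apply: measurableI => //|]; exact: measurableC.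
by rewrite probability_setC//; have [-> _] := lawP; rewrite subee.
Qed.

Lemma law_hit_upper b t n : 0 < t -> 0 <= b -> b < a ->
  (P [set w : Omega R | (t%:E < hit b w)%E] <=
   kiter (bessel_q mu (t / 2 ^+ n)) `]b, +oo[%classic (cst 1%E) (2 ^ n) a)%E.
Proof.
move=> t0 b0 ba; have mH := measurable_hit_gt b t0; have mS := measurable_start.
rewrite -law_grid_event// start_full//.
apply: le_measure; rewrite ?inE; [exact: measurableI|exact: measurable_grid_event|].
move=> w [/= tb wa]; split.
  by apply: (lt_le_trans tb); apply: hit_antitone => //; rewrite wa ltW.
move=> k /andP[k0 kn]; apply: (@hit_gt_above b w t) => //; rewrite ?wa ?(ltW t0)//.
rewrite mulr_ge0 ?divr_ge0 ?exprn_ge0 ?(ltW t0)//=.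
by rewrite mulrAC ler_pdivrMr ?exprn_gt0// ler_pM2l// -natrX ler_nat.
Qed.

(** In the limit of the grids the path is only known to be at least [c] on [0, t]. Taking c > b
    leaves a margin, which continuity extends past [t]. The passage to the limit is continuity of
    [P] from above, so a bound for large [n] is enough. *)
Lemma law_hit_lower b c t n0 (L : \bar R) : 0 < t -> 0 <= b -> b < c -> c < a ->
  (forall n, (n0 <= n)%N ->
    L <= kiter (bessel_q mu (t / 2 ^+ n)) `]c, +oo[%classic (cst 1%E) (2 ^ n) a)%E ->
  (L <= P [set w : Omega R | (t%:E < hit b w)%E])%E.
Proof.
move=> t0 b0 bc ca HL; have mH := measurable_hit_gt b t0; have mS := measurable_start.
have c0 : 0 <= c by exact: (le_trans b0 (ltW bc)).
have mE n : measurable (grid_event c t n) by exact: measurable_grid_event.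
have mI : measurable (\bigcap_n grid_event c t n) by exact: bigcapT_measurable.
have cv : (P \o grid_event c t) n @[n --> \oo] --> P (\bigcap_n grid_event c t n).
  apply: nonincreasing_cvg_mu => //.
  - by rewrite (le_lt_trans (probability_le1 P (mE 0%N)))// ltry.
  - exact: grid_event_nonincreasing.
apply: (@le_trans _ _ (P (\bigcap_n grid_event c t n))).
  rewrite -(cvg_lim _ cv)//; apply: lime_ge.
    by apply/cvg_ex; eexists; exact: cv.
  by exists n0 => // n /= n0n; rewrite law_grid_event//; exact: HL.
rewrite start_full//; apply: le_measure; rewrite ?inE//; first exact: measurableI.
move=> w [/= Hw wa].
have H := @dyadic_lower_bound w t c id t0 (fun x => @cvg_id _ _).
have {}H : forall s, 0 <= s <= t -> c <= path_of w s.
  (* Time 0 is absent from the grid events; there the starting point [a], which lies above [c], is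
     used. *)
  apply: H => n [|k] kn; first by rewrite mulr0 wa ltW.
  by have [_ h] := Hw n I; apply/ltW/h.
have cb0 : 0 < c - b by rewrite subr_gt0.
have [d d0 Hd] := path_continuous_at w (ltW t0) cb0.
apply: (@avoid_hit_gt b w t (d / 2)); first by rewrite divr_gt0.
move=> s /andP[s0 sd]; have [st|ts] := leP s t.
  by rewrite gt_eqF// (lt_le_trans bc)// H// s0.
have := Hd s s0; have -> : `|s - t| < d.
  by rewrite ger0_norm ?subr_ge0 ?(ltW ts)//; lra.
have := H t; rewrite (ltW t0) lexx => /(_ isT) ct /(_ isT).
rewrite ltr_norml => /andP[h _]; rewrite gt_eqF//; lra.
Qed.

End law.

Lemma hit_infinity b : [set w : Omega R | hit b w = +oo%E] =
  \bigcap_n [set w : Omega R | (n.+1%:R%:E < hit b w)%E].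
Proof.
apply/seteqP; split => w /=; first by move=> h n _; rewrite /= h ltry.
move=> H; have := H 0%N I => /=.
case E : (hit b w) => [r| |]//= _; have [n rn] := nat_above r.
by have := H n I; rewrite /= E lte_fin ltNge rn.
Qed.

Lemma measurable_hit_infinity b : measurable [set w : Omega R | hit b w = +oo%E].
Proof.
rewrite hit_infinity; apply: bigcapT_measurable => n.
exact: measurable_hit_gt.
Qed.

Lemma hit_gt_finite (P : probability (Omega R) R) b t : 0 < t ->
  P [set w : Omega R | (t%:E < hit b w)%E /\ (hit b w < +oo)%E] =
  (P [set w : Omega R | (t%:E < hit b w)%E] - P [set w : Omega R | hit b w = +oo%E])%E.
Proof.
move=> t0; have mH := measurable_hit_gt b t0; have mI := measurable_hit_infinity b.
have -> : [set w : Omega R | (t%:E < hit b w)%E /\ (hit b w < +oo)%E] =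
    [set w : Omega R | (t%:E < hit b w)%E] `\` [set w : Omega R | hit b w = +oo%E].
  apply/seteqP; split => w /= [h1]; first by move=> h2; split => // h3; rewrite h3 in h2.
  by move=> /eqP h2; split => //; rewrite ltey.
rewrite measureD//; last by rewrite (le_lt_trans (probability_le1 P mH))// ltry.
congr (_ - P _)%E; apply/seteqP; split => w /=; first by case.
by move=> h; split => //; rewrite h ltry.
Qed.

Lemma cvg_hit_infinity (P : probability (Omega R) R) b :
  P [set w : Omega R | (n.+1%:R%:E < hit b w)%E] @[n --> \oo] -->
  P [set w : Omega R | hit b w = +oo%E].
Proof.
rewrite hit_infinity; apply: nonincreasing_cvg_mu => //.
- by rewrite (le_lt_trans (probability_le1 P (measurable_hit_gt b _)))// ltry.
- by move=> n; exact: measurable_hit_gt.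
- by rewrite -hit_infinity; exact: measurable_hit_infinity.
- move=> m n mn; rewrite subsetEset => w /=; apply: le_lt_trans.
  by rewrite lee_fin ler_nat.
Qed.

End path_events.

(** * Estimates for the chain sampled at step [dl], under both indices *)

Section sampled_process.
Context (R : realType).
Notation pos := (`]0%R, +oo[%classic : set R).
Local Open Scope ereal_scope.
Variable nu : R.
Hypothesis nu0 : (0 < nu)%R.
Implicit Types (a b c s t x dl : R).

Let nuN : (- nu != 0)%R. Proof. by rewrite oppr_eq0 gt_eqF. Qed.
Let nuP : (nu != 0)%R. Proof. by rewrite gt_eqF. Qed.
Let nu20 : (0 < 2 * nu)%R. Proof. exact: mulr_gt0. Qed.
Let C := @tail_const R nu.
Let C0 : (0 < C)%R. Proof. exact: tail_const_gt0. Qed.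

Notation Q dl := (@bessel_q R (- nu) dl).
Notation D dl c n x := (kiter (Q dl) `]c, +oo[ (cst 1) n x).
Notation V dl c n x := (kiter (Q dl) `]c, +oo[ (fun y : R => (y `^ (2 * nu))%:E) n x).

Lemma kint_powR t x : (0 < t)%R -> (0 < x)%R ->
  kint (Q t) pos (fun y : R => (y `^ (2 * nu))%:E) x = (x `^ (2 * nu))%:E.
Proof.
move=> t0 x0; have := bessel_q_laplace nu0 t0 x0 (lexx 0%R).
rewrite mulr0 !mul0r addr0 powR1 oppr0 expR0 !mulr1 => <-.
rewrite /kint; apply: eq_integral => y _.
by rewrite mul0r oppr0 expR0 mulr1.
Qed.

Lemma kint_one_le1 t x : (0 < t)%R -> (0 < x)%R -> kint (Q t) pos (cst 1) x <= 1.
Proof. by move=> t0 x0; rewrite kint_one// survival_le1// ltW. Qed.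

Lemma kint_flip dl (A : set R) (f : R -> \bar R) x : (0 < dl)%R -> (0 < x)%R ->
  measurable A -> A `<=` pos -> measurable_fun pos f ->
  (forall y, (0 < y)%R -> 0 <= f y) ->
  kint (bessel_q nu dl) A f x =
  (x `^ (- (2 * nu)))%:E * kint (Q dl) A (fun y => (y `^ (2 * nu))%:E * f y) x.
Proof.
move=> dl0 x0 mA Ap mf f0.
have q0 : forall z y : R, (0 < y)%R -> (0 <= Q dl z y)%R.
  by move=> z y; exact: bessel_q_ge0.
have mp : measurable_fun pos (fun y => (y `^ (2 * nu))%:E * f y).
  by apply: emeasurable_funM => //; apply/measurable_EFinP; exact: measurable_powR_on.
rewrite -(@kintZ R _ (measurable_bessel_q dl nuN) q0 A)//; last 2 first.
- exact: powR_ge0.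
- by move=> y y0; rewrite mule_ge0 ?lee_fin ?powR_ge0 ?f0.
rewrite /kint; apply: eq_integral => y /[!inE] /Ap; rewrite posP => y0.
by rewrite bessel_q_flip// !EFinM !muleA; congr (_ * _); rewrite -!EFinM; congr EFin; ring.
Qed.

(** The factors introduced by the h-transform telescope: y^(2 nu) from one step cancels y^(- 2 nu)
    from the next, and only the one at the starting point remains. *)
Lemma kiter_flip dl c n x : (0 < dl)%R -> (0 <= c)%R -> (0 < x)%R ->
  V dl c n x = (x `^ (2 * nu))%:E * kiter (bessel_q nu dl) `]c, +oo[ (cst 1) n x.
Proof.
move=> dl0 c0; elim: n x => [|n IH] x x0; first by rewrite /= mule1.
have mq := measurable_bessel_q dl nuP.
have q0 : forall z y : R, (0 < y)%R -> (0 <= bessel_q nu dl z y)%R.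
  by move=> z y; exact: bessel_q_ge0.
have ab := @above_pos R c c0.
have mA : measurable (`]c, +oo[%classic : set R) by exact: measurable_itv.
have mf := @measurable_kiter R _ mq q0 _ (cst 1) n mA ab (measurable_cst _) (fun _ _ => lee01).
have f0 := @kiter_ge0 R _ q0 _ (cst 1) n ab (fun _ _ => lee01).
have E := @kint_flip dl `]c, +oo[ _ x dl0 x0 mA ab mf f0.
transitivity ((x `^ (2 * nu))%:E * ((x `^ (- (2 * nu)))%:E * kint (Q dl) `]c, +oo[
  (fun y => (y `^ (2 * nu))%:E * kiter (bessel_q nu dl) `]c, +oo[ (cst 1) n y) x)); last first.
  by congr (_ * _); exact: esym.
have x1 : x != 0%R by rewrite gt_eqF.
rewrite muleA -EFinM -powRD ?x1 ?implybT// addrN powRr0 mul1e.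
rewrite /kint; apply: eq_integral => y /[!inE] /ab; rewrite posP => y0.
by congr (_ * _); exact: (IH y y0).
Qed.

Lemma kint_plus_le1 t x : (0 < t)%R -> (0 < x)%R ->
  kint (bessel_q nu t) pos (cst 1) x <= 1.
Proof.
move=> t0 x0; rewrite kint_flip//.
have -> : (fun y : R => (y `^ (2 * nu))%:E * cst 1 y) = (fun y : R => (y `^ (2 * nu))%:E).
  by apply/funext => y; rewrite mule1.
rewrite kint_powR// -EFinM lee_fin -powRD ?addNr ?powRr0//.
by rewrite [x == 0%R]gt_eqF// implybT.
Qed.

Section step.
Variables (dl c : R).
Hypotheses (dl0 : (0 < dl)%R) (c0 : (0 <= c)%R).

Let mq := measurable_bessel_q dl nuN.
Let q0 : forall z y : R, (0 < y)%R -> (0 <= Q dl z y)%R.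
Proof. by move=> z y; exact: bessel_q_ge0. Qed.
Let ab := @above_pos R c c0.
Let mabove : measurable (`]c, +oo[%classic : set R). Proof. exact: measurable_itv. Qed.
Let mass x : (0 < x)%R -> kint (Q dl) pos (cst 1) x <= 1.
Proof. exact: kint_one_le1. Qed.

Let msurv s : measurable_fun pos (survival nu s).
Proof. by apply: (@measurable_funS _ _ _ _ setT) => //; exact: measurable_survival. Qed.

Let mpow : measurable_fun pos (fun y : R => (y `^ (2 * nu))%:E).
Proof. by apply/measurable_EFinP; exact: measurable_powR_on. Qed.

Lemma D_ge0 n x : (0 < x)%R -> 0 <= D dl c n x.
Proof. by apply: kiter_ge0. Qed.

Lemma mD n : measurable_fun pos (fun x => D dl c n x).
Proof. exact: measurable_kiter. Qed.

Lemma D_le1 n x : (0 < x)%R -> D dl c n x <= 1.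
Proof. exact: kiter_one_le1. Qed.

Lemma D_le_survival n x : (0 < x)%R -> D dl c n x <= survival nu (dl * n%:R) x.
Proof.
elim: n x => [|n IH] x x0; first by rewrite mulr0 survival0.
have -> : (dl * n.+1%:R = dl * n%:R + dl)%R by rewrite -natr1; ring.
rewrite -kint_survival ?mulr_ge0 ?(ltW dl0)//.
rewrite (@kint_split R _ mq q0 c c0)//; last by move=> y _; exact: survival_ge0.
apply: (@le_trans _ _ (kint (Q dl) `]c, +oo[ (survival nu (dl * n%:R)) x)); last first.
  by rewrite leeDr//; apply: kint_ge0 => // [|y _]; [exact: below_pos|exact: survival_ge0].
apply: le_kint => //; [exact: mD|by move=> y; exact: D_ge0|].
by move=> y /ab; rewrite posP; exact: IH.
Qed.

Lemma survival_le_below s t y : (0 < s)%R -> (s <= t)%R -> (0 < y <= c)%R ->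
  survival nu t y <= (C * c `^ (2 * nu) * s `^ (- nu))%:E.
Proof.
move=> s0 st /andP[y0 yc]; have t0 : (0 < t)%R by exact: lt_le_trans st.
apply: (le_trans (survival_upper y nu0 t0)); rewrite lee_fin.
apply: ler_pM; rewrite ?mulr_ge0 ?powR_ge0 ?(ltW C0)//.
  rewrite ler_wpM2l ?(ltW C0)//; apply: ge0_ler_powR; rewrite ?nnegrE ?(ltW y0) ?(ltW nu20)//.
rewrite !(powRN _ nu) lef_pV2 ?posrE ?powR_gt0//.
by apply: ge0_ler_powR; rewrite ?nnegrE ?(ltW s0) ?(ltW t0) ?(ltW nu0).
Qed.

(* Paths falling below [c] with at least [s + dl * m] time left are controlled by
   the last term; later falls leave only time [s], but must first survive [j] steps. *)
Lemma D_lower_step s (m j : nat) x : (0 < s)%R -> (0 < x)%R ->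
  survival nu (s + dl * (m + j)%:R) x <=
  D dl c (m + j) x + (C * c `^ (2 * nu) * s `^ (- nu))%:E * D dl c j x +
  (C * c `^ (2 * nu) * (s + dl * m%:R) `^ (- nu))%:E.
Proof.
move=> s0 x0.
pose L1 := (C * c `^ (2 * nu) * s `^ (- nu))%R.
pose L2 := (C * c `^ (2 * nu) * (s + dl * m%:R) `^ (- nu))%R.
have L10 : (0 <= L1)%R by rewrite !mulr_ge0 ?powR_ge0 ?(ltW C0).
have L20 : (0 <= L2)%R by rewrite !mulr_ge0 ?powR_ge0 ?(ltW C0).
have dk (k : nat) : (0 <= dl * k%:R)%R by rewrite mulr_ge0// ltW.
have sk (k : nat) : (0 < s + dl * k%:R)%R by rewrite ltr_wpDr.
have rec (k : nat) y : (0 < y)%R ->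
    survival nu (s + dl * k.+1%:R) y <= kint (Q dl) pos (survival nu (s + dl * k%:R)) y.
  move=> y0; rewrite kint_survival ?(ltW (sk _))//.
  by rewrite le_eqVlt; apply/orP; left; apply/eqP; congr survival; rewrite -natr1; ring.
(* Crude decomposition: a fall below [c] at any time leaves at least time [s], hence contributes at
   most [L1]. *)
have first : forall k y, (0 < y)%R ->
    survival nu (s + dl * k%:R) y + L1%:E * D dl c k y <= D dl c k y + L1%:E.
  apply: (@first_passage_lower R _ mq q0 c c0 (fun k => survival nu (s + dl * k%:R))
    (fun k y => D dl c k y) L1) => //.
  - by move=> k y _; exact: survival_ge0.
  - by move=> k y yc; apply: survival_le_below => //; rewrite lerDl.
  - by move=> y y0; rewrite survival_le1// ltW.
have m1 : measurable_fun pos (fun y => L1%:E * D dl c 0 y).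
  by apply: measurable_funeM; exact: mD.
have F20 (k : nat) y : (0 < y)%R -> 0 <= survival nu (s + dl * (m + k)%:R) y.
  by move=> _; exact: survival_ge0.
have mA2 : measurable_fun pos (fun y => D dl c (m + 0) y + L1%:E * D dl c 0 y).
  by apply: emeasurable_funD => //; exact: mD.
have LD0 (k : nat) y : (0 < y)%R -> 0 <= L1%:E * D dl c k y.
  by move=> y0; rewrite mule_ge0// D_ge0.
have A20 y : (0 < y)%R -> 0 <= D dl c (m + 0) y + L1%:E * D dl c 0 y.
  by move=> y0; rewrite adde_ge0 ?LD0 ?D_ge0.
have A2rec (k : nat) y : D dl c (m + k.+1) y + L1%:E * D dl c k.+1 y =
    kint (Q dl) `]c, +oo[ (fun y => D dl c (m + k) y + L1%:E * D dl c k y) y.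
  have mLD : measurable_fun pos (fun z => L1%:E * D dl c k z).
    by apply: measurable_funeM; exact: mD.
  rewrite (@kintD R _ mq q0 `]c, +oo[ _ _ y mabove ab (mD (m + k)) mLD
    (D_ge0 (m + k)) (LD0 k)).
  rewrite (@kintZ R _ mq q0 `]c, +oo[ _ _ y mabove ab L10 (mD k) (D_ge0 k)).
  by rewrite addnS.
have F2rec (k : nat) y : (0 < y)%R -> survival nu (s + dl * (m + k.+1)%:R) y <=
    kint (Q dl) pos (survival nu (s + dl * (m + k)%:R)) y.
  by rewrite addnS; exact: rec.
have F2L (k : nat) y : (0 < y <= c)%R -> survival nu (s + dl * (m + k)%:R) y <= L2%:E.
  move=> yc; apply: survival_le_below => //.
  by rewrite lerD2l ler_pM2l// ler_nat leq_addr.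
have F2A y : (0 < y)%R -> survival nu (s + dl * (m + 0)%:R) y <=
    D dl c (m + 0) y + L1%:E * D dl c 0 y.
  move=> y0; rewrite addn0 mule1; apply: le_trans (first m y y0).
  by rewrite leeDl// LD0.
(* The crude bound over the last [m] steps is the initial value of a recursion over the first [j]
   steps. Falls during these contribute at most [L2], and [L1] is weighted by the probability of
   having stayed above [c] for [j] steps. *)
have second := @first_passage_lower R _ mq q0 c c0
  (fun k => survival nu (s + dl * (m + k)%:R))
  (fun k y => D dl c (m + k) y + L1%:E * D dl c k y) L2 mass L20
  (fun k => msurv _) F20 mA2 A20 A2rec F2rec F2L F2A.
apply: le_trans (second j x x0).
by rewrite leeDl// mule_ge0 ?lee_fin ?D_ge0.
Qed.

(** First passage for the harmonic function, constant in time: the function increases with the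
    position, so it is at most c^(2 nu) after a fall. [V_upper] is the converse, with b' in place of
    [c] and the overshoot error added. *)
Lemma V_lower n x : (0 < x)%R ->
  (x `^ (2 * nu))%:E + (c `^ (2 * nu))%:E * D dl c n x <= V dl c n x + (c `^ (2 * nu))%:E.
Proof.
apply: (@first_passage_lower R _ mq q0 c c0 (fun _ y => (y `^ (2 * nu))%:E)
  (fun k y => V dl c k y) (c `^ (2 * nu))) => //.
- exact: powR_ge0.
- by move=> k y _; rewrite lee_fin powR_ge0.
- by move=> y _; rewrite lee_fin powR_ge0.
- by move=> _ y y0; rewrite kint_powR.
- move=> _ y /andP[y0 yc]; rewrite lee_fin; apply: ge0_ler_powR => //.
    exact: ltW.
  by rewrite nnegrE ltW.
Qed.

Lemma V_upper b' K n x : (0 < b' < c)%R -> (0 <= K)%R ->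
  (forall x, (c < x)%R -> 1 <= kint (Q dl) `]b', +oo[ (cst 1) x + (K * dl ^+ 2)%:E) ->
  (c < x)%R ->
  V dl c n x + (b' `^ (2 * nu))%:E <=
  (x `^ (2 * nu))%:E + (b' `^ (2 * nu))%:E * D dl c n x +
    (b' `^ (2 * nu) * n%:R * (K * dl ^+ 2))%:E.
Proof.
move=> b'c K0 HK cx; have /andP[b'0 _] := b'c.
apply: (@first_passage_upper R _ mq q0 c c0 (fun _ y => (y `^ (2 * nu))%:E)
  (fun k y => V dl c k y) (b' `^ (2 * nu)) b' (K * dl ^+ 2)) => //.
- by rewrite mulr_ge0// exprn_ge0// ltW.
- exact: powR_ge0.
- by move=> k y _; rewrite lee_fin powR_ge0.
- by move=> y _; rewrite lee_fin powR_ge0.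
- by move=> _ y y0; rewrite kint_powR.
- move=> _ y _ /andP[b'y _]; rewrite lee_fin; apply: ge0_ler_powR => //.
  + exact: ltW.
  + by rewrite nnegrE ltW.
  + by rewrite nnegrE ltW// (lt_trans b'0).
  + exact: ltW.
Qed.

(** Only falls during the first [j] steps are counted; they leave between [m] and [m + j] steps. In
    [L] the power of time is taken at the longest duration and the exponential at the shortest, so
    that [L] bounds all these tails from below. The condition on [m] keeps the exponential under
    control. *)
Lemma D_upper_step b' K L (m j : nat) x : (0 < b' < c)%R -> (0 <= K)%R ->
  (forall x, (c < x)%R -> 1 <= kint (Q dl) `]b', +oo[ (cst 1) x + (K * dl ^+ 2)%:E) ->
  (0 < m)%N -> (c < x)%R ->
  L = (C * b' `^ (2 * nu) * (dl * (m + j)%:R) `^ (- nu) *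
       expR (- (c ^+ 2 / (2 * (dl * m%:R)))))%R ->
  D dl c (m + j) x + L%:E <=
  survival nu (dl * (m + j)%:R) x + L%:E * D dl c j x + (L * j%:R * (K * dl ^+ 2))%:E.
Proof.
move=> b'c K0 HK m0 cx LE; have /andP[b'0 _] := b'c.
have L0 : (0 <= L)%R by rewrite LE !mulr_ge0 ?powR_ge0 ?expR_ge0 ?(ltW C0).
have dk (k : nat) : (0 <= dl * k%:R)%R by rewrite mulr_ge0// ltW.
apply: (@first_passage_upper R _ mq q0 c c0 (fun k => survival nu (dl * (m + k)%:R))
  (fun k y => D dl c (m + k) y) L b' (K * dl ^+ 2)) => //.
- by rewrite mulr_ge0// exprn_ge0// ltW.
- by move=> k y _; exact: survival_ge0.
- by rewrite addn0; exact: mD.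
- by move=> y; exact: D_ge0.
- by move=> k y; rewrite addnS.
- move=> k y y0; rewrite kint_survival//.
  by rewrite le_eqVlt; apply/orP; left; apply/eqP; congr survival; rewrite addnS -natr1; ring.
- by move=> y y0; rewrite addn0; exact: D_le_survival.
- move=> i y ij /andP[b'y yc]; have y0 : (0 < y)%R by exact: lt_trans b'y.
  have dm0 : (0 < dl * m%:R)%R by rewrite mulr_gt0// ltr0n.
  have dmi : (dl * m%:R <= dl * (m + i)%:R)%R by rewrite ler_pM2l// ler_nat leq_addr.
  have dij : (dl * (m + i)%:R <= dl * (m + j)%:R)%R.
    by rewrite ler_pM2l// ler_nat leq_add2l ltnW.
  have di0 : (0 < dl * (m + i)%:R)%R by exact: lt_le_trans dmi.
  have dj0 : (0 < dl * (m + j)%:R)%R by exact: lt_le_trans dij.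
  apply: le_trans (survival_lower y nu0 di0); rewrite LE lee_fin.
  apply: ler_pM; rewrite ?expR_ge0 ?mulr_ge0 ?powR_ge0 ?(ltW C0)//.
    apply: ler_pM; rewrite ?mulr_ge0 ?powR_ge0 ?(ltW C0)//.
      rewrite ler_wpM2l ?(ltW C0)//; apply: ge0_ler_powR; rewrite ?nnegrE ?(ltW nu20)// ltW//.
    rewrite !(powRN _ nu) lef_pV2 ?posrE ?powR_gt0//.
    by apply: ge0_ler_powR; rewrite ?nnegrE ?(ltW nu0) ?(ltW di0) ?(ltW dj0).
  rewrite ler_expR lerN2; apply: ler_pM.
  - exact: sqr_ge0.
  - by rewrite invr_ge0 ltW// mulr_gt0.
  - by rewrite lerXn2r ?nnegrE ?(ltW y0).
  - rewrite lef_pV2 ?posrE; [|exact: mulr_gt0|exact: mulr_gt0].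
    by rewrite ler_wpM2l.
Qed.

End step.
End sampled_process.

(** * Explicit two-sided bounds at fixed time and their limits *)

Section asymptotics.
Context (R : realType).
Variable nu : R.
Hypothesis nu0 : 0 < nu.
Implicit Types (a b c s t w X : R).

Let C := @tail_const R nu.
Let C0 : 0 < C. Proof. exact: tail_const_gt0. Qed.
Let nu20 : 0 < 2 * nu. Proof. exact: mulr_gt0. Qed.

(** The tail from [a] minus the tail from [b], the latter weighted by a lower bound for the
    probability of a fall in the first half of [0, t]. The exponential is that of [survival_lower]
    at time t / 2. *)
Definition hit_ub a b t : R :=
  t `^ (- nu) * (C * a `^ (2 * nu) - C * b `^ (2 * nu) * expR (- (b ^+ 2 / t)) *
    (1 - C * a `^ (2 * nu) * (t / 2) `^ (- nu))).

(** With ep = 2^-r, survival from [a] is taken up to (1 + ep) t, so that a passage at any time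
    before [t] leaves at least ep t. The last term, a product of two tails at ep t, accounts for
    passages after ep t; the term before it for the earlier ones, which leave time at least [t]. *)
Definition hit_lb a b (r : nat) t : R :=
  t `^ (- nu) * (C * a `^ (2 * nu) * (1 + (2 ^+ r)^-1) `^ (- nu) *
      expR (- (a ^+ 2 / (2 * ((1 + (2 ^+ r)^-1) * t))))
    - C * b `^ (2 * nu)
    - C ^+ 2 * a `^ (2 * nu) * b `^ (2 * nu) * ((2 ^+ r)^-1 `^ (- nu)) ^+ 2 * t `^ (- nu)).

Local Notation D dl c n x :=
  (kiter (bessel_q (- nu) dl) `]c, +oo[%classic (cst 1%E) n x).

Let eq_leye (x y : \bar R) : x = y -> (x <= y)%E. Proof. by move=> ->. Qed.

Lemma D_fin dl c n x : 0 < dl -> 0 <= c -> 0 < x -> (fine (D dl c n x))%:E = D dl c n x.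
Proof.
move=> dl0 c0 x0; rewrite fineK// ge0_fin_numE; last exact: D_ge0.
by apply: (@le_lt_trans _ _ 1%E); [exact: D_le1|rewrite ltry].
Qed.

Lemma D_lower a c (r n : nat) t : 0 < a -> 0 <= c -> 0 < t -> (r <= n)%N ->
  ((hit_lb a c r t)%:E <= D (t / 2 ^+ n) c (2 ^ n) a)%E.
Proof.
move=> a0 c0 t0 rn.
set dl := t / 2 ^+ n.
have p2 (k : nat) : 0 < (2 : R) ^+ k by rewrite exprn_gt0.
have p21 (k : nat) : (2 : R) ^+ k != 0 by rewrite expf_neq0.
have dl0 : 0 < dl by rewrite divr_gt0.
set ep : R := (2 ^+ r)^-1; have ep0 : 0 < ep by rewrite invr_gt0.
(* Since ep is dyadic and r <= n, exactly [j] grid steps cover ep t, and the remaining [m] steps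
   together with the spare time ep t have length [t]. *)
pose j := (2 ^ (n - r))%N; pose m := (2 ^ n - j)%N.
have jn : (j <= 2 ^ n)%N by rewrite leq_pexp2l// leq_subr.
have mj : (m + j)%N = (2 ^ n)%N by rewrite subnK.
have s0 : 0 < ep * t by rewrite mulr_gt0.
have dN : dl * (2 ^ n)%:R = t by rewrite natrX divfK.
have dj : dl * j%:R = ep * t.
  rewrite /dl /j natrX /ep -{1}(subnK rn) exprD; field.
  by rewrite !p21.
have dm : ep * t + dl * m%:R = t.
  by rewrite -dj -mulrDr -natrD addnC mj.
have := @D_lower_step R nu nu0 dl c dl0 c0 (ep * t) m j a s0 a0.
rewrite mj dN dm -/C => H.
have e1 : ep * t + t = (1 + ep) * t by ring.
have et0 : 0 < (1 + ep) * t by rewrite mulr_gt0// addr_gt0.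
have low : ((C * a `^ (2 * nu) * ((1 + ep) * t) `^ (- nu) *
    expR (- (a ^+ 2 / (2 * ((1 + ep) * t)))))%:E <= survival nu (ep * t + t) a)%E.
  by rewrite e1; exact: survival_lower.
have Dj : (D dl c j a <= (C * a `^ (2 * nu) * (ep * t) `^ (- nu))%:E)%E.
  rewrite -dj; apply: le_trans (D_le_survival nu0 dl0 c0 j a0) _.
  by apply: survival_upper => //; rewrite dj.
have jfin := D_fin j dl0 c0 a0; have nfin := D_fin (2 ^ n) dl0 c0 a0.
move: H low Dj; rewrite -jfin -nfin.
move: (fine (D dl c j a)) (fine (D dl c (2 ^ n) a)) => dj' dn'.
rewrite -EFinM -!EFinD => H low; rewrite lee_fin => Dj.
have := le_trans low H; rewrite !lee_fin => {}H.
have L10 : 0 <= C * c `^ (2 * nu) * (ep * t) `^ (- nu).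
  by rewrite !mulr_ge0 ?powR_ge0// ltW.
have {}Dj := ler_wpM2l L10 Dj.
have m1 : ((1 + ep) * t) `^ (- nu) = (1 + ep) `^ (- nu) * t `^ (- nu).
  by rewrite powRM ?addr_ge0 ?(ltW ep0) ?(ltW t0).
have m2 : (ep * t) `^ (- nu) = ep `^ (- nu) * t `^ (- nu).
  by rewrite powRM ?(ltW ep0) ?(ltW t0).
rewrite m1 m2 in H Dj; rewrite /hit_lb -/ep.
move: H Dj; set A := expR _ => H Dj.
have -> : t `^ (- nu) * (C * a `^ (2 * nu) * (1 + ep) `^ (- nu) * A
    - C * c `^ (2 * nu)
    - C ^+ 2 * a `^ (2 * nu) * c `^ (2 * nu) * (ep `^ (- nu)) ^+ 2 * t `^ (- nu)) =
  C * a `^ (2 * nu) * ((1 + ep) `^ (- nu) * t `^ (- nu)) * A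
  - C * c `^ (2 * nu) * (ep `^ (- nu) * t `^ (- nu)) *
    (C * a `^ (2 * nu) * (ep `^ (- nu) * t `^ (- nu)))
  - C * c `^ (2 * nu) * t `^ (- nu) by ring.
lra.
Qed.

(** [D_upper_step] with m = j, half of the steps each. The intermediate level enters the main term
    only through b'^(2 nu), so it can be removed by an affine limit after the error term. *)
Lemma D_upper a c b' t : 0 < t -> 0 < b' < c -> c < a ->
  exists2 Z : R, 0 <= Z & forall n : nat,
  (D (t / 2 ^+ n.+1) c (2 ^ n.+1) a <=
    (t `^ (- nu) * (C * a `^ (2 * nu) - C * b' `^ (2 * nu) * expR (- (c ^+ 2 / t)) *
    (1 - C * a `^ (2 * nu) * (t / 2) `^ (- nu))) + Z / n.+1%:R)%:E)%E.
Proof.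
move=> t0 b'c ca; have /andP[b'0 bc] := b'c.
have c0 : 0 < c by exact: lt_trans bc.
have a0 : 0 < a by exact: lt_trans ca.
have [K K0 HK] := overshoot_bound nu0 b'c.
pose L := C * b' `^ (2 * nu) * t `^ (- nu) * expR (- (c ^+ 2 / t)).
have L0 : 0 <= L by rewrite !mulr_ge0 ?powR_ge0 ?expR_ge0// ltW.
exists (L * K * t ^+ 2) => [|n].
  by apply: mulr_ge0; [exact: mulr_ge0|exact: sqr_ge0].
set dl := t / 2 ^+ n.+1.
have p2 : 0 < (2 : R) ^+ n.+1 by rewrite exprn_gt0.
have p21 : (2 : R) ^+ n.+1 != 0 by rewrite gt_eqF.
have dl0 : 0 < dl by rewrite divr_gt0.
have mm : (2 ^ n + 2 ^ n)%N = (2 ^ n.+1)%N by rewrite addnn -mul2n expnS.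
have dN : dl * (2 ^ n.+1)%:R = t by rewrite natrX divfK.
have dn : dl * (2 ^ n)%:R = t / 2.
  by rewrite /dl natrX exprS; field; rewrite expf_neq0.
have n20 : (0 < 2 ^ n)%N by rewrite expn_gt0.
have LE : L = C * b' `^ (2 * nu) * (dl * (2 ^ n + 2 ^ n)%:R) `^ (- nu) *
    expR (- (c ^+ 2 / (2 * (dl * (2 ^ n)%:R)))).
  by rewrite mm dN dn /L; congr (_ * expR (- (_ / _))); field.
have := @D_upper_step R nu nu0 dl c dl0 (ltW c0) b' K L (2 ^ n) (2 ^ n) a b'c K0
  (fun x cx => HK dl x dl0 cx) n20 ca LE.
rewrite mm dN => H.
have up := survival_upper a nu0 t0.
have Dj : (D dl c (2 ^ n) a <= (C * a `^ (2 * nu) * (t / 2) `^ (- nu))%:E)%E.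
  rewrite -dn; apply: le_trans (D_le_survival nu0 dl0 (ltW c0) (2 ^ n) a0) _.
  by apply: survival_upper => //; rewrite dn divr_gt0.
have jfin := D_fin (2 ^ n) dl0 (ltW c0) a0; have nfin := D_fin (2 ^ n.+1) dl0 (ltW c0) a0.
(* The accumulated overshoot decays geometrically in [n]; the weaker harmonic rate is enough for
   [le_of_harmonic]. *)
have small : L * (2 ^ n)%:R * (K * dl ^+ 2) <= L * K * t ^+ 2 / n.+1%:R.
  have -> : L * (2 ^ n)%:R * (K * dl ^+ 2) = L * K * t ^+ 2 * ((2 ^ n)%:R / (2 ^+ n.+1) ^+ 2).
    by rewrite /dl; field.
  rewrite ler_wpM2l ?(mulr_ge0 (mulr_ge0 L0 K0)) ?sqr_ge0//.
  rewrite ler_pdivrMr ?exprn_gt0// mulrC ler_pdivlMr//.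
  rewrite -!natrX -natrM ler_nat.
  have h1 : (n.+1 <= 2 ^ n.+1)%N by rewrite ltnW// ltn_expl.
  have h2 : (2 ^ n <= 2 ^ n.+1)%N by rewrite leq_pexp2l.
  by rewrite mulnC (leq_trans (leq_mul h1 h2))// expnS expn1.
move: H Dj up; rewrite -jfin -nfin.
move: (fine (D dl c (2 ^ n) a)) (fine (D dl c (2 ^ n.+1) a)) => dj' dn'.
rewrite -EFinM -EFinD lee_fin => H Dj up.
have {H up} : ((dn' + L)%:E <= (C * a `^ (2 * nu) * t `^ (- nu))%:E + (L * dj')%:E +
    (L * (2 ^ n)%:R * (K * dl ^+ 2))%:E)%E.
  by apply: (le_trans H); rewrite leeD2r// leeD2r.
rewrite -!EFinD !lee_fin => H.
have {}Dj := ler_wpM2l L0 Dj.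
have -> : t `^ (- nu) * (C * a `^ (2 * nu) - C * b' `^ (2 * nu) * expR (- (c ^+ 2 / t)) *
    (1 - C * a `^ (2 * nu) * (t / 2) `^ (- nu))) =
  C * a `^ (2 * nu) * t `^ (- nu) - L + L * (C * a `^ (2 * nu) * (t / 2) `^ (- nu)).
  by rewrite /L; ring.
move: small H Dj.
move: (L * dj') (L * _ * (K * _)) (L * (C * _ * _)) (L * K * _ / _) (C * _ * _).
by move=> x1 x2 x3 x4 x5; lra.
Qed.

Lemma le_of_harmonic X (Y Z : R) : 0 <= Z ->
  (forall n : nat, X <= Y + Z / n.+1%:R) -> X <= Y.
Proof.
move=> Z0 H; apply/ler_addgt0Pr => e e0.
have [n Zn] := nat_above (Z / e).
apply: (le_trans (H n)); rewrite lerD2l ler_pdivrMr//.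
by rewrite mulrC -ler_pdivrMr.
Qed.

Lemma le_left_limit (f : R -> R) b X : continuous f -> 0 < b ->
  (forall c, 0 < c < b -> X <= f (c `^ (2 * nu))) -> X <= f (b `^ (2 * nu)).
Proof.
move=> cf b0 H.
have cv : f (c `^ (2 * nu)) @[c --> b^'-] --> f (b `^ (2 * nu)).
  apply: cvg_at_left_filter.
  apply: (@continuous_comp _ _ _ (fun c : R => c `^ (2 * nu)) f); last exact: cf.
  exact: continuous_powR_pos.
rewrite -(cvg_lim _ cv)//; apply: limr_ge; first by apply/cvg_ex; eexists; exact: cv.
near=> c; apply: H; apply/andP; split; last by near: c; exact: nbhs_left_lt.
by near: c; exact: nbhs_left_gt.
Unshelve. all: by end_near. Qed.

Lemma le_right_limit (f : R -> R) a b X : continuous f -> 0 <= b -> b < a ->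
  (forall c, b < c < a -> f (c `^ (2 * nu)) <= X) -> f (b `^ (2 * nu)) <= X.
Proof.
move=> cf b0 ba H.
have cp : c `^ (2 * nu) @[c --> b^'+] --> b `^ (2 * nu).
  (* At b = 0 the power function has only a one-sided limit at hand, so this case is separate. *)
  move: b0; rewrite le_eqVlt => /predU1P[<-|b0].
    by rewrite powR0 ?gt_eqF//; exact: powR_cvg0.
  by apply: cvg_at_right_filter; exact: continuous_powR_pos.
have cv : f (c `^ (2 * nu)) @[c --> b^'+] --> f (b `^ (2 * nu)).
  by apply: (cvg_comp _ _ cp); exact: cf.
rewrite -(cvg_lim _ cv)//; apply: limr_le; first by apply/cvg_ex; eexists; exact: cv.
near=> c; apply: H; apply/andP; split; near: c.
  exact: nbhs_right_gt.
exact: nbhs_right_lt.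
Unshelve. all: by end_near. Qed.

Lemma continuous_affine (al be : R) : continuous (fun w => al - be * w).
Proof.
move=> w; apply: cvgB; first exact: cvg_cst.
by apply: cvgM; [exact: cvg_cst|exact: cvg_id].
Qed.

(** Stated for a common lower bound [X] of all grid values, so that no limit of these values in [n]
    has to be named: the error goes first, then b' increases to [c]. *)
Lemma D_le_ub a c t : 0 < t -> 0 <= c -> c < a -> forall X,
  (forall n : nat, X <= fine (D (t / 2 ^+ n) c (2 ^ n) a)) -> X <= hit_ub a c t.
Proof.
move=> t0 c0 ca X HX; have a0 : 0 < a by exact: le_lt_trans ca.
move: c0; rewrite le_eqVlt => /predU1P[c0|c0].
  (* For c = 0 there is no level b' below [c]; the bound reduces to the tail at 0, and a single step
     suffices. *)
  have X1 : X <= fine (D t c 1 a) by have := HX 0%N; rewrite expr0 divr1.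
  have c00 : 0 <= c by rewrite -c0.
  apply: (le_trans X1); rewrite -lee_fin D_fin//.
  apply: le_trans (D_le_survival nu0 t0 c00 1 a0) _; rewrite mulr1.
  apply: le_trans (survival_upper a nu0 t0) _; rewrite lee_fin /hit_ub -c0.
  by rewrite powR0 ?gt_eqF// mulr0 !mul0r subr0 mulrC.
rewrite /hit_ub.
pose f w := t `^ (- nu) * (C * a `^ (2 * nu)) - t `^ (- nu) * C * expR (- (c ^+ 2 / t)) *
    (1 - C * a `^ (2 * nu) * (t / 2) `^ (- nu)) * w.
have fE w : t `^ (- nu) * (C * a `^ (2 * nu) - C * w * expR (- (c ^+ 2 / t)) *
    (1 - C * a `^ (2 * nu) * (t / 2) `^ (- nu))) = f w by rewrite /f; ring.
rewrite fE; apply: le_left_limit => //; first exact: continuous_affine.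
move=> b' b'c; have [Z Z0 HZ] := D_upper t0 b'c ca.
apply: (le_of_harmonic Z0) => n; apply: le_trans (HX n.+1) _.
by rewrite -fE -lee_fin D_fin// ?ltW// divr_gt0// exprn_gt0.
Qed.

Section laws.
Variables (a : R) (P : probability (Omega R) R).
Hypothesis a0 : 0 < a.

Let u b t := fine (P [set w : Omega R | (t%:E < hit b w)%E]).

Lemma prob_fin b t : 0 < t -> (u b t)%:E = P [set w : Omega R | (t%:E < hit b w)%E].
Proof.
move=> t0; rewrite /u fineK// ge0_fin_numE//.
by rewrite (le_lt_trans (probability_le1 P (measurable_hit_gt b t0)))// ltry.
Qed.

Lemma hit_minus_upper b t : bessel_law (- nu) a P -> 0 < t -> 0 <= b -> b < a ->
  u b t <= hit_ub a b t.
Proof.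
move=> lawP t0 b0 ba; apply: D_le_ub => // n.
have dl0 : 0 < t / 2 ^+ n by rewrite divr_gt0// exprn_gt0.
by rewrite -lee_fin prob_fin// D_fin//; exact: law_hit_upper.
Qed.

Lemma hit_minus_lower b r t : bessel_law (- nu) a P -> 0 < t -> 0 <= b -> b < a ->
  hit_lb a b r t <= u b t.
Proof.
move=> lawP t0 b0 ba.
pose A := C * a `^ (2 * nu) * (1 + (2 ^+ r)^-1) `^ (- nu) *
      expR (- (a ^+ 2 / (2 * ((1 + (2 ^+ r)^-1) * t)))).
pose B := C ^+ 2 * a `^ (2 * nu) * ((2 ^+ r)^-1 `^ (- nu)) ^+ 2 * t `^ (- nu).
pose f w := t `^ (- nu) * A - t `^ (- nu) * (C + B) * w.
have fE c : hit_lb a c r t = f (c `^ (2 * nu)) by rewrite /hit_lb /f /A /B; ring.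
rewrite fE; apply: (le_right_limit (a := a)) => //; first exact: continuous_affine.
move=> c /andP[bc ca]; have c0 : 0 <= c by exact: le_trans (ltW bc).
rewrite -fE -lee_fin prob_fin//; apply: (law_hit_lower (n0 := r) lawP t0 b0 bc ca) => n rn.
exact: D_lower.
Qed.

Lemma prob_ge0 b t : 0 < t -> 0 <= u b t <= 1.
Proof.
move=> t0; rewrite -!lee_fin prob_fin// measure_ge0/=.
exact: (probability_le1 P (measurable_hit_gt b t0)).
Qed.

Local Notation Dp dl c n := (kiter (bessel_q nu dl) `]c, +oo[%classic (cst 1%E) n a).

Lemma Dp_fin dl c n : 0 < dl -> 0 <= c -> (fine (Dp dl c n))%:E = Dp dl c n.
Proof.
move=> dl0 c0; have nuP : nu != 0 by rewrite gt_eqF.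
have q0 : forall z y : R, 0 < y -> 0 <= bessel_q nu dl z y.
  by move=> z y; exact: bessel_q_ge0.
rewrite fineK// ge0_fin_numE.
  apply: (@le_lt_trans _ _ 1%E); last by rewrite ltry.
  apply: (@kiter_one_le1 R _ (measurable_bessel_q dl nuP) q0 c c0) => //.
  by move=> x; exact: kint_plus_le1.
by apply: (@kiter_ge0 R _ q0) => //; exact: above_pos.
Qed.

Lemma powR_ratio c : 0 <= c -> (c / a) `^ (2 * nu) * a `^ (2 * nu) = c `^ (2 * nu).
Proof.
by move=> c0; rewrite -powRM ?divr_ge0 ?(ltW a0)// divfK// gt_eqF.
Qed.

Let fine_lower (A G : R) (x y : \bar R) : 0 < A ->
  (fine x)%:E = x -> (fine y)%:E = y ->
  (A%:E + (G * A)%:E * x <= A%:E * y + (G * A)%:E)%E ->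
  1 - G * (1 - fine x) <= fine y.
Proof.
move=> A0 <- <-; rewrite -!EFinM -!EFinD lee_fin /= => H.
by rewrite -(ler_pM2l A0); lra.
Qed.

Let fine_upper (A G e : R) (x y : \bar R) : 0 < A ->
  (fine x)%:E = x -> (fine y)%:E = y ->
  (A%:E * y + (G * A)%:E <= A%:E + (G * A)%:E * x + (A * e)%:E)%E ->
  fine y <= 1 - G * (1 - fine x) + e.
Proof.
move=> A0 <- <-; rewrite -!EFinM -!EFinD lee_fin /= => H.
by rewrite -(ler_pM2l A0); lra.
Qed.

(** [V_lower] divided by a^(2 nu): by [kiter_flip] the killed harmonic function becomes the
    probability under index nu. This is one half of the relation between the two indices, in
    discrete time. *)
Lemma Dp_lower dl c n : 0 < dl -> 0 <= c ->
  1 - (c / a) `^ (2 * nu) * (1 - fine (D dl c n a)) <= fine (Dp dl c n).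
Proof.
move=> dl0 c0; apply: (@fine_lower (a `^ (2 * nu))); first by rewrite powR_gt0.
- exact: D_fin.
- exact: Dp_fin.
rewrite (powR_ratio c0); apply: le_trans (V_lower nu0 dl0 c0 n a0) _.
by apply: leeD2r; apply: eq_leye; exact: kiter_flip.
Qed.

Lemma Dp_upper c b' t : 0 < t -> 0 < b' < c -> c < a ->
  exists2 Z : R, 0 <= Z & forall n : nat,
  fine (Dp (t / 2 ^+ n) c (2 ^ n)) <=
  1 - (b' / a) `^ (2 * nu) * (1 - fine (D (t / 2 ^+ n) c (2 ^ n) a)) + Z / n.+1%:R.
Proof.
move=> t0 b'c ca; have /andP[b'0 bc] := b'c.
have c0 : 0 < c by exact: lt_trans bc.
have [K K0 HK] := overshoot_bound nu0 b'c.
exists ((b' / a) `^ (2 * nu) * K * t ^+ 2) => [|n].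
  by apply: mulr_ge0; [rewrite mulr_ge0// powR_ge0|exact: sqr_ge0].
set dl := t / 2 ^+ n.
have p2 : 0 < (2 : R) ^+ n by rewrite exprn_gt0.
have dl0 : 0 < dl by rewrite divr_gt0.
have small : (2 ^ n)%:R * (K * dl ^+ 2) <= K * t ^+ 2 / n.+1%:R.
  have -> : (2 ^ n)%:R * (K * dl ^+ 2) = K * t ^+ 2 / 2 ^+ n.
    by rewrite /dl natrX; field; rewrite gt_eqF.
  rewrite ler_wpM2l ?(mulr_ge0 K0) ?sqr_ge0//.
  by rewrite lef_pV2 ?posrE// -natrX ler_nat ltn_expl.
have G0 : 0 <= (b' / a) `^ (2 * nu) by exact: powR_ge0.
have A0 : 0 < a `^ (2 * nu) by rewrite powR_gt0.
apply: (@le_trans _ _ (1 - (b' / a) `^ (2 * nu) * (1 - fine (D dl c (2 ^ n) a)) +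
    (b' / a) `^ (2 * nu) * ((2 ^ n)%:R * (K * dl ^+ 2)))).
  apply: (@fine_upper _ _ _ _ _ A0); [exact: (D_fin _ dl0 (ltW c0) a0)|exact: (Dp_fin _ dl0 (ltW c0))|].
  rewrite (powR_ratio (ltW b'0)).
  have -> : a `^ (2 * nu) * ((b' / a) `^ (2 * nu) * ((2 ^ n)%:R * (K * dl ^+ 2))) =
      b' `^ (2 * nu) * (2 ^ n)%:R * (K * dl ^+ 2).
    by rewrite -(powR_ratio (ltW b'0)); ring.
  apply: le_trans (@V_upper R nu nu0 dl c dl0 (ltW c0) b' K (2 ^ n) a b'c K0
    (fun x cx => HK dl x dl0 cx) ca).
  apply: leeD2r; apply: eq_leye; apply: esym.
  exact: (kiter_flip nu0 (2 ^ n) dl0 (ltW c0) a0).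
have -> : (b' / a) `^ (2 * nu) * K * t ^+ 2 / n.+1%:R =
  (b' / a) `^ (2 * nu) * (K * t ^+ 2 / n.+1%:R) by ring.
by rewrite lerD2l ler_wpM2l.
Qed.

Lemma hit_plus_lower b r t : bessel_law nu a P -> 0 < t -> 0 <= b -> b < a ->
  1 - (b / a) `^ (2 * nu) * (1 - hit_lb a b r t) <= u b t.
Proof.
move=> lawP t0 b0 ba.
pose A := C * a `^ (2 * nu) * (1 + (2 ^+ r)^-1) `^ (- nu) *
      expR (- (a ^+ 2 / (2 * ((1 + (2 ^+ r)^-1) * t)))).
pose B := C ^+ 2 * a `^ (2 * nu) * ((2 ^+ r)^-1 `^ (- nu)) ^+ 2 * t `^ (- nu).
(* The prefactor makes the bound quadratic in c^(2 nu); the double sign puts the inner factor in the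
   form of [continuous_affine]. *)
pose f w := 1 - (a `^ (2 * nu))^-1 * (w * ((1 - t `^ (- nu) * A) - (- (t `^ (- nu) * (C + B))) * w)).
have a1 : a `^ (2 * nu) != 0 by rewrite gt_eqF ?powR_gt0.
have fE c : 0 <= c -> 1 - (c / a) `^ (2 * nu) * (1 - hit_lb a c r t) = f (c `^ (2 * nu)).
  move=> c0; rewrite /f -(powR_ratio c0) /hit_lb -(powR_ratio c0) -/A.
  by rewrite /B; move: (a `^ _) a1 => a2 a1'; field.
rewrite fE//; apply: (le_right_limit (a := a)) => //.
  move=> w; apply: cvgB; first exact: cvg_cst.
  apply: cvgM; first exact: cvg_cst.
  by apply: cvgM; [exact: cvg_id|exact: continuous_affine].
move=> c /andP[bc ca]; have c0 : 0 <= c by exact: le_trans (ltW bc).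
rewrite -fE// -lee_fin prob_fin//; apply: (law_hit_lower (n0 := r) lawP t0 b0 bc ca) => n rn.
have dl0 : 0 < t / 2 ^+ n by rewrite divr_gt0// exprn_gt0.
rewrite -Dp_fin// lee_fin; apply: le_trans (Dp_lower _ dl0 c0).
rewrite lerD2l lerN2 ler_wpM2l ?powR_ge0// lerD2l lerN2 -lee_fin D_fin//.
exact: D_lower.
Qed.

Lemma hit_plus_upper b t : bessel_law nu a P -> 0 < t -> 0 <= b -> b < a ->
  u b t <= 1 - (b / a) `^ (2 * nu) * (1 - hit_ub a b t).
Proof.
move=> lawP t0 b0 ba; move: (b0); rewrite le_eqVlt => /predU1P[<-|b1].
  (* For b = 0 the right-hand side is 1. *)
  rewrite mul0r powR0 ?gt_eqF// mul0r subr0.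
  by have /andP[] := prob_ge0 0 t0.
have a1 : 0 < a `^ (2 * nu) by rewrite powR_gt0.
pose al := t `^ (- nu) * (C * a `^ (2 * nu)).
pose be := t `^ (- nu) * C * expR (- (b ^+ 2 / t)) * (1 - C * a `^ (2 * nu) * (t / 2) `^ (- nu)).
pose f w := 1 - (a `^ (2 * nu))^-1 * (w * ((1 - al) - (- be) * w)).
have fE w : f w = 1 - w / a `^ (2 * nu) * (1 - (al - be * w)) by rewrite /f; ring.
have ratio c : 0 <= c -> (c / a) `^ (2 * nu) = c `^ (2 * nu) / a `^ (2 * nu).
  by move=> c0; rewrite -(powR_ratio c0) mulfK// gt_eqF.
have -> : 1 - (b / a) `^ (2 * nu) * (1 - hit_ub a b t) = f (b `^ (2 * nu)).
  by rewrite fE ratio// /hit_ub /al /be; ring.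
apply: le_left_limit => //.
  move=> w; apply: cvgB; first exact: cvg_cst.
  apply: cvgM; first exact: cvg_cst.
  by apply: cvgM; [exact: cvg_id|exact: continuous_affine].
move=> b' b'b; have /andP[b'0 _] := b'b.
have [Z Z0 HZ] := Dp_upper t0 b'b ba; have [Y Y0 HY] := D_upper t0 b'b ba.
have G0 : 0 <= (b' / a) `^ (2 * nu) by exact: powR_ge0.
apply: (@le_of_harmonic _ _ (Z + (b' / a) `^ (2 * nu) * Y)) => [|n].
  by rewrite addr_ge0// mulr_ge0.
have dl0 k : 0 < t / 2 ^+ k by rewrite divr_gt0// exprn_gt0.
have U : u b t <= fine (Dp (t / 2 ^+ n.+1) b (2 ^ n.+1)).
  by rewrite -lee_fin prob_fin// Dp_fin//; exact: law_hit_upper.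
apply: (le_trans U); apply: (le_trans (HZ n.+1)).
(* [D_upper] speaks of the grid of index n + 1, so [Dp_upper] is taken there too and its error is
   brought to the same denominator. *)
have Zn : Z / n.+2%:R <= Z / n.+1%:R.
  by rewrite ler_wpM2l// lef_pV2 ?posrE// ler_nat.
move: (HY n); rewrite -D_fin// lee_fin.
rewrite fE -(ratio _ (ltW b'0)); move: (fine _) => d Hd.
have {}Hd : d <= al - be * b' `^ (2 * nu) + Y / n.+1%:R.
  by apply: (le_trans Hd); rewrite /al /be le_eqVlt; apply/orP; left; apply/eqP; ring.
have {}Hd := ler_wpM2l G0 Hd.
have -> : (Z + (b' / a) `^ (2 * nu) * Y) / n.+1%:R = Z / n.+1%:R + (b' / a) `^ (2 * nu) * (Y / n.+1%:R).
  by ring.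
rewrite /=; move: Hd Zn.
move: (_ `^ _) (al - _) (Y / _) (Z / _) (Z / _) => g w y z z'.
rewrite mulrDr => Hd Zn; lra.
Qed.

End laws.

Lemma powR_mulN t : 0 < t -> t `^ nu * t `^ (- nu) = 1.
Proof. by move=> t0; rewrite -powRD ?subrr ?powRr0// (gt_eqF t0) implybT. Qed.

Lemma cvg_divy (k : R) : k / t @[t --> +oo] --> 0.
Proof.
rewrite -[0](mulr0 k); apply: cvgM; first exact: cvg_cst.
apply: cvg_trans (powRN_cvgy (@ltr01 R)); apply: near_eq_cvg; near=> t.
have t0 : 0 <= t by near: t; apply: nbhs_pinfty_ge; exact: num_real.
by rewrite powR_inv1.
Unshelve. all: by end_near. Qed.

Lemma cvg_expR_divy (k : R) : expR (- (k / t)) @[t --> +oo] --> (1 : R).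
Proof.
rewrite -[X in _ --> X]expR0 -[0]oppr0.
apply: (@cvg_comp _ _ _ (fun t => - (k / t)) expR _ (nbhs (- 0))).
  by apply: cvgN; exact: cvg_divy.
exact: continuous_expR.
Qed.

Lemma powRN_half_cvgy : (t / 2) `^ (- nu) @[t --> +oo] --> 0.
Proof.
apply: (@cvg_comp _ _ _ (fun t => t / 2) (fun s => s `^ (- nu)) _ +oo); last exact: powRN_cvgy.
by apply: gt0_cvgMly => //; exact: cvg_id.
Qed.

Lemma hit_ub_cvg a b :
  t `^ nu * hit_ub a b t @[t --> +oo] --> C * (a `^ (2 * nu) - b `^ (2 * nu)).
Proof.
pose g t := C * a `^ (2 * nu) - C * b `^ (2 * nu) * expR (- (b ^+ 2 / t)) *
  (1 - C * a `^ (2 * nu) * (t / 2) `^ (- nu)).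
have -> : C * (a `^ (2 * nu) - b `^ (2 * nu)) =
    C * a `^ (2 * nu) - C * b `^ (2 * nu) * 1 * (1 - C * a `^ (2 * nu) * 0) by ring.
have gc : g t @[t --> +oo] -->
    C * a `^ (2 * nu) - C * b `^ (2 * nu) * 1 * (1 - C * a `^ (2 * nu) * 0).
  apply: cvgB; first exact: cvg_cst.
  apply: cvgM; first by apply: cvgM; [exact: cvg_cst|exact: cvg_expR_divy].
  apply: cvgB; first exact: cvg_cst.
  by apply: cvgM; [exact: cvg_cst|exact: powRN_half_cvgy].
apply: cvg_trans gc; apply: near_eq_cvg; near=> t.
have t0 : 0 < t by near: t; apply: nbhs_pinfty_gt; exact: num_real.
by rewrite /hit_ub mulrA powR_mulN// mul1r.
Unshelve. all: by end_near. Qed.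

Lemma hit_lb_cvg a b r :
  t `^ nu * hit_lb a b r t @[t --> +oo] -->
    C * (a `^ (2 * nu) * (1 + (2 ^+ r)^-1) `^ (- nu) - b `^ (2 * nu)).
Proof.
pose ep : R := (2 ^+ r)^-1; rewrite -/ep.
have ep0 : 0 < ep by rewrite invr_gt0 exprn_gt0.
pose K := C ^+ 2 * a `^ (2 * nu) * b `^ (2 * nu) * (ep `^ (- nu)) ^+ 2.
pose g t := C * a `^ (2 * nu) * (1 + ep) `^ (- nu) *
    expR (- (a ^+ 2 / (2 * (1 + ep)) / t)) - C * b `^ (2 * nu) - K * t `^ (- nu).
have -> : C * (a `^ (2 * nu) * (1 + ep) `^ (- nu) - b `^ (2 * nu)) =
    C * a `^ (2 * nu) * (1 + ep) `^ (- nu) * 1 - C * b `^ (2 * nu) - K * 0 by ring.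
have gc : g t @[t --> +oo] -->
    C * a `^ (2 * nu) * (1 + ep) `^ (- nu) * 1 - C * b `^ (2 * nu) - K * 0.
  apply: cvgB; last by apply: cvgM; [exact: cvg_cst|exact: powRN_cvgy].
  apply: cvgB; last exact: cvg_cst.
  by apply: cvgM; [exact: cvg_cst|exact: cvg_expR_divy].
apply: cvg_trans gc; apply: near_eq_cvg; near=> t.
have t0 : 0 < t by near: t; apply: nbhs_pinfty_gt; exact: num_real.
rewrite /hit_lb mulrA powR_mulN// mul1r /g /K -/ep.
have -> : a ^+ 2 / (2 * ((1 + ep) * t)) = a ^+ 2 / (2 * (1 + ep)) / t.
  by field; rewrite !gt_eqF// addr_gt0.
by [].
Unshelve. all: by end_near. Qed.

Lemma cvg_powR_dyadic : (1 + (2 ^+ r)^-1) `^ (- nu) @[r --> \oo] --> (1 : R).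
Proof.
have e1 : (1 + 0 : R) `^ (- nu) = 1 by rewrite addr0 powR1.
rewrite -[X in _ --> X]e1.
apply: (@cvg_comp _ _ _ (fun r : nat => 1 + (2 ^+ r)^-1) (fun x : R => x `^ (- nu)) _ (nbhs (1 + 0 : R))).
  apply: cvgD; first exact: cvg_cst.
  under eq_fun do rewrite -exprVn.
  by apply: cvg_expr; rewrite ger0_norm// invf_lt1// ltr1n.
by apply: continuous_powR_pos; rewrite addr0.
Qed.

(** The lower bounds miss the limit by the factor (1 + 2^-r)^(- nu) on the tail from [a]; a fixed
    [r] makes this gap small before [t] grows. The factor [G] lets one statement serve both indices:
    it is 1 for - nu and (b / a)^(2 nu) for nu. *)
Lemma hit_squeeze a b (f : R -> R) (G : R) : 0 <= G ->
  (forall t, 0 < t -> f t <= G * hit_ub a b t) ->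
  (forall r t, 0 < t -> G * hit_lb a b r t <= f t) ->
  t `^ nu * f t @[t --> +oo] --> G * (C * (a `^ (2 * nu) - b `^ (2 * nu))).
Proof.
move=> G0 Hu Hl; set l := C * _.
pose lr (r : nat) := C * (a `^ (2 * nu) * (1 + (2 ^+ r)^-1) `^ (- nu) - b `^ (2 * nu)).
have lrl : G * lr r @[r --> \oo] --> G * l.
  apply: cvgM; first exact: cvg_cst.
  apply: cvgM; first exact: cvg_cst.
  apply: cvgB; last exact: cvg_cst.
  rewrite -[X in _ --> X](mulr1 (a `^ _)).
  by apply: cvgM; [exact: cvg_cst|exact: cvg_powR_dyadic].
apply/cvgrPdist_le => e e0; have e20 : 0 < e / 2 by rewrite divr_gt0.
have /cvgrPdist_le /(_ _ e20) [r0 _ /(_ r0 (leqnn _)) Hr] := lrl.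
have cu : G * (t `^ nu * hit_ub a b t) @[t --> +oo] --> G * l.
  by apply: cvgM; [exact: cvg_cst|exact: hit_ub_cvg].
have cl : G * (t `^ nu * hit_lb a b r0 t) @[t --> +oo] --> G * lr r0.
  by apply: cvgM; [exact: cvg_cst|exact: hit_lb_cvg].
have /cvgrPdist_le /(_ _ e20) Nu := cu; have /cvgrPdist_le /(_ _ e20) Nl := cl.
near=> t.
have t0 : 0 < t by near: t; apply: nbhs_pinfty_gt; exact: num_real.
have : `|G * l - G * (t `^ nu * hit_ub a b t)| <= e / 2 by near: t.
have : `|G * lr r0 - G * (t `^ nu * hit_lb a b r0 t)| <= e / 2 by near: t.
move: Hr; rewrite !ler_norml => /andP[r1 r2] /andP[l1 l2] /andP[u1 u2].
have p0 : 0 <= t `^ nu by exact: powR_ge0.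
have := ler_wpM2l p0 (Hu t t0); have := ler_wpM2l p0 (Hl r0 t t0).
rewrite ![t `^ nu * (G * _)]mulrCA => h1 h2.
by apply/andP; split; lra.
Unshelve. all: by end_near. Qed.

End asymptotics.

(** * Tail limits for the two indices *)

Lemma bessel_minus_tail (R : realType) (nu a b : R) (P : probability (Omega R) R) :
  0 < nu -> 0 < a -> 0 <= b -> b < a -> bessel_law (- nu) a P ->
  ((t `^ nu)%:E * P [set w : Omega R | (t%:E < hit b w)%E])%E @[t --> +oo] -->
    ((2 `^ nu * Gamma (nu + 1))^-1 * a `^ (2 * nu) * (1 - (b / a) `^ (2 * nu)))%:E.
Proof.
move=> nu0 a0 b0 ba lawP.
have E : (2 `^ nu * Gamma (nu + 1))^-1 * a `^ (2 * nu) * (1 - (b / a) `^ (2 * nu)) =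
    1 * (tail_const nu * (a `^ (2 * nu) - b `^ (2 * nu))).
  by rewrite -/(tail_const nu) -(powR_ratio nu a0 b0); ring.
rewrite E; have := @hit_squeeze R nu nu0 a b (fun t => fine (P [set w | (t%:E < hit b w)%E])) 1 ler01.
move=> /(_ _ _)/wrap[t t0|r t t0|H].
- by rewrite mul1r; exact: hit_minus_upper.
- by rewrite mul1r; exact: hit_minus_lower.
have tP : \forall t \near +oo, (t `^ nu * fine (P [set w | (t%:E < hit b w)%E]))%:E =
    ((t `^ nu)%:E * P [set w : Omega R | (t%:E < hit b w)%E])%E.
  near=> t; have t0 : 0 < t by near: t; apply: nbhs_pinfty_gt; exact: num_real.
  by rewrite EFinM prob_fin.
apply: cvg_trans (near_eq_cvg tP) _.
by apply: cvg_EFin => //; near=> t.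
Unshelve. all: by end_near. Qed.

Section bessel_plus.
Context (R : realType).
Variables (nu a b : R) (P : probability (Omega R) R).
Hypotheses (nu0 : 0 < nu) (a0 : 0 < a) (b0 : 0 <= b) (ba : b < a).
Hypothesis lawP : bessel_law nu a P.

Let G := (b / a) `^ (2 * nu).
Let u t := fine (P [set w : Omega R | (t%:E < hit b w)%E]).

(** The relation between the indices makes the excess over 1 - G equal, up to the bounds, to [G]
    times the tail for index - nu. That 1 - G is the probability of never reaching [b] is deduced
    from this limit. *)
Lemma bessel_plus_deficit :
  t `^ nu * (u t - (1 - G)) @[t --> +oo] -->
    G * (tail_const nu * (a `^ (2 * nu) - b `^ (2 * nu))).
Proof.
apply: hit_squeeze => // [|t t0|r t t0]; first exact: powR_ge0.
  by have := hit_plus_upper nu0 a0 lawP t0 b0 ba; rewrite -/G -/(u t); lra.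
by have := hit_plus_lower nu0 a0 r lawP t0 b0 ba; rewrite -/G -/(u t); lra.
Qed.

(** Multiplying the limit of the scaled excess by t^(- nu) shows that P (tau_b > t) tends to 1 - G.
    Along the integers the same probabilities decrease to that of never hitting, and limits are
    unique. *)
Lemma bessel_plus_escape : P [set w : Omega R | hit b w = +oo%E] = (1 - G)%:E.
Proof.
set L := G * (tail_const nu * (a `^ (2 * nu) - b `^ (2 * nu))).
have uc : u t @[t --> +oo] --> 1 - G.
  have : t `^ (- nu) * (t `^ nu * (u t - (1 - G))) + (1 - G) @[t --> +oo] --> 0 * L + (1 - G).
    apply: cvgD; last exact: cvg_cst.
    by apply: cvgM; [exact: powRN_cvgy|exact: bessel_plus_deficit].
  rewrite mul0r add0r; apply: cvg_trans; apply: near_eq_cvg; near=> t.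
  have t0 : 0 < t by near: t; apply: nbhs_pinfty_gt; exact: num_real.
  by rewrite mulrA [_ * t `^ nu]mulrC powR_mulN// mul1r subrK.
have nc : n.+1%:R @[n --> \oo] --> (+oo : set_system R).
  by apply/cvgryPge => A; near=> n; rewrite (le_trans (ltW (truncnS_gt A)))// ler_nat ltnS;
    near: n; exact: nbhs_infty_ge.
have unc : u n.+1%:R @[n --> \oo] --> 1 - G by exact: (cvg_comp _ _ nc uc).
apply: (cvg_unique _ (@cvg_hit_infinity R P b)) => //.
have nP : \forall n \near \oo, (u n.+1%:R)%:E = P [set w : Omega R | (n.+1%:R%:E < hit b w)%E].
  by near=> n; exact: prob_fin.
apply: cvg_trans (near_eq_cvg nP) _.
by apply: cvg_EFin => //; near=> n.
Unshelve. all: by end_near. Qed.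

Lemma bessel_plus_tail :
  ((t `^ nu)%:E * P [set w : Omega R | (t%:E < hit b w)%E /\ (hit b w < +oo)%E])%E
    @[t --> +oo] -->
    ((2 `^ nu * Gamma (nu + 1))^-1 * b `^ (2 * nu) * (1 - (b / a) `^ (2 * nu)))%:E.
Proof.
(* Since G a^(2 nu) = b^(2 nu), the factor [G] replaces a^(2 nu) by b^(2 nu) in the constant
   obtained for index - nu. *)
have -> : (2 `^ nu * Gamma (nu + 1))^-1 * b `^ (2 * nu) * (1 - (b / a) `^ (2 * nu)) =
    G * (tail_const nu * (a `^ (2 * nu) - b `^ (2 * nu))).
  by rewrite -/(tail_const nu) -/G -(powR_ratio nu a0 b0) -/G; ring.
have tP : \forall t \near +oo, (t `^ nu * (u t - (1 - G)))%:E =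
    ((t `^ nu)%:E * P [set w : Omega R | (t%:E < hit b w)%E /\ (hit b w < +oo)%E])%E.
  near=> t; have t0 : 0 < t by near: t; apply: nbhs_pinfty_gt; exact: num_real.
  by rewrite hit_gt_finite// bessel_plus_escape -prob_fin// -EFinB -EFinM.
apply: cvg_trans (near_eq_cvg tP) _.
by apply: cvg_EFin; [near=> t|exact: bessel_plus_deficit].
Unshelve. all: by end_near. Qed.

End bessel_plus.

Theorem theorem2p1 (R : realType) (nu a b : R) :
  0 < nu -> 0 < a -> 0 <= b -> b < a ->
  (forall P : probability (Omega R) R, bessel_law nu a P ->
     ((t `^ nu)%:E * P [set w : Omega R | (t%:E < hit b w)%E /\ (hit b w < +oo)%E])%E
       @[t --> +oo]
     --> ((2 `^ nu * Gamma (nu + 1))^-1 * b `^ (2 * nu)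
            * (1 - (b / a) `^ (2 * nu)))%:E)
  /\
  (forall P : probability (Omega R) R, bessel_law (- nu) a P ->
     ((t `^ nu)%:E * P [set w : Omega R | (t%:E < hit b w)%E])%E
       @[t --> +oo]
     --> ((2 `^ nu * Gamma (nu + 1))^-1 * a `^ (2 * nu)
            * (1 - (b / a) `^ (2 * nu)))%:E).
Proof.
move=> nu0 a0 b0 ba; split=> P lawP.
  exact: bessel_plus_tail.
exact: bessel_minus_tail.
Qed.
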